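(* The restless bandit model of the context (standing assumptions (A1)–(A7) and (B1)–(B3)) is indexable: the set of states $(p,h)\in[0,1]\times\mathbb H$ where the safe arm is optimal is increasing in the payoff $k$ of the safe arm. That is, if $S_k\subseteq[0,1]\times\mathbb H$ denotes the set of states where the safe arm is optimal when the safe payoff is $k$ (all other model data, i.e. $\rho,\beta_H,\beta_R,\sigma_R,K_R$, being fixed), then $k\le k'$ implies $S_k\subseteq S_{k'}$.
   Context: Conventions. $\mathbb U=\mathbb X=\{0,1\}$, $\mathbb Y=\mathbb H\times\mathbb R$ with $\mathbb H=\mathbb R$, so $y=(h,r)$ and observation processes are $Y=(H,R)$; $\rho>0$; $\chi\colon\mathbb Y\to\mathbb Y$ is a fixed bounded continuous function that is the identity near $0$, with $\chi(0,r)=(0,\chi_R(r))$. All filtrations are complete; $\{\mathcal F^Y_t\}$ is the completed filtration generated by $Y$. $C^2_b$ denotes functions that are bounded and continuous together with their derivatives up to order 2 in the continuous variables. $D_{S}[0,\infty)$ is Skorokhod space. Data. Functions $b\colon\mathbb U\times\mathbb X\times\mathbb Y\to\mathbb R$, $\beta\colon\mathbb U\times\mathbb X\times\mathbb Y\to\mathbb Y$, $\sigma^2\colon\mathbb U\times\mathbb Y\to\mathbb Y\otimes\mathbb Y$, a transition kernel $K(u,x,y,dz)$ from $\mathbb U\times\mathbb X\times\mathbb Y$ to $\mathbb Y\setminus\{0\}$, and functions $\phi_1\colon\mathbb U\times\mathbb Y\to\mathbb Y$, $\phi_2\colon\mathbb U\times\mathbb Y\times\mathbb Y\to\mathbb R$.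 Put $\bar b(u,p,y)=p\,b(u,1,y)+(1-p)b(u,0,y)$, $\bar\beta(u,p,y)=p\beta(u,1,y)+(1-p)\beta(u,0,y)$, $\bar K(u,p,y,dz)=pK(u,1,y,dz)+(1-p)K(u,0,y,dz)$, and $j(u,p,y,z)=\frac{p\phi_2(u,y,z)}{p\phi_2(u,y,z)+(1-p)(2-\phi_2(u,y,z))}-p$, with $j=0$ if $p\in\{0,1\}$. Operators. For $f\in\mathcal D(\mathcal A)=C_b^2(\mathbb X\times\mathbb Y)$, $$\mathcal Af(u,x,y)=\partial_yf(x,y)\beta(u,x,y)+\tfrac12\partial_y^2f(x,y)\sigma^2(u,y)+\int_{\mathbb Y}\big(f(x,y+z)-f(x,y)-\partial_yf(x,y)\chi(z)\big)K(u,x,y,dz).$$ For $f\in\mathcal D(\mathcal G)=C_b^2([0,1]\times\mathbb Y)$, $$\begin{aligned}\mathcal Gf(u,p,y)=\;&\partial_yf\,\bar\beta(u,p,y)+\tfrac12\partial_p^2f\,p^2(1-p)^2\phi_1^\top\sigma^2\phi_1(u,y)+\partial_p\partial_yf\,p(1-p)\sigma^2\phi_1(u,y)+\tfrac12\partial_y^2f\,\sigma^2(u,y)\\&+\int_{\mathbb Y}\big(f(p+j(u,p,y,z),y+z)-f(p,y)-\partial_pf(p,y)j(u,p,y,z)-\partial_yf(p,y)\chi(z)\big)\bar K(u,p,y,dz),\end{aligned}$$ with derivatives of $f$ evaluated at $(p,y)$. Martingale problems. Let $F$ be a càglàd adapted $\mathbb U$-valued process on $D_{\mathbb Y}[0,\infty)$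 with its canonical filtration. $(X,Y,T)$ solves the stopped martingale problem for $(\mathcal A,F)$ if for some filtration $\{\mathcal F_t\}$, $X$ is an $\mathcal F_0$-measurable $\mathbb X$-valued random variable, $Y$ is a càdlàg adapted $\mathbb Y$-valued process, $T$ is a stopping time, and $f(X,Y_{t\wedge T})-f(X,Y_0)-\int_0^{t\wedge T}\mathcal Af(F(Y)_s,X,Y_s)ds$ is an $\{\mathcal F_t\}$-martingale for all $f\in\mathcal D(\mathcal A)$. If $T=\infty$ a.s., $(X,Y)$ solves the martingale problem; $(X,Y)$ solves the local martingale problem if, for one filtration, there are stopping times $T_n\to\infty$ a.s. such that each $(X,Y,T_n)$ solves the stopped problem. Local uniqueness holds if for any two solutions $(X',Y',T')$, $(X'',Y'',T'')$ of the stopped problem with equal laws of $(X',Y'_0)$ and $(X'',Y''_0)$ there is a solution $(X,Y,S'\vee S'')$ of the stopped problem such that $(X,Y_{\cdot\wedge S'},S')$ has the law of $(X',Y'_{\cdot\wedge T'},T')$ and $(X,Y_{\cdot\wedge S''},S'')$ has the law of $(X'',Y''_{\cdot\wedge T''},T'')$. The problem is well-posed if local uniqueness holds and for every probability measure $\nu$ on $\mathbb X\times\mathbb Y$ there is a solution of the local martingale problem with $(X,Y_0)\sim\nu$. The martingale problem for $(\mathcal G,F)$ ($F$ on $D_{[0,1]\times\mathbb Y}[0,\infty)$) and its well-posedness are defined analogously for càdlàg $[0,1]\times\mathbb Y$-valued $(P,Y)$, using $f(P_t,Y_t)-f(P_0,Y_0)-\int_0^t\mathcal Gf(F(P,Y)_s,P_s,Y_s)ds$,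 $f\in\mathcal D(\mathcal G)$. Controls. A control with partial observations is a tuple $(U,X,Y)$ with $U=F(Y)$ for some càglàd adapted $\mathbb U$-valued process $F$ on $D_{\mathbb Y}[0,\infty)$ (with its canonical filtration) such that the martingale problem for $(\mathcal A,F)$ is well-posed and $(X,Y)$ solves it; its value is $\mathbb E\int_0^\infty\rho e^{-\rho t}b(U_t,X,Y_t)dt$. A separated control is a tuple $(U,P,Y)$ such that for some filtration, $U$ is adapted càglàd $\mathbb U$-valued, $(P,Y)$ is adapted càdlàg $[0,1]\times\mathbb Y$-valued, and $f(P_t,Y_t)-f(P_0,Y_0)-\int_0^t\mathcal Gf(U_s,P_s,Y_s)ds$ is a martingale for all $f\in\mathcal D(\mathcal G)$; its value is $\mathbb E\int_0^\infty\rho e^{-\rho t}\bar b(U_t,P_t,Y_t)dt$. $V^{\mathrm{p.o.}}(p,y)$ is the supremum of the values of controls with partial observations with $\mathbb E[X]=p$, $Y_0=y$; $V^{\mathrm{se.}}(p,y)$ is the supremum of the values of separated controls with $P_0=p$, $Y_0=y$. Under the standing assumptions the two coincide and do not depend on $r$; the common value function is $V(p,h)$ (written $V_k$ to stress the dependence on $k$). The safe arm ($u=0$) is optimal in state $(p,h)$ if the control $U\equiv0$, whose value is $k$, attains the value function, i.e. $V_k(p,h)\le k$. Standing assumptions. (A1) $b(u,x,y)$, $\beta(u,x,y)$, $\sigma^2(u,y)$, $\int(|z|^2\wedge1)K(u,x,y,dz)$ are measurable and bounded. (A2) $\phi_2(u,y,z)=\frac{K(u,1,y,dz)}{(K(u,1,y,dz)+K(u,0,y,dz))/2}$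 (Radon–Nikodym density) and $\sigma^2(u,y)\phi_1(u,y)=\beta(u,1,y)-\beta(u,0,y)-\int_{\mathbb Y}(\phi_2(u,y,z)-1)\chi(z)\,(K(u,1,y,dz)+K(u,0,y,dz))$. (A3) $\Phi(u,y)=\tfrac18\phi_1^\top\sigma^2\phi_1(u,y)+\int_{\mathbb Y}\big(1-\sqrt{\phi_2(u,y,z)(2-\phi_2(u,y,z))}\big)(K(u,1,y,dz)+K(u,0,y,dz))$ is bounded in $(u,y)$. (A4) $\beta(u,x,y)$, $\sigma^2(u,y)$, $\phi_1(u,y)$ and $\int_{\mathbb Y}g(j(u,p,y,z),z)\bar K(u,p,y,dz)$ are continuous in $(y,u)$ for all $x\in\mathbb X$, $p\in[0,1]$ and all $g\in C_b([-1,1]\times\mathbb Y)$ with $g(w)=O(|w|^2)$ as $|w|\to0$. (A5) $\lim_{a\to\infty}\sup_{u,x,y}K(u,x,y,\{|z|>a\})=0$. (A6) The martingale problem for $(\mathcal A,F)$ is well-posed for every deterministic càglàd $F\colon[0,\infty)\to\mathbb U$. (A7) The martingale problem for $(\mathcal G,u)$ is well-posed for every constant $u\in\mathbb U$. (B1) There are $k\in\mathbb R$, $\beta_H\colon\mathbb U\times\mathbb H\to\mathbb H$, $\beta_R\colon\mathbb X\times\mathbb H\to\mathbb R$, $\sigma_R\colon\mathbb H\to\mathbb R$ and a kernel $K_R$ from $\mathbb X\times\mathbb H$ to $\mathbb R\setminus\{0\}$ with $\sup_{x,h}\int(|r|^2\wedge|r|)K_R(x,h,dr)<\infty$ such that $\beta(1,x,h,r)=(\beta_H(1,h),\beta_R(x,h))^\top$,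 $\beta(0,x,h,r)=(\beta_H(0,h),k)^\top$, $\sigma^2(1,h,r)=\mathrm{diag}(0,\sigma_R^2(h))$, $\sigma^2(0,h,r)=0$, $K(1,x,h,r,\cdot)=\delta_0\otimes K_R(x,h,\cdot)$, $K(0,x,h,r,\cdot)=0$. (B2) $b$ depends only on $(u,x,h)$: $b(1,x,h)=\beta_R(x,h)+\int_{\mathbb R}(r-\chi_R(r))K_R(x,h,dr)$ and $b(0,x,h)=k$. (B3) $\beta_H(0,h)\le0\le\beta_H(1,h)$ for all $h$, and $b(1,x,h)$ is non-decreasing in $x\in\mathbb X$ and in $h\in\mathbb H$. *)

(* Defs.v *)
From HB Require Import structures.
From mathcomp Require Import all_boot all_order all_algebra.
From mathcomp Require Import all_classical all_reals all_analysis.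
From mathcomp Require Import measurable_realfun.

Set Implicit Arguments.
Unset Strict Implicit.
Unset Printing Implicit Defensive.

Import Order.TTheory GRing.Theory Num.Theory.
Import numFieldNormedType.Exports.

Local Open Scope classical_set_scope.
Local Open Scope ring_scope.

(* Conventions.
   - U = X = {0,1} is [bool], with 1 = true (u = true is the risky arm).
   - Y = H * R is [R * R], y = (h, r); an element of Y (x) Y is encoded by its
     two rows. |z| is the (sup) norm of the product; the conditions in which it
     occurs do not depend on the choice of the norm.
   - Time [0,oo) is the nonnegative half of R: processes and paths are functions
     on R whose values at negative times are never used. *)

Section stochastic_bases.
Context {R : realType}.

(* Every negligible set belongs to every F_t; in particular P is complete. *)
Definition complete_filtration d (Om : measurableType d) (P : probability Om R)
    (F : R -> set (set Om)) : Prop :=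
  [/\ forall t : R, 0 <= t -> sigma_algebra setT (F t),
      forall t, 0 <= t -> F t `<=` measurable,
      forall s t, 0 <= s -> s <= t -> F s `<=` F t &
      forall t N, 0 <= t -> P.-negligible N -> F t N].

Record stoch_basis := StochBasis {
  sb_disp : measure_display;
  sb_space :> measurableType sb_disp;
  sb_prob : probability sb_space R;
  sb_filt : R -> set (set sb_space);
  sb_complete : complete_filtration sb_prob sb_filt }.
Arguments sb_filt : clear implicits.

Definition adapted (B : stoch_basis) d (E : measurableType d)
    (Z : R -> B -> E) : Prop :=
  forall (t : R) (A : set E), 0 <= t -> measurable A -> sb_filt B t (Z t @^-1` A).

Definition martingale (B : stoch_basis) (M : R -> B -> R) : Prop :=
  [/\ adapted M,
      forall t, 0 <= t -> (sb_prob B).-integrable setT (EFin \o M t) &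
      forall (s t : R) (A : set B), 0 <= s -> s <= t -> sb_filt B s A ->
        (\int[sb_prob B]_(w in A) (M t w)%:E =
         \int[sb_prob B]_(w in A) (M s w)%:E)%E].

Definition random_time (B : stoch_basis) (T : B -> \bar R) : Prop :=
  measurable_fun setT T /\ forall w, (0 <= T w)%E.

Definition stopping_time (B : stoch_basis) (T : B -> \bar R) : Prop :=
  random_time T /\
  forall t, 0 <= t -> sb_filt B t [set w | (T w <= t%:E)%E].

(* t /\ T *)
Definition min_time (t : R) (T : \bar R) : R := fine (mine t%:E T).

Definition cadlag (E : topologicalType) (z : R -> E) : Prop :=
  forall t, 0 <= t ->
    (z s @[s --> t^'+] --> z t) /\
    (0 < t -> exists l : E, z s @[s --> t^'-] --> l).

Definition caglad (E : topologicalType) (z : R -> E) : Prop :=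
  forall t, 0 <= t ->
    (0 < t -> z s @[s --> t^'-] --> z t) /\
    (exists l : E, z s @[s --> t^'+] --> l).

End stochastic_bases.
Arguments stoch_basis : clear implicits.

(* Martingale problems with state space [S] inside E, paths in [D], generator
   [L] (depending on the control value) with domain [dom], and feedback [F].
   On path spaces the Borel sigma-algebra of the Skorokhod topology is the one
   generated by the coordinate maps, which is how laws are expressed. *)
Section martingale_problems.
Context {R : realType} d (E : measurableType d).
Variables (S : set E) (D : set (R -> E)).
Variables (dom : set (E -> R)) (L : (E -> R) -> bool -> E -> R).

(* F is an adapted caglad process on D with its (raw) canonical filtration. *)
Definition path_sigma (t : R) : set (set (R -> E)) :=
  <<s D, [set C | exists s (A : set E), [/\ 0 <= s <= t, measurable A &
                    C = D `&` [set z | A (z s)]] ]>>.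

Definition adapted_feedback (F : (R -> E) -> R -> bool) : Prop :=
  (forall z, D z -> caglad (F z)) /\
  (forall t, 0 <= t -> path_sigma t (D `&` [set z | F z t])).

Definition law_sigma : set (set ((R -> E) * \bar R)) :=
  <<s [set C | (exists t (A : set E), [/\ 0 <= t, measurable A &
                  C = [set zt | A (zt.1 t)]]) \/
               (exists A : set (\bar R), measurable A /\
                  C = [set zt | A zt.2])] >>.

Definition stop (B : stoch_basis R) (Z : R -> B -> E) (T : B -> \bar R)
    (t : R) (w : B) : E := Z (min_time t (T w)) w.

(* (Z^T, T) and (Z'^T', T') have the same law. *)
Definition same_stopped_law (B : stoch_basis R) (Z : R -> B -> E)
    (T : B -> \bar R) (B' : stoch_basis R) (Z' : R -> B' -> E)
    (T' : B' -> \bar R) : Prop :=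
  forall C, law_sigma C ->
    sb_prob B [set w | C (stop Z T ^~ w, T w)] =
    sb_prob B' [set w | C (stop Z' T' ^~ w, T' w)].

Definition same_initial_law (B : stoch_basis R) (Z : R -> B -> E)
    (B' : stoch_basis R) (Z' : R -> B' -> E) : Prop :=
  forall A, measurable A ->
    sb_prob B (Z 0 @^-1` A) = sb_prob B' (Z' 0 @^-1` A).

Variable F : (R -> E) -> R -> bool.

Definition mp_process (f : E -> R) (B : stoch_basis R) (Z : R -> B -> E)
    (T : B -> \bar R) (t : R) (w : B) : R :=
  f (stop Z T t w) - f (Z 0 w) -
  \int[lebesgue_measure]_(s in `[0, min_time t (T w)])
     L f (F (Z ^~ w) s) (Z s w).

Definition stopped_solution (B : stoch_basis R) (Z : R -> B -> E)
    (T : B -> \bar R) : Prop :=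
  [/\ forall w, D (Z ^~ w), adapted Z, stopping_time T &
      forall f, dom f -> martingale (mp_process f Z T)].

Definition mp_solution (B : stoch_basis R) (Z : R -> B -> E) : Prop :=
  exists T, {ae sb_prob B, forall w, T w = +oo%E} /\ stopped_solution Z T.

Definition local_solution (B : stoch_basis R) (Z : R -> B -> E) : Prop :=
  exists T : nat -> B -> \bar R,
    {ae sb_prob B, forall w, T n w @[n --> \oo] --> +oo%E} /\
    forall n, stopped_solution Z (T n).

Definition local_uniqueness : Prop :=
  forall (B1 : stoch_basis R) Z1 T1 (B2 : stoch_basis R) Z2 T2,
    @stopped_solution B1 Z1 T1 -> @stopped_solution B2 Z2 T2 ->
    same_initial_law Z1 Z2 ->
    exists (B : stoch_basis R) (Z : R -> B -> E) (S1 S2 : B -> \bar R),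
      [/\ random_time S1, random_time S2,
          stopped_solution Z (fun w => maxe (S1 w) (S2 w)),
          same_stopped_law Z S1 Z1 T1 & same_stopped_law Z S2 Z2 T2].

Definition well_posed : Prop :=
  local_uniqueness /\
  forall nu : probability E R, nu S = 1%E ->
    exists (B : stoch_basis R) (Z : R -> B -> E),
      local_solution Z /\
      forall A, measurable A -> sb_prob B (Z 0 @^-1` A) = nu A.

End martingale_problems.

Section test_functions.
Context {R : realType}.

Definition bounded_continuous (E : topologicalType) (f : E -> R) : Prop :=
  continuous f /\ exists C : R, forall x, `|f x| <= C.

(* C^2_b on a (finite-dimensional) normed space, by directional derivatives. *)
Definition C2b (E : normedModType R) (f : E -> R) : Prop :=
  bounded_continuous f /\
  forall v : E,
    [/\ forall x, derivable f x v, bounded_continuous ('D_v f) &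
        forall w : E, (forall x, derivable ('D_v f) x w) /\
                      bounded_continuous ('D_w ('D_v f))].

End test_functions.

Section model.
Context (R : realType).
Local Notation Y := (R * R)%type.

Definition eh : Y := (1, 0).
Definition er : Y := (0, 1).

Definition dot (v w : Y) : R := v.1 * w.1 + v.2 * w.2.
Definition tens_app (s : Y * Y) (v : Y) : Y := (dot s.1 v, dot s.2 v).

Record model := Model {
  b : bool -> bool -> Y -> R;
  beta : bool -> bool -> Y -> Y;
  sigma2 : bool -> Y -> Y * Y;
  K : R.-ker (bool * bool * Y)%type ~> Y;   (* K (u, x, y) (dz) *)
  phi1 : bool -> Y -> Y;
  phi2 : bool -> Y -> Y -> R }.

Variables (rho : R) (chi : Y -> Y) (M : model).

Definition mix (p a1 a0 : R) : R := p * a1 + (1 - p) * a0.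

Definition b_bar (u : bool) (p : R) (y : Y) : R :=
  mix p (b M u true y) (b M u false y).

Definition beta_bar (u : bool) (p : R) (y : Y) : Y :=
  (mix p (beta M u true y).1 (beta M u false y).1,
   mix p (beta M u true y).2 (beta M u false y).2).

(* [Rintegral] wants a bundled measure, hence the explicit [fine] whenever
   the set function [K_bar] (a measure for 0 <= p <= 1) is integrated. *)
Definition K_bar (u : bool) (p : R) (y : Y) (A : set Y) : \bar R :=
  (p%:E * K M (u, true, y) A + (1 - p)%:E * K M (u, false, y) A)%E.

Definition K_sum (u : bool) (y : Y) : {measure set Y -> \bar R} :=
  measure_add (K M (u, true, y)) (K M (u, false, y)).

Definition j (u : bool) (p : R) (y z : Y) : R :=
  if (p == 0) || (p == 1) then 0
  else p * phi2 M u y z /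
       (p * phi2 M u y z + (1 - p) * (2 - phi2 M u y z)) - p.

(* phi1^T sigma^2 phi1 *)
Definition qform (u : bool) (y : Y) : R :=
  dot (phi1 M u y) (tens_app (sigma2 M u y) (phi1 M u y)).

Definition domA : set (bool * Y -> R) :=
  [set f | forall x, C2b (fun y => f (x, y))].

Definition genA (f : bool * Y -> R) (u : bool) (xy : bool * Y) : R :=
  let x := xy.1 in let y := xy.2 in
  let g := fun y' : Y => f (x, y') in
  let grad : Y := ('D_eh g y, 'D_er g y) in
  let s := sigma2 M u y in
  dot grad (beta M u x y)
  + 2^-1 * (  'D_eh ('D_eh g) y * s.1.1 + 'D_er ('D_eh g) y * s.1.2
            + 'D_eh ('D_er g) y * s.2.1 + 'D_er ('D_er g) y * s.2.2)
  + \int[K M (u, x, y)]_z (f (x, y + z) - f (x, y) - dot grad (chi z)).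

(* C^2_b([0,1] * Y), as restrictions of functions of C^2_b(R * Y): only values
   and derivatives on [0,1] * Y enter the martingale problem. *)
Definition domG : set (R * Y -> R) := [set f | C2b f].

Definition genG (f : R * Y -> R) (u : bool) (py : R * Y) : R :=
  let p := py.1 in let y := py.2 in
  let dp : R * Y := (1, 0) in
  let dh : R * Y := (0, eh) in
  let dr : R * Y := (0, er) in
  let grad : Y := ('D_dh f py, 'D_dr f py) in
  let mixed : Y := ('D_dh ('D_dp f) py, 'D_dr ('D_dp f) py) in
  let s := sigma2 M u y in
  dot grad (beta_bar u p y)
  + 2^-1 * 'D_dp ('D_dp f) py * (p ^+ 2 * (1 - p) ^+ 2) * qform u y
  + p * (1 - p) * dot mixed (tens_app s (phi1 M u y))
  + 2^-1 * (  'D_dh ('D_dh f) py * s.1.1 + 'D_dr ('D_dh f) py * s.1.2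
            + 'D_dh ('D_dr f) py * s.2.1 + 'D_dr ('D_dr f) py * s.2.2)
  + fine (\int[K_bar u p y]_z
      (f (p + j u p y z, y + z) - f py - 'D_dp f py * j u p y z
       - dot grad (chi z))%:E)%E.

(* X is the (constant in time) first component of Z = (X, Y). *)
Definition pathsA : set (R -> bool * Y) :=
  [set z | cadlag (fun t => (z t).2) /\
           forall t, 0 <= t -> (z t).1 = (z 0).1].

Definition stateG : set (R * Y) := [set py | 0 <= py.1 <= 1].

Definition pathsG : set (R -> R * Y) :=
  [set z | cadlag z /\ forall t, 0 <= t -> stateG (z t)].

Definition lift_feedback (F : (R -> Y) -> R -> bool)
  (z : R -> bool * Y) : R -> bool := F (fun t => (z t).2).

Definition solutionA (F : (R -> Y) -> R -> bool) (B : stoch_basis R)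
    (Z : R -> B -> bool * Y) : Prop :=
  mp_solution pathsA domA genA (lift_feedback F) Z.

Definition well_posedA (F : (R -> Y) -> R -> bool) : Prop :=
  well_posed setT pathsA domA genA (lift_feedback F).

Definition well_posedG (F : (R -> R * Y) -> R -> bool) : Prop :=
  well_posed stateG pathsG domG genG F.

(* Controls with partial observations; X w = (Z 0 w).1. *)
Definition po_value (B : stoch_basis R) (F : (R -> Y) -> R -> bool)
    (Z : R -> B -> bool * Y) : \bar R :=
  (\int[sb_prob B]_w \int[lebesgue_measure]_(t in `[0%R, +oo[)
     (rho * expR (- (rho * t)) *
      b M (F (fun s => (Z s w).2) t) (Z 0%R w).1 (Z t w).2)%:E)%E.

Definition po_values (p : R) (y : Y) : set (\bar R) :=
  [set v | exists (B : stoch_basis R) F (Z : R -> B -> bool * Y),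
    [/\ adapted_feedback [set z : R -> Y | cadlag z] F,
        well_posedA F /\ solutionA F Z,
        (\int[sb_prob B]_w ((Z 0%R w).1%:R : R)%:E = p%:E)%E,
        {ae sb_prob B, forall w, (Z 0 w).2 = y} &
        v = po_value F Z]].

Definition V_po (p : R) (y : Y) : \bar R := ereal_sup (po_values p y).

Definition separated_control (B : stoch_basis R) (U : R -> B -> bool)
    (Z : R -> B -> R * Y) : Prop :=
  [/\ adapted U, forall w, caglad (U ^~ w),
      adapted Z, forall w, pathsG (Z ^~ w) &
      forall f, domG f -> martingale (fun t w =>
        f (Z t w) - f (Z 0 w) -
        \int[lebesgue_measure]_(s in `[0, t]) genG f (U s w) (Z s w))].

Definition se_value (B : stoch_basis R) (U : R -> B -> bool)
    (Z : R -> B -> R * Y) : \bar R :=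
  (\int[sb_prob B]_w \int[lebesgue_measure]_(t in `[0%R, +oo[)
     (rho * expR (- (rho * t)) * b_bar (U t w) (Z t w).1 (Z t w).2)%:E)%E.

Definition se_values (p : R) (y : Y) : set (\bar R) :=
  [set v | exists (B : stoch_basis R) U (Z : R -> B -> R * Y),
    [/\ separated_control U Z,
        {ae sb_prob B, forall w, Z 0 w = (p, y)} & v = se_value U Z]].

Definition V_se (p : R) (y : Y) : \bar R := ereal_sup (se_values p y).

Definition bounded_meas (f : Y -> R) : Prop :=
  measurable_fun setT f /\ exists C : R, forall y, `|f y| <= C.

Definition A1 : Prop :=
  [/\ forall u x, bounded_meas (b M u x),
      forall u x, bounded_meas (fun y => (beta M u x y).1) /\
                  bounded_meas (fun y => (beta M u x y).2),
      forall u, [/\ bounded_meas (fun y => (sigma2 M u y).1.1),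
                    bounded_meas (fun y => (sigma2 M u y).1.2),
                    bounded_meas (fun y => (sigma2 M u y).2.1) &
                    bounded_meas (fun y => (sigma2 M u y).2.2)] &
      exists C : R, forall u x y,
        (\int[K M (u, x, y)]_z (Num.min (`|z| ^+ 2) 1)%:E <= C%:E)%E].

(* phi2 is a jointly measurable version of the density. *)
Definition A2 : Prop :=
  [/\ forall u, measurable_fun setT (fun yz : Y * Y => phi2 M u yz.1 yz.2),
      forall u y (A : set Y), measurable A ->
        K M (u, true, y) A = (\int[K_sum u y]_(z in A) (phi2 M u y z / 2)%:E)%E &
      forall u y, tens_app (sigma2 M u y) (phi1 M u y) =
        beta M u true y - beta M u false y -
        (\int[K_sum u y]_z ((phi2 M u y z - 1) * (chi z).1),
         \int[K_sum u y]_z ((phi2 M u y z - 1) * (chi z).2))].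

Definition A3 : Prop :=
  exists C : R, forall u y,
    (`| (8^-1 * qform u y)%:E +
        \int[K_sum u y]_z
          (1 - Num.sqrt (phi2 M u y z * (2 - phi2 M u y z)))%:E | <= C%:E)%E.

(* U is discrete, so continuity in (y,u) is continuity in y for each u. *)
Definition A4 : Prop :=
  [/\ forall u x, continuous (beta M u x),
      forall u, continuous (sigma2 M u),
      forall u, continuous (phi1 M u) &
      forall u p (g : R * Y -> R), 0 <= p <= 1 ->
        {within [set w | -1 <= w.1 <= 1], continuous g} ->
        (exists C : R, forall w, -1 <= w.1 <= 1 -> `|g w| <= C) ->
        (exists C e : R, 0 < e /\ forall w, -1 <= w.1 <= 1 -> `|w| < e ->
           `|g w| <= C * `|w| ^+ 2) ->
        continuous (fun y =>
          fine (\int[K_bar u p y]_z (g (j u p y z, z))%:E)%E)].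

Definition A5 : Prop :=
  ereal_sup [set K M uxy [set z | a < `|z|] | uxy in setT] @[a --> +oo]
    --> 0%E.

Definition A6 : Prop :=
  forall F : R -> bool, caglad F -> well_posedA (fun _ => F).

Definition A7 : Prop := forall u : bool, well_posedG (fun _ _ => u).

(* K is a kernel to Y \ {0}. *)
Definition no_null_jumps : Prop := forall uxy, K M uxy [set 0] = 0%E.

Definition standing : Prop :=
  no_null_jumps /\ [/\ A1, A2 & A3] /\ [/\ A4, A5, A6 & A7].

Definition truncation_function (chi_R : R -> R) : Prop :=
  [/\ continuous chi, exists C : R, forall z, `|chi z| <= C,
      \forall z \near (0 : Y), chi z = z &
      forall r, chi (0, r) = (0, chi_R r)].

Definition B1 (k : R) (beta_H : bool -> R -> R) (beta_R : bool -> R -> R)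
    (sigma_R : R -> R) (K_R : R.-ker (bool * R)%type ~> R) : Prop :=
  [/\ (forall xh, K_R xh [set 0] = 0%E) /\
      (exists C : R, forall xh,
        (\int[K_R xh]_r (Num.min (`|r| ^+ 2) `|r|)%:E <= C%:E)%E),
      forall x h r, beta M true x (h, r) = (beta_H true h, beta_R x h) /\
                    beta M false x (h, r) = (beta_H false h, k),
      forall h r,
        sigma2 M true (h, r) = ((0, 0), (0, sigma_R h ^+ 2)) /\
        sigma2 M false (h, r) = 0 &
      forall x h r (A : set Y), measurable A ->
        (* delta_0 (x) K_R(x,h,.) *)
        K M (true, x, (h, r)) A = K_R (x, h) [set s | A (0, s)] /\
        K M (false, x, (h, r)) A = 0%E].

Definition B2 (chi_R : R -> R) (k : R) (beta_R : bool -> R -> R)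
    (K_R : R.-ker (bool * R)%type ~> R) : Prop :=
  forall x h r,
    b M true x (h, r) = beta_R x h + \int[K_R (x, h)]_s (s - chi_R s) /\
    b M false x (h, r) = k.

Definition B3 (beta_H : bool -> R -> R) : Prop :=
  [/\ forall h, beta_H false h <= 0 <= beta_H true h,
      forall y, b M true false y <= b M true true y &
      forall x h h' r, h <= h' -> b M true x (h, r) <= b M true x (h', r)].

Definition bandit (chi_R : R -> R) (k : R) (beta_H beta_R : bool -> R -> R)
    (sigma_R : R -> R) (K_R : R.-ker (bool * R)%type ~> R) : Prop :=
  [/\ standing, B1 k beta_H beta_R sigma_R K_R, B2 chi_R k beta_R K_R &
      B3 beta_H].

(* The states (p,h) at which the safe arm, whose value is k, attains the value
   function V. Under [standing] and [B1]-[B3], V_po and V_se coincide and do not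
   depend on r, so that V can be either of them and any r can be used. *)
Definition safe_optimal (V : R -> Y -> \bar R) (k : R) : set (R * R) :=
  [set ph | 0 <= ph.1 <= 1 /\ forall r, (V ph.1 (ph.2, r) <= k%:E)%E].

End model.

(* Main.v *)
(** Let [A t] be [k' - k] times the time that a separated control of the
    [k']-model has spent on the safe arm up to time [t].  The two models have the
    same dynamics on the risky arm, and on the safe arm they differ only in the
    drift of [R], which is [k'] instead of [k].  Hence replacing [R] by [R - A]
    turns the control into one of the [k]-model, whose reward rate is smaller by
    at most [k' - k] at every time.  Since [rho e^(- rho t)] integrates to 1, its
    value drops by at most [k' - k]; if the safe arm is optimal for [k], every
    [k']-value is therefore at most [k + (k' - k) = k'].

    For the martingale problem of the shifted process, [A] is frozen on the cells
    of a fine grid: on each cell the shift is a random constant known at the left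
    end point, and the generator commutes with constant shifts of [r].  The mesh
    then tends to 0 by dominated convergence, which needs [G f] to be bounded and
    continuous under shifts.  The jump part is bounded because
    [|j| <= |phi2 - 1|] and [(phi2 - 1)^2 <= 2 (1 - sqrt (phi2 (2 - phi2)))], the
    integrand of (A3). *)

Require Import Defs.
From HB Require Import structures.
From mathcomp Require Import all_boot all_order all_algebra.
From mathcomp Require Import all_classical all_reals all_analysis.
From mathcomp Require Import measurable_realfun.
From mathcomp Require Import ring lra.

Set Implicit Arguments.
Unset Strict Implicit.
Unset Printing Implicit Defensive.

Import Order.TTheory GRing.Theory Num.Theory.
Import numFieldNormedType.Exports.
Local Open Scope classical_set_scope.
Local Open Scope ring_scope.

(** The shift is applied to separated controls, where [U] is merely an adapted process: subtracting
    an adapted clock from [R] leaves [U] admissible. A control with partial observations would have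
    to be rewritten as a feedback of the shifted observation, with a well-posed martingale problem
    of its own; the claim for [V_po] is transferred from [V_se] through their equality instead.

    [M] and [M'] carry their own versions of [phi1] and [phi2], which may depend on [r]. The
    generators are therefore compared through what kernels and drifts determine: [phi2] almost
    everywhere, the product of [sigma2] and [phi1] by (A2), and from it the quadratic form. The
    kernels may be infinite near 0, so density arguments run on the sets [{|z| > 1/(n+1)}] and are
    then glued.

    No stochastic integral appears. Freezing yields a chain rule whose correction term comes from
    the mean value theorem in the shift; this term equals the drift difference of the two
    generators. *)

Lemma bounded_integrable d (T : measurableType d) (R : realType)
    (mu : {measure set T -> \bar R}) (D : set T) (f : T -> R) (C : R) :
  measurable D -> (mu D < +oo)%E -> measurable_fun D f ->
  (forall x, D x -> `|f x| <= C) -> mu.-integrable D (EFin \o f).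
Proof.
move=> mD muD mf fC; apply: measurable_bounded_integrable => //.
by exists C; split => //; [exact: num_real|move=> M CM x Dx; exact: le_trans (fC _ Dx) (ltW CM)].
Qed.

Lemma bounded_cvg_Rintegral d (T : measurableType d) (R : realType)
    (mu : {measure set T -> \bar R}) (D : set T) (fn : nat -> T -> R) (f : T -> R)
    (C : R) :
  measurable D -> (mu D < +oo)%E -> (forall n, measurable_fun D (fn n)) ->
  (forall x, D x -> fn n x @[n --> \oo] --> f x) ->
  (forall n x, D x -> `|fn n x| <= C) ->
  \int[mu]_(x in D) fn n x @[n --> \oo] --> \int[mu]_(x in D) f x.
Proof.
move=> mD muD mfn fnf fnC; apply: fine_cvg.
have fC x : D x -> `|f x| <= C.
  move=> Dx; have /cvg_norm h := fnf _ Dx.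
  by apply: (cvgr_to_le h); apply: nearW => n; exact: fnC.
have mf : measurable_fun D f by apply: measurable_fun_cvg mfn fnf.
have intf := bounded_integrable mD muD mf fC.
rewrite fineK; last exact: integrable_fin_num.
apply: (@dominated_cvg _ _ _ mu D mD (fun n x => (fn n x)%:E) (EFin \o f) (cst C%:E)).
- by move=> n; apply/measurable_EFinP.
- by move=> x Dx; apply/cvg_EFin; [exact: nearW|exact: fnf].
- by [].
- by apply: (bounded_integrable (C := `|C|)) => //; exact: measurable_cst.
- by move=> n x Dx; rewrite lee_fin; exact: fnC.
Qed.

Lemma Rintegral_norm_le d (T : measurableType d) (R : realType)
    (mu : {measure set T -> \bar R}) (D : set T) (f : T -> R) (C : R) :
  measurable D -> (mu D < +oo)%E -> measurable_fun D f ->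
  (forall x, D x -> `|f x| <= C) -> `|\int[mu]_(x in D) f x| <= C * fine (mu D).
Proof.
move=> mD muD mf fC.
apply: (@le_trans _ _ (\int[mu]_(x in D) `|f x|)).
  by apply: le_normr_Rintegral => //; exact: (bounded_integrable (C := C)).
rewrite -Rintegral_cst//; apply: le_Rintegral => //.
  by apply: (bounded_integrable (C := C)) => //; [exact: measurableT_comp|move=> x Dx; rewrite normr_id fC].
by apply: (bounded_integrable (C := `|C|)) => //; exact: measurable_cst.
Qed.

(** * Paths with one-sided limits *)

Section one_sided_sequences.
Context {R : realType}.
Implicit Types (u : nat -> R).

Lemma cvg_right_seq {V : normedModType R} (f : R -> V) x u : f s @[s --> x^'+] --> f x ->
  (forall n, x <= u n) -> u n @[n --> \oo] --> x -> f (u n) @[n --> \oo] --> f x.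
Proof.
move=> /cvg_at_right_within fx xu ux; apply: cvg_comp fx.
by move=> A /ux[N _ hN]; exists N => // n /hN/=; apply; exact: xu.
Qed.

Lemma cvg_left_seq {V : normedModType R} (f : R -> V) x u : f s @[s --> x^'-] --> f x ->
  (forall n, u n <= x) -> u n @[n --> \oo] --> x -> f (u n) @[n --> \oo] --> f x.
Proof.
move=> /cvg_at_left_within fx xu ux; apply: cvg_comp fx.
by move=> A /ux[N _ hN]; exists N => // n /hN/=; apply; exact: xu.
Qed.

(** Both grid functions are constant on the cells [[i/(n+1), (i+1)/(n+1)[]. At a grid point
    [ceil_grid] already moves to the next one, so it is a function of the same truncation. *)
Definition floor_grid (n : nat) (t : R) : R := (Num.truncn (t * n.+1%:R))%:R / n.+1%:R.
Definition ceil_grid (n : nat) (t : R) : R := (Num.truncn (t * n.+1%:R)).+1%:R / n.+1%:R.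

Lemma floor_grid_itv n t : 0 <= t -> 0 <= floor_grid n t <= t /\ t - n.+1%:R^-1 <= floor_grid n t.
Proof.
move=> t0; have tn0 : 0 <= t * n.+1%:R by apply: mulr_ge0.
have /andP[h1 h2] := truncn_itv tn0.
have n0 : 0 < n.+1%:R :> R by [].
rewrite /floor_grid; split.
  by rewrite divr_ge0//= ler_pdivrMr.
rewrite ler_pdivlMr// mulrBl mulVf ?gt_eqF// lerBlDr; apply/ltW.
by rewrite natr1.
Qed.

Lemma ceil_grid_itv n t : 0 <= t -> t <= ceil_grid n t <= t + n.+1%:R^-1.
Proof.
move=> t0; have tn0 : 0 <= t * n.+1%:R by apply: mulr_ge0.
have /andP[h1 h2] := truncn_itv tn0.
have n0 : 0 < n.+1%:R :> R by [].
rewrite /ceil_grid ler_pdivlMr// (ltW h2)/= ler_pdivrMr// mulrDl mulVf ?gt_eqF//.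
by rewrite -natr1 lerD2r.
Qed.

Lemma cvg_shift_harmonic (x : R) : x + n.+1%:R^-1 @[n --> \oo] --> x.
Proof. by rewrite -[X in _ --> X]addr0; apply: cvgD; [exact: cvg_cst|exact: cvg_harmonic]. Qed.

Lemma cvg_shiftN_harmonic (x : R) : x - n.+1%:R^-1 @[n --> \oo] --> x.
Proof. by rewrite -[X in _ --> X]subr0; apply: cvgB; [exact: cvg_cst|exact: cvg_harmonic]. Qed.

Lemma cvg_floor_grid t : 0 <= t -> floor_grid n t @[n --> \oo] --> t.
Proof.
move=> t0; apply: (@squeeze_cvgr _ _ _ _ (fun n => t - n.+1%:R^-1) (cst t)).
- by apply: nearW => n; have [/andP[_ ->] ->] := floor_grid_itv n t0.
- exact: cvg_shiftN_harmonic.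
- exact: cvg_cst.
Qed.

Lemma cvg_ceil_grid t : 0 <= t -> ceil_grid n t @[n --> \oo] --> t.
Proof.
move=> t0; apply: (@squeeze_cvgr _ _ _ _ (cst t) (fun n => t + n.+1%:R^-1)).
- by apply: nearW => n; exact: ceil_grid_itv.
- exact: cvg_cst.
- exact: cvg_shift_harmonic.
Qed.

Context d (T : measurableType d).

(** On each time cell the map depends on [w] alone, so a preimage is a countable union of
    rectangles. *)
Lemma measurable_truncn_step (z : nat -> T -> R) (n : nat) :
  (forall k, measurable_fun setT (z k)) ->
  measurable_fun (`[0, +oo[%classic `*` setT : set (R * T))
    (fun tw : R * T => z (Num.truncn (tw.1 * n.+1%:R)) tw.2).
Proof.
move=> mz mD S mS.
have -> : (`[0, +oo[%classic `*` setT) `&`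
    ((fun tw : R * T => z (Num.truncn (tw.1 * n.+1%:R)) tw.2) @^-1` S) =
  \bigcup_k (`[k%:R / n.+1%:R, k.+1%:R / n.+1%:R[%classic `*` (z k @^-1` S)).
  have n0 : 0 < n.+1%:R :> R by [].
  apply/seteqP; split => [[t w]/= [[]]|[t w]/= [k _] [/=]].
    rewrite in_itv/= andbT => t0 _ Sz; exists (Num.truncn (t * n.+1%:R)) => //=.
    by split => //; rewrite in_itv/= ler_pdivrMr// ltr_pdivlMr// truncn_itv// mulr_ge0.
  rewrite !in_itv/= ler_pdivrMr// ltr_pdivlMr// => h; rewrite (truncn_def h).
  move=> Sz; rewrite andbT; split => //; split => //.
  by rewrite -(pmulr_lge0 _ n0); apply: le_trans (proj1 (andP h)).
apply: bigcupT_measurable => k; apply: measurableX => //.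
by rewrite -[X in measurable X]setTI; exact: mz.
Qed.

(** Sampling at a grid point to the right of [t] gives step functions that converge pointwise by
    right continuity. *)
Lemma measurable_right_continuous (z : R -> T -> R) :
  (forall t, 0 <= t -> measurable_fun setT (z t)) ->
  (forall t w, 0 <= t -> z s w @[s --> t^'+] --> z t w) ->
  measurable_fun (`[0, +oo[%classic `*` setT : set (R * T)) (fun tw : R * T => z tw.1 tw.2).
Proof.
move=> mz rz.
apply: (@measurable_fun_cvg _ _ _ _ (fun n tw => z (ceil_grid n tw.1) tw.2)).
  move=> n; apply: (measurable_truncn_step (z := fun k => z (k.+1%:R / n.+1%:R))) => k.
  exact: mz.
move=> [t w] [/=]; rewrite in_itv/= andbT => t0 _.
apply: (@cvg_right_seq _ (z ^~ w)); first exact: rz.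
  by move=> n; have /andP[] := ceil_grid_itv n t0.
exact: cvg_ceil_grid.
Qed.

Lemma measurable_left_continuous (z : R -> T -> R) :
  (forall t, 0 <= t -> measurable_fun setT (z t)) ->
  (forall t w, 0 < t -> z s w @[s --> t^'-] --> z t w) ->
  measurable_fun (`[0, +oo[%classic `*` setT : set (R * T)) (fun tw : R * T => z tw.1 tw.2).
Proof.
move=> mz rz.
apply: (@measurable_fun_cvg _ _ _ _ (fun n tw => z (floor_grid n tw.1) tw.2)).
  move=> n; apply: (measurable_truncn_step (z := fun k => z (k%:R / n.+1%:R))) => k.
  exact: mz.
move=> [t w] [/=]; rewrite in_itv/= andbT le_eqVlt => /predU1P[<- _|t0 _].
  (* At time 0 no left limit is assumed; [floor_grid n 0 = 0] makes the sequence constant there. *)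
  by rewrite /floor_grid; under eq_fun do rewrite mul0r truncn0 mul0r; exact: cvg_cst.
apply: (@cvg_left_seq _ (z ^~ w)); first exact: rz.
  by move=> n; have [/andP[]] := floor_grid_itv n (ltW t0).
exact/cvg_floor_grid/ltW.
Qed.

End one_sided_sequences.

(** * Martingale increments *)

Section filtered_space.
Context {R : realType} (B : stoch_basis R).
Local Notation P := (sb_prob B).
Local Notation F := (@sb_filt R B).

(** Phrased through the measurable space generated by [F t], so that closure under sums, products
    and limits is inherited from [measurable_fun]. *)
Definition filt_measurable d (E : measurableType d) (t : R) (X : B -> E) : Prop :=
  measurable_fun [set: g_sigma_algebraType (F t)] X.

Lemma filt_measurableP d (E : measurableType d) t (X : B -> E) : 0 <= t ->
  filt_measurable t X <->
  forall A, measurable A -> F t (X @^-1` A).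
Proof.
move=> t0; have [sF _ _ _] := sb_complete B.
have mE := measurable_g_measurableTypeE (sF _ t0).
split=> [mX A mA|mX _ A mA].
  by have := mX measurableT A mA; rewrite setTI mE.
by rewrite setTI mE; exact: mX.
Qed.

Lemma filt_measurable_filt t (A : set B) : 0 <= t ->
  measurable (A : set (g_sigma_algebraType (F t))) <-> F t A.
Proof.
move=> t0; have [sF _ _ _] := sb_complete B.
by rewrite (measurable_g_measurableTypeE (sF _ t0)).
Qed.

Lemma filt_measurableW d (E : measurableType d) s t (X : B -> E) :
  0 <= s -> s <= t -> filt_measurable s X -> filt_measurable t X.
Proof.
move=> s0 st /(filt_measurableP _ s0) mX.
apply/(filt_measurableP _ (le_trans s0 st)) => A mA.
have [_ _ mF _] := sb_complete B.
exact/(mF _ _ s0 st)/mX.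
Qed.

Lemma filt_measurable_measurable d (E : measurableType d) t (X : B -> E) :
  0 <= t -> filt_measurable t X -> measurable_fun setT X.
Proof.
move=> t0 /(filt_measurableP _ t0) mX _ A mA; rewrite setTI.
have [_ mF _ _] := sb_complete B.
exact/(mF _ t0)/mX.
Qed.

(** The last clause says that the conditional expectation given [F s] is 0. Boundedness is included
    because test functions and their generators are bounded; it makes integrability and passages to
    the limit automatic. *)
Definition mart_diff (s t : R) (X : B -> R) : Prop :=
  [/\ filt_measurable t X, exists C : R, forall w, `|X w| <= C &
      forall A, F s A -> \int[P]_(w in A) X w = 0].

Lemma filt_sub_measurable t (A : set B) : 0 <= t -> F t A -> measurable A.
Proof. by move=> t0; have [_ mF _ _] := sb_complete B; exact: mF. Qed.

Lemma prob_lty (A : set B) : measurable A -> (P A < +oo)%E.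
Proof. by move=> mA; apply: le_lt_trans (probability_le1 P mA) _; rewrite ltry. Qed.

Lemma bounded_filt_integrable t (A : set B) (X : B -> R) (C : R) : 0 <= t ->
  filt_measurable t X -> (forall w, `|X w| <= C) -> measurable A ->
  P.-integrable A (EFin \o X).
Proof.
move=> t0 mX XC mA; apply: (bounded_integrable (C := C)) => //.
- exact: prob_lty.
- exact: measurable_funS (filt_measurable_measurable t0 mX).
Qed.

Lemma mart_diff_cst0 s t : 0 <= s -> mart_diff s t (fun=> 0).
Proof.
move=> s0; split.
- exact: measurable_cst.
- by exists 0 => w; rewrite normr0.
- by move=> A /(filt_sub_measurable s0) mA; rewrite Rintegral_cst// mul0r.
Qed.

Lemma mart_diffD s t X X' : 0 <= s -> s <= t ->
  mart_diff s t X -> mart_diff s t X' -> mart_diff s t (fun w => X w + X' w).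
Proof.
move=> s0 st [mX [C XC] iX] [mX' [C' XC'] iX']; have t0 := le_trans s0 st; split.
- exact: measurable_funD.
- by exists (C + C') => w; apply: le_trans (ler_normD _ _) _; exact: lerD.
- move=> A FA; have mA := filt_sub_measurable s0 FA.
  rewrite RintegralD ?iX ?iX' ?addr0//.
  + exact: (bounded_filt_integrable (t := t) (C := C)).
  + exact: (bounded_filt_integrable (t := t) (C := C')).
Qed.

(** An earlier [s'] leaves fewer test events and a later [t'] asks for less measurability. This
    allows increments over different cells to be added over one common interval. *)
Lemma mart_diffW s t s' t' X : 0 <= s' -> s' <= s -> s <= t -> t <= t' ->
  mart_diff s t X -> mart_diff s' t' X.
Proof.
move=> s0 ss st tt [mX bX iX]; split => //.
- by apply: filt_measurableW tt mX; rewrite (le_trans s0)// (le_trans ss).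
- have [_ _ mF _] := sb_complete B.
  by move=> A FA; apply: iX; exact: mF FA.
Qed.

Lemma mart_diff_sum s t (I : Type) (r : seq I) (X : I -> B -> R) :
  0 <= s -> s <= t -> (forall i, mart_diff s t (X i)) ->
  mart_diff s t (fun w => \sum_(i <- r) X i w).
Proof.
move=> s0 st mX; elim: r => [|i r IH].
  by under eq_fun do rewrite big_nil; exact: mart_diff_cst0.
by under eq_fun do rewrite big_cons; exact: mart_diffD.
Qed.

(** The indicator is absorbed into the test event: the integral over [D] becomes one over the
    intersection of [D] and [A], which is again in [F s]. *)
Lemma mart_diff_indic s t (A : set B) X : 0 <= s -> s <= t -> F s A ->
  mart_diff s t X -> mart_diff s t (fun w => \1_A w * X w).
Proof.
move=> s0 st FA [mX [C XC] iX]; have t0 := le_trans s0 st; split.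
- apply: measurable_funM => //; apply: measurable_indic.
  apply/(filt_measurable_filt _ t0).
  by have [_ _ mF _] := sb_complete B; exact: mF FA.
- exists C => w; rewrite normrM indicE; case: (w \in A).
    by rewrite normr1 mul1r.
  by rewrite normr0 mul0r (le_trans _ (XC w)).
- move=> D FD; rewrite -[RHS](iX (D `&` A)).
    rewrite [RHS]Rintegral_mkcondr; apply: eq_Rintegral => w _.
    by rewrite patchE indicE; case: (w \in A); rewrite ?mul1r ?mul0r.
  have [sF _ _ _] := sb_complete B.
  apply/(filt_measurable_filt _ s0).
  by apply: measurableI; apply/(filt_measurable_filt _ s0).
Qed.

(** Bounded convergence on each event of [F s]. The constant [C] serves the whole sequence, whereas
    the bounds inside [mart_diff] may vary with [n]. *)
Lemma mart_diff_cvg s t (X : nat -> B -> R) (Y : B -> R) (C : R) : 0 <= s -> s <= t ->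
  (forall n, mart_diff s t (X n)) -> (forall n w, `|X n w| <= C) ->
  (forall w, X n w @[n --> \oo] --> Y w) -> mart_diff s t Y.
Proof.
move=> s0 st mX XC XY; have t0 := le_trans s0 st; split.
- by apply: (@measurable_fun_cvg _ (g_sigma_algebraType (F t)) R setT X Y) => [n|w _]; [have [] := mX n|exact: XY].
- exists C => w; have /cvg_norm h := XY w.
  by apply: (cvgr_to_le h); apply: nearW => n; exact: XC.
- move=> A FA; have mA := filt_sub_measurable s0 FA.
  have : \int[P]_(w in A) X n w @[n --> \oo] --> \int[P]_(w in A) Y w.
    apply: (bounded_cvg_Rintegral (C := C)) => //.
    + exact: prob_lty.
    + move=> n; have [mXn _ _] := mX n.
      exact: measurable_funS (filt_measurable_measurable t0 mXn).
  under eq_fun do rewrite (let: And3 _ _ h := mX _ in h A FA).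
  by move/(cvg_unique (@norm_hausdorff _ _)) => /(_ _ (cvg_cst _)).
Qed.

(* Rounding [a] down to a grid makes [X (a w) w] a finite sum of martingale increments
   multiplied by indicators of [F s]-events. *)
Lemma mart_diff_random_parameter s t (X : R -> B -> R) (a : B -> R) (C L : R) :
  0 <= s -> s <= t -> (forall c, mart_diff s t (X c)) ->
  (forall c w, `|X c w| <= C) ->
  (forall w c (cn : nat -> R), cn n @[n --> \oo] --> c ->
     X (cn n) w @[n --> \oo] --> X c w) ->
  filt_measurable s a -> (forall w, 0 <= a w <= L) ->
  mart_diff s t (fun w => X (a w) w).
Proof.
move=> s0 st mX XC cX ma aL.
apply: (mart_diff_cvg (X := fun n w => X (floor_grid n (a w)) w) (C := C)) => //; last first.
  by move=> w; apply: cX; apply: cvg_floor_grid; have /andP[] := aL w.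
move=> n; pose N := (Num.truncn (L * n.+1%:R)).+1.
have n0 : 0 < n.+1%:R :> R by [].
pose A k := a @^-1` `[k%:R / n.+1%:R, k.+1%:R / n.+1%:R[%classic.
have AE k w : (w \in A k) = (Num.truncn (a w * n.+1%:R) == k).
  have /andP[a0 _] := aL w.
  rewrite truncn_eq ?mulr_ge0//; apply/idP/idP; rewrite inE /A/= in_itv/=;
  by rewrite ler_pdivrMr// ltr_pdivlMr.
have -> : (fun w => X (floor_grid n (a w)) w) =
    (fun w => \sum_(k < N) \1_(A k) w * X (k%:R / n.+1%:R) w).
  apply/funext => w; have /andP[a0 aLw] := aL w.
  have kN : (Num.truncn (a w * n.+1%:R) < N)%N.
    rewrite /N ltnS truncn_ge_nat; last by rewrite mulr_ge0// (le_trans a0).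
    apply: le_trans (_ : a w * n.+1%:R <= _); last by rewrite ler_wpM2r.
    by rewrite truncn_le mulr_ge0.
  rewrite (bigD1 (Ordinal kN))//= big1 ?addr0.
    by rewrite indicE AE eqxx mul1r.
  move=> i; rewrite -val_eqE/= => ik; rewrite indicE AE eq_sym (negPf ik).
  by rewrite mul0r.
apply: mart_diff_sum => // k; apply: mart_diff_indic => //.
have /(filt_measurableP _ s0) := ma; apply; exact: measurable_itv.
Qed.

Lemma martingale_mart_diff (M : R -> B -> R) s t (C : R) : 0 <= s -> s <= t ->
  martingale M -> (forall w, `|M t w - M s w| <= C) ->
  mart_diff s t (fun w => M t w - M s w).
Proof.
move=> s0 st [aM iM eM] MC; have t0 := le_trans s0 st.
have mM r : 0 <= r -> filt_measurable r (M r).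
  by move=> r0; apply/(filt_measurableP _ r0) => A mA; exact: aM.
split.
- by apply: measurable_funB; [exact: mM|exact: filt_measurableW st (mM _ s0)].
- by exists C.
- move=> A FA; have mA := filt_sub_measurable s0 FA.
  rewrite RintegralB//; try by apply: integrableS (iM _ _).
  by rewrite /Rintegral (eM _ _ _ s0 st FA) subrr.
Qed.

(** Starting at 0 makes [M t] itself an increment, which yields adaptedness and integrability. *)
Lemma mart_diff_martingale (M : R -> B -> R) : (forall w, M 0 w = 0) ->
  (forall s t, 0 <= s -> s <= t -> mart_diff s t (fun w => M t w - M s w)) ->
  martingale M.
Proof.
move=> M0 mM.
have m0 t : 0 <= t -> mart_diff 0 t (M t).
  move=> t0; have := mM _ _ (lexx _) t0.
  by under eq_fun do rewrite M0 subr0.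
split.
- move=> t A t0 mA; have [h _ _] := m0 _ t0.
  by move/(filt_measurableP _ t0) : h; apply.
- move=> t t0; have [h [C MC] _] := m0 _ t0.
  exact: (bounded_filt_integrable (t := t) (C := C)).
- move=> s t A s0 st FA; have t0 := le_trans s0 st.
  have mA := filt_sub_measurable s0 FA.
  have iA r : 0 <= r -> P.-integrable A (EFin \o M r).
    move=> r0; have [h [C MC] _] := m0 _ r0.
    exact: (bounded_filt_integrable (t := r) (C := C)).
  have [_ _ h] := mM _ _ s0 st; have := h _ FA.
  rewrite RintegralB; [|by []|exact: iA|exact: iA].
  move/eqP; rewrite subr_eq0 => /eqP e.
  have fin r : 0 <= r -> (\int[P]_(w in A) (M r w)%:E)%E \is a fin_num.
    by move=> r0; exact: integrable_fin_num (iA _ r0).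
  by rewrite -(fineK (fin _ t0)) -(fineK (fin _ s0)); congr (_%:E).
Qed.

End filtered_space.

Lemma lebesgue_itvoc_lty (R : realType) (a b : R) :
  (lebesgue_measure (`]a, b] : set R) < +oo)%E.
Proof.
by rewrite lebesgue_measure_itv/=; case: ifP => _; rewrite ?ltry// -EFinB ltry.
Qed.

(** * Freezing the shift on a grid *)

Section path_discretization.
Context {R : realType}.
(** One path is fixed here. In the application [phi v a] is a test function at [Z v] with [r]
    lowered by [a], [psi] is its [r]-derivative at the same point (so the [a]-derivative of [phi] is
    [- psi]), [g] is the generator of the translated test function, [A] the clock and [alpha] its
    rate. *)
Variables (phi psi g : R -> R -> R) (A alpha : R -> R) (C1 C2 C3 L s t : R).
Local Notation mu := (@lebesgue_measure R).
Implicit Types v a : R.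
Hypotheses (s0 : 0 <= s) (st : s <= t).
Hypothesis phi_bound : forall v a, 0 <= v -> `|phi v a| <= C1.
Hypothesis g_bound : forall v a, 0 <= v -> `|g v a| <= C2.
Hypothesis psi_bound : forall v a, 0 <= v -> `|psi v a| <= C3.
Hypothesis alpha_bound : forall v, `|alpha v| <= L.
Hypothesis phi_mvt : forall v a a', 0 <= v -> a <= a' ->
  exists2 xi, a <= xi <= a' & phi v a' - phi v a = - (psi v xi * (a' - a)).
Hypothesis measurable_g : forall a, measurable_fun (`[0, +oo[%classic : set R) (g ^~ a).
Hypothesis g_continuous : forall v (an : nat -> R) a, 0 <= v ->
  an n @[n --> \oo] --> a -> g v (an n) @[n --> \oo] --> g v a.
(** Time approaches [v] from the right only: [psi] is sampled at the right end of a cell, and the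
    path behind it is cadlag. *)
Hypothesis psi_continuous : forall (vn an : nat -> R) v a, 0 <= v ->
  (forall n, v <= vn n) -> vn n @[n --> \oo] --> v -> an n @[n --> \oo] --> a ->
  psi (vn n) (an n) @[n --> \oo] --> psi v a.
Hypothesis measurable_alpha : measurable_fun (`[0, +oo[%classic : set R) alpha.
Hypothesis A_lipschitz : forall v v', 0 <= v -> v <= v' -> 0 <= A v' - A v <= L * (v' - v).
Hypothesis A_integral : forall v v', 0 <= v -> v <= v' ->
  A v' - A v = \int[mu]_(x in `]v, v']) alpha x.

Let delta n := (t - s) / n.+1%:R.
Let tau n i := s + i%:R * delta n.

Definition increment_sum (phi g : R -> R -> R) (A : R -> R) (s t : R) (n : nat) : R :=
  let tau i := s + i%:R * ((t - s) / n.+1%:R) in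
  \sum_(i < n.+1) (phi (tau i.+1) (A (tau i)) - phi (tau i) (A (tau i)) -
    \int[mu]_(v in `]tau i, tau i.+1]) g v (A (tau i))).

Let delta0 n : 0 <= delta n.
Proof. by rewrite /delta divr_ge0// subr_ge0. Qed.

Let tauS n i : tau n i.+1 = tau n i + delta n.
Proof. by rewrite /tau -natr1 mulrDl mul1r addrA. Qed.

Let tau_le n i j : (i <= j)%N -> tau n i <= tau n j.
Proof. by move=> ij; rewrite lerD2l ler_wpM2r// ler_nat. Qed.

Let tau0 n : tau n 0 = s.
Proof. by rewrite /tau mul0r addr0. Qed.

Let tau_ge0 n i : 0 <= tau n i.
Proof. by apply: (le_trans s0); rewrite -(tau0 n); exact: tau_le. Qed.

Let tau_end n : tau n n.+1 = t.
Proof. by rewrite /tau /delta mulrCA mulfV ?pnatr_eq0// mulr1 addrC subrK. Qed.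

Let cell n m v : s < v <= tau n m -> exists2 i, (i < m)%N & tau n i < v <= tau n i.+1.
Proof.
elim: m => [|m IH]; first by rewrite tau0 => /andP[/lt_le_trans h /h]; rewrite ltxx.
move=> /andP[sv vm]; have [vt|tv] := leP v (tau n m).
  by have [|i im h] := IH; [rewrite sv|exists i => //; exact: ltnW].
by exists m => //; rewrite tv.
Qed.

(* On each cell, [phi t (A t) - phi s (A s)] splits into an increment in time with [A] frozen
   and an increment in [A], which the mean value theorem turns into an integral of [alpha]. *)
Lemma increment_sum_step n : exists h : R -> R,
  [/\ measurable_fun (`]s, t] : set R) h,
      increment_sum phi g A s t n = phi t (A t) - phi s (A s) - \int[mu]_(v in `]s, t]) h v &
      forall v, s < v <= t -> exists u : R * R * R,
        [/\ s <= u.1.1 < v, v <= u.1.2, u.1.2 - u.1.1 = delta n, A u.1.1 <= u.2 <= A u.1.2 &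
            h v = g v (A u.1.1) - psi u.1.2 u.2 * alpha v]].
Proof.
have Ale i : A (tau n i) <= A (tau n i.+1).
  by have /andP[] := A_lipschitz (tau_ge0 n i) (tau_le n (leqnSn i)); rewrite subr_ge0.
have /choice[xi xiP] : forall i, exists x, A (tau n i) <= x <= A (tau n i.+1) /\
    phi (tau n i.+1) (A (tau n i.+1)) - phi (tau n i.+1) (A (tau n i)) =
    - (psi (tau n i.+1) x * (A (tau n i.+1) - A (tau n i))).
  by move=> i; have [x] := phi_mvt (tau_ge0 n i.+1) (Ale i); exists x.
pose I i : set R := `]tau n i, tau n i.+1]%classic.
pose k i v := g v (A (tau n i)) - psi (tau n i.+1) (xi i) * alpha v.
(* The cells are disjoint, so at each [v] in []s, t]] the sum reduces to the integrand of the cell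
   containing [v]. *)
pose h v := \sum_(i < n.+1) \1_(I i) v * k i v.
have sub i : (i < n.+1)%N -> I i `<=` `]s, t].
  move=> ni v; rewrite /I /= !in_itv/= => /andP[h1 h2]; apply/andP; split.
    by apply: le_lt_trans h1; rewrite -(tau0 n); exact: tau_le.
  by apply: (le_trans h2); rewrite -(tau_end n); exact: tau_le.
have pos i : I i `<=` `[0, +oo[.
  move=> v; rewrite /I /= !in_itv/= andbT => /andP[h1 _].
  by apply: ltW; apply: le_lt_trans h1; exact: tau_ge0.
have st0 : (`]s, t] : set R) `<=` `[0, +oo[.
  by move=> v; rewrite /= !in_itv/= andbT => /andP[h1 _]; rewrite ltW// (le_lt_trans s0).
have mk i (D : set R) : measurable D -> D `<=` `[0, +oo[ -> measurable_fun D (k i).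
  move=> mD D0; apply: measurable_funB.
    by apply: measurable_funS (measurable_g _).
  apply: measurable_funM; first exact: measurable_cst.
  exact: measurable_funS measurable_alpha.
have hk i v : (i < n.+1)%N -> I i v -> h v = k i v.
  move=> ni Iv; rewrite /h (bigD1 (Ordinal ni))//= big1 ?addr0.
    by rewrite indicE mem_set// mul1r.
  move=> j; rewrite -val_eqE/= => ji; rewrite indicE memNset ?mul0r// => Jv.
  move: Iv Jv; rewrite /I /= !in_itv/= => /andP[a1 a2] /andP[b1 b2].
  case: (ltngtP j i) ji => // ij _.
    by have := lt_le_trans a1 (le_trans b2 (tau_le n ij)); rewrite ltxx.
  by have := lt_le_trans b1 (le_trans a2 (tau_le n ij)); rewrite ltxx.
have mh : measurable_fun (`]s, t] : set R) h.
  apply: measurable_sum => i; apply: measurable_funM; last exact: mk.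
  by apply: measurable_indic; exact: measurable_itv.
have kb i v : 0 <= v -> `|k i v| <= C2 + C3 * L.
  move=> v0; apply: (le_trans (ler_normB _ _)); apply: lerD; first exact: g_bound.
  by rewrite normrM ler_pM// ?psi_bound.
have hb v : s < v <= t -> `|h v| <= C2 + C3 * L.
  rewrite -{1}(tau_end n) => /cell[i ni iv].
  have Iv : I i v by rewrite /I /= in_itv.
  rewrite (hk i)//; apply: kb.
  by apply: ltW; apply: le_lt_trans (tau_ge0 n i) _; case/andP: iv.
have ih a b : s <= a -> b <= t -> mu.-integrable (`]a, b] : set R) (EFin \o h).
  move=> sa bt; apply: (bounded_integrable (C := C2 + C3 * L)) => //.
  - exact: lebesgue_itvoc_lty.
  - by apply: measurable_funS mh => //; apply: subset_itv; rewrite bnd_simp.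
  - move=> v; rewrite /= in_itv/= => /andP[av vb]; apply: hb.
    by rewrite (le_lt_trans sa av) (le_trans vb bt).
have sumI m : (m <= n.+1)%N ->
    \sum_(i < m) \int[mu]_(v in I i) k i v = \int[mu]_(v in `]s, tau n m]) h v.
  elim: m => [_|m IH mn].
    by rewrite big_ord0 tau0 set_itvoc0 Rintegral_set0.
  rewrite big_ord_recr/= IH; last exact: ltnW.
  have <- : \int[mu]_(v in I m) h v = \int[mu]_(v in I m) k m v.
    by apply: eq_Rintegral => v; rewrite inE; exact: hk.
  rewrite /I -(@Rintegral_itvB _ h (BRight s) (BRight (tau n m.+1)) (tau n m)).
  - by rewrite addrC subrK.
  - by apply: ih => //; rewrite -(tau_end n); exact: tau_le.
  - by rewrite bnd_simp -(tau0 n); exact: tau_le.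
  - by rewrite bnd_simp; exact: tau_le.
exists h; split => //; last first.
  move=> v; rewrite -{1}(tau_end n) => /cell[i ni /andP[iv vi]].
  exists (tau n i, tau n i.+1, xi i); split => //=.
  - by rewrite iv andbT -{1}(tau0 n); exact: tau_le.
  - by rewrite tauS addrAC subrr add0r.
  - by have [] := xiP i.
  - by apply: hk => //; rewrite /I /= in_itv/= iv.
have := sumI n.+1 (leqnn _); rewrite tau_end => <-.
have -> : phi t (A t) - phi s (A s) =
    \sum_(i < n.+1) (phi (tau n i.+1) (A (tau n i.+1)) - phi (tau n i) (A (tau n i))).
  rewrite -(big_mkord xpredT (fun i => phi (tau n i.+1) (A (tau n i.+1)) - phi (tau n i) (A (tau n i)))).
  by rewrite (telescope_sumr (fun i => phi (tau n i) (A (tau n i))))// tau_end tau0.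
rewrite -sumrB /increment_sum; apply: eq_bigr => i _.
rewrite -/(delta n) -/(tau n i) -/(tau n i.+1) -/(I i).
have mI : measurable (I i) by exact: measurable_itv.
have muI : (mu (I i) < +oo)%E by exact: lebesgue_itvoc_lty.
have intg : mu.-integrable (I i) (EFin \o (fun v => g v (A (tau n i)))).
  apply: (bounded_integrable (C := C2)) => //; first exact: measurable_funS (measurable_g _).
  by move=> v /pos; rewrite /= in_itv/= andbT; exact: g_bound.
have inta : mu.-integrable (I i) (EFin \o alpha).
  by apply: (bounded_integrable (C := L)) => //; exact: measurable_funS measurable_alpha.
have intpa : mu.-integrable (I i) (EFin \o (fun v => psi (tau n i.+1) (xi i) * alpha v)).
  by rewrite /comp; under eq_fun do rewrite EFinM; exact: integrableZl.
rewrite RintegralB// RintegralZl//.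
have [_] := xiP i; rewrite A_integral//; last exact: tau_le.
by move/eqP; rewrite subr_eq => /eqP ->; ring.
Qed.

(** The bound is uniform in [n], as the later limit under the expectation requires. *)
Lemma increment_sum_bound n :
  `|increment_sum phi g A s t n| <= C1 + C1 + (C2 + C3 * L) * (t - s).
Proof.
have s0' := s0; have t0 := le_trans s0 st.
have [h [mh -> hE]] := increment_sum_step n.
have hb v : s < v <= t -> `|h v| <= C2 + C3 * L.
  move=> /[dup] /andP[sv vt] /hE[[[lo hi] x]/= [/andP[slo lov] vhi _ _ ->]].
  apply: (le_trans (ler_normB _ _)); apply: lerD; first by apply: g_bound; lra.
  by rewrite normrM ler_pM// psi_bound//; lra.
apply: (le_trans (ler_normB _ _)); apply: lerD.
  by apply: (le_trans (ler_normB _ _)); apply: lerD; exact: phi_bound.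
have -> : t - s = fine (mu `]s, t]).
  by rewrite lebesgue_measure_itv/= lte_fin; case: ltgtP st => // ->; rewrite subrr.
apply: Rintegral_norm_le => //.
  exact: lebesgue_itvoc_lty.
Qed.

(** For fixed [v] the cell around [v] shrinks: its right end tends to [v] from the right and all
    values of [A] on it tend to [A v]. In [g] the time is [v] itself and only the shift moves.
    Bounded convergence in [v] concludes. *)
Lemma increment_sum_cvg :
  increment_sum phi g A s t n @[n --> \oo] -->
  phi t (A t) - phi s (A s) - \int[mu]_(v in `]s, t]) (g v (A v) - psi v (A v) * alpha v).
Proof.
have s0' := s0; have [h hP] : exists h : nat -> R -> R, forall n,
  [/\ measurable_fun (`]s, t] : set R) (h n),
      increment_sum phi g A s t n = phi t (A t) - phi s (A s) - \int[mu]_(v in `]s, t]) h n v &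
      forall v, s < v <= t -> exists u : R * R * R,
        [/\ s <= u.1.1 < v, v <= u.1.2, u.1.2 - u.1.1 = delta n, A u.1.1 <= u.2 <= A u.1.2 &
            h n v = g v (A u.1.1) - psi u.1.2 u.2 * alpha v]].
  by have /choice[h hP] := increment_sum_step; exists h.
under eq_fun do rewrite (let: And3 _ e _ := hP _ in e).
apply: cvgB; first exact: cvg_cst.
have cdelta : delta n @[n --> \oo] --> 0.
  by rewrite -(mulr0 (t - s)); apply: cvgM; [exact: cvg_cst|exact: cvg_harmonic].
have hb n v : s < v <= t -> `|h n v| <= C2 + C3 * L.
  have [_ _ hE] := hP n.
  move=> /[dup] /andP[sv vt] /hE[[[lo hi] x]/= [/andP[slo lov] vhi _ _ ->]].
  apply: (le_trans (ler_normB _ _)); apply: lerD; first by apply: g_bound; lra.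
  by rewrite normrM ler_pM// psi_bound//; lra.
have hc v : s < v <= t -> h n v @[n --> \oo] --> g v (A v) - psi v (A v) * alpha v.
  move=> sv; have v0 : 0 <= v by lra.
  have /choice[u uP] : forall n, exists u : R * R * R,
        [/\ s <= u.1.1 < v, v <= u.1.2, u.1.2 - u.1.1 = delta n, A u.1.1 <= u.2 <= A u.1.2 &
            h n v = g v (A u.1.1) - psi u.1.2 u.2 * alpha v].
    by move=> n; have [_ _ h3] := hP n; exact: h3.
  under eq_fun do rewrite (let: And5 _ _ _ _ e := uP _ in e).
  have close (x : nat -> R) c (K : R) : (forall n, `|x n - c| <= K * delta n) ->
      x n @[n --> \oo] --> c.
    move=> xc; apply/subr_cvg0/norm_cvg0P.
    apply: (@squeeze_cvgr _ _ _ _ (cst 0) (fun n => K * delta n)).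
    + by apply: nearW => n; rewrite normr_ge0/=.
    + exact: cvg_cst.
    + by rewrite -(mulr0 K); apply: cvgM => //; exact: cvg_cst.
  have chi : (u n).1.2 @[n --> \oo] --> v.
    apply: (close _ _ 1) => n; have [/andP[h1 h2] h3 h4 _ _] := uP n.
    by rewrite mul1r -h4 ger0_norm; lra.
  (* Both [x] and [A v] lie between the values of [A] at the ends of the cell, which differ by at
     most [L] times the mesh. *)
  have A_close n x : A (u n).1.1 <= x <= A (u n).1.2 -> `|x - A v| <= L * delta n.
    have [/andP[h1 h2] h3 h4 /andP[h5 h6] _] := uP n => /andP[xl xr].
    have lo0 : 0 <= (u n).1.1 by lra.
    have hi0 : 0 <= (u n).1.2 by lra.
    have /andP[a1 a2] := A_lipschitz lo0 (ltW h2).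
    have /andP[a3 a4] := A_lipschitz v0 h3.
    have /andP[a5 a6] := A_lipschitz lo0 (le_trans (ltW h2) h3).
    by rewrite -h4 ler_norml; apply/andP; split; lra.
  apply: cvgB.
    apply: g_continuous => //; apply: (close _ _ L) => n; apply: A_close.
    by have [_ _ _ /andP[h5 h6] _] := uP n; rewrite lexx (le_trans h5).
  apply: cvgM; last exact: cvg_cst.
  apply: psi_continuous => //; first by move=> n; have [] := uP n.
  by apply: (close _ _ L) => n; apply: A_close; have [] := uP n.
apply: (bounded_cvg_Rintegral (C := C2 + C3 * L)) => //.
- exact: lebesgue_itvoc_lty.
- by move=> n; have [] := hP n.
Qed.

End path_discretization.

(** A chain rule of Ito-Wentzell type: a family of martingale increments indexed by [a] is evaluated
    at an absolutely continuous adapted parameter [A], and the drift gains the [a]-derivative of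
    [phi] times [alpha], that is [- psi * alpha]. *)
Lemma mart_diff_random_translation (R : realType) (B : stoch_basis R)
    (phi psi g : R -> R -> B -> R) (A alpha : R -> B -> R) (C1 C2 C3 L : R) :
  (forall v a w, 0 <= v -> `|phi v a w| <= C1) ->
  (forall v a w, 0 <= v -> `|g v a w| <= C2) ->
  (forall v a w, 0 <= v -> `|psi v a w| <= C3) ->
  (forall v w, `|alpha v w| <= L) ->
  (forall v a a' w, 0 <= v -> a <= a' ->
    exists2 xi, a <= xi <= a' & phi v a' w - phi v a w = - (psi v xi w * (a' - a))) ->
  (forall a w, measurable_fun (`[0, +oo[%classic : set R) (fun v => g v a w)) ->
  (forall v w (an : nat -> R) a, 0 <= v ->
    an n @[n --> \oo] --> a -> g v (an n) w @[n --> \oo] --> g v a w) ->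
  (forall v w (an : nat -> R) a, 0 <= v ->
    an n @[n --> \oo] --> a -> phi v (an n) w @[n --> \oo] --> phi v a w) ->
  (forall (vn an : nat -> R) v a w, 0 <= v ->
    (forall n, v <= vn n) -> vn n @[n --> \oo] --> v -> an n @[n --> \oo] --> a ->
    psi (vn n) (an n) w @[n --> \oo] --> psi v a w) ->
  (forall w, measurable_fun (`[0, +oo[%classic : set R) (alpha ^~ w)) ->
  (forall w, A 0 w = 0) ->
  (forall v v' w, 0 <= v -> v <= v' -> 0 <= A v' w - A v w <= L * (v' - v)) ->
  (forall v v' w, 0 <= v -> v <= v' ->
    A v' w - A v w = \int[lebesgue_measure]_(x in `]v, v']) alpha x w) ->
  (forall v, 0 <= v -> filt_measurable v (A v)) ->
  (forall a s t, 0 <= s -> s <= t -> mart_diff s t (fun w =>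
    phi t a w - phi s a w - \int[lebesgue_measure]_(v in `]s, t]) g v a w)) ->
  forall s t, 0 <= s -> s <= t -> mart_diff s t (fun w =>
    phi t (A t w) w - phi s (A s w) w -
    \int[lebesgue_measure]_(v in `]s, t]) (g v (A v w) w - psi v (A v w) w * alpha v w)).
Proof.
move=> phib gb psib ab mvt mg cg cphi cpsi ma A0 AL Aint mA md s t s0 st.
pose X n w := increment_sum (fun v a => phi v a w) (fun v a => g v a w) (A ^~ w) s t n.
have ge0 a : s <= a -> 0 <= a by exact: le_trans.
have sub a b : s <= a -> (`]a, b] : set R) `<=` `[0, +oo[.
  move=> sa v; rewrite /= !in_itv/= andbT => /andP[av _].
  by rewrite ltW// (le_lt_trans (ge0 _ sa)).
apply: (@mart_diff_cvg _ _ s t X _ (C1 + C1 + (C2 + C3 * L) * (t - s))) => //.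
- move=> n; pose tau i := s + i%:R * ((t - s) / n.+1%:R).
  have d0 : 0 <= (t - s) / n.+1%:R by rewrite divr_ge0// subr_ge0.
  have tau_le i j : (i <= j)%N -> tau i <= tau j.
    by move=> ij; rewrite lerD2l ler_wpM2r// ler_nat.
  have stau i : s <= tau i by rewrite lerDl mulr_ge0.
  rewrite /X /increment_sum.
  apply: mart_diff_sum => // i; rewrite -/(tau i) -/(tau i.+1).
  apply: (@mart_diffW _ _ (tau i) (tau i.+1)) => //; first exact: tau_le.
    have -> : t = tau n.+1 by rewrite /tau mulrCA mulfV ?pnatr_eq0// mulr1 addrC subrK.
    exact: tau_le.
  apply: (@mart_diff_random_parameter _ _ _ _ (fun a w => phi (tau i.+1) a w - phi (tau i) a w -
      \int[lebesgue_measure]_(v in `]tau i, tau i.+1]) g v a w) (A (tau i))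
      (C1 + C1 + C2 * fine (lebesgue_measure (`]tau i, tau i.+1] : set R))) (L * tau i)).
  + exact: ge0.
  + exact: tau_le.
  + by move=> c; apply: md; [exact: ge0|exact: tau_le].
  + move=> c w; apply: (le_trans (ler_normB _ _)); apply: lerD.
      by apply: (le_trans (ler_normB _ _)); apply: lerD; apply: phib; exact: ge0.
    apply: Rintegral_norm_le => //.
    * exact: lebesgue_itvoc_lty.
    * by apply: (measurable_funS _ (sub _ _ (stau i)) (mg c w)).
    * by move=> v vi; have := sub _ _ (stau i) _ vi; rewrite /= in_itv/= andbT; exact: gb.
  + move=> w c cn cnc; apply: cvgB.
      by apply: cvgB; apply: cphi => //; exact: ge0.
    apply: (bounded_cvg_Rintegral (C := C2)) => //.
    * exact: lebesgue_itvoc_lty.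
    * by move=> n'; apply: (measurable_funS _ (sub _ _ (stau i)) (mg _ w)).
    * by move=> v vi; have := sub _ _ (stau i) _ vi; rewrite /= in_itv/= andbT => v0; exact: cg.
    * by move=> n' v vi; have := sub _ _ (stau i) _ vi; rewrite /= in_itv/= andbT; exact: gb.
  + by apply: mA; exact: ge0.
  + move=> w; have := AL 0 (tau i) w (lexx _) (ge0 _ (stau i)).
    by rewrite A0 !subr0.
- move=> n w; apply: (@increment_sum_bound _ (fun v a => phi v a w) (fun v a => psi v a w)
    (fun v a => g v a w) (A ^~ w) (alpha ^~ w)); by auto.
- move=> w; apply: (@increment_sum_cvg _ (fun v a => phi v a w) (fun v a => psi v a w)
    (fun v a => g v a w) (A ^~ w) (alpha ^~ w) C2 C3 L s t); by auto.
Qed.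

(** * Measurability of functions on products *)

Lemma cvg_to_pair {T : Type} {U V : topologicalType} (F : set_system T) (f : T -> U) (g : T -> V)
    (x : U) (y : V) : Filter F ->
  f @ F --> x -> g @ F --> y -> (fun t => (f t, g t)) @ F --> (x, y).
Proof. by move=> FF fx gy; exact: (cvg_pair fx gy). Qed.

(** Continuity in [x] gives right continuity on the nonnegative half-line; the negative half-line is
    reflected onto it. *)
Lemma measurable_caratheodory (R : realType) d (T : measurableType d) (f : R -> T -> R) :
  (forall x, measurable_fun setT (f x)) -> (forall w, continuous (f ^~ w)) ->
  measurable_fun setT (fun xw : R * T => f xw.1 xw.2).
Proof.
move=> mf cf.
have h1 : measurable_fun (`[0, +oo[%classic `*` setT : set (R * T)) (fun xw => f xw.1 xw.2).
  apply: measurable_right_continuous => // x w _.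
  by apply: cvg_at_right_filter; exact: cf.
have h2 : measurable_fun (`[0, +oo[%classic `*` setT : set (R * T)) (fun xw => f (- xw.1) xw.2).
  apply: (@measurable_right_continuous _ _ _ (fun x w => f (- x) w)) => // x w _.
  apply: cvg_at_right_filter.
  by apply: (@continuous_comp _ _ _ -%R (f ^~ w)); [exact: opp_continuous|exact: cf].
have -> : (fun xw : R * T => f xw.1 xw.2) =
   (fun xw => if 0 <= xw.1 then f xw.1 xw.2 else f (- - xw.1) xw.2).
  by apply/funext => xw; rewrite opprK; case: ifP.
have mle : measurable_fun setT (fun xw : R * T => 0 <= xw.1).
  by apply: measurable_fun_ler => //; exact: measurable_cst.
apply: measurable_fun_if => //.
- apply: (measurable_funS _ _ h1); first exact: measurableX.
  by move=> xw [_ /= x0]; split => //=; rewrite in_itv/= x0.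
- pose opp1 (xw : R * T) := (- xw.1, xw.2).
  apply: (@measurable_comp _ _ _ _ _ _ (`[0, +oo[%classic `*` setT : set (R * T))
     (fun xw => f (- xw.1) xw.2) _ opp1) => //.
  + exact: measurableX.
  + move=> _ [xw [_ /= /negbT]] + <-; rewrite -ltNge => x0; split => //=.
    by rewrite in_itv/= andbT oppr_ge0 ltW.
  + apply: measurable_funTS; apply: measurable_fun_pair; last exact: measurable_snd.
    by apply: measurableT_comp => //; exact: measurable_fst.
Qed.

Section plane.
Context {R : realType}.

(** The sigma-algebra on [R * R] is the product one. Viewing [f] as a Caratheodory function, with
    one coordinate as parameter, avoids comparing it with the Borel sets of the product topology. *)
Lemma continuous_measurable_prod (f : R * R -> R) : continuous f -> measurable_fun setT f.
Proof.
move=> cf; have -> : f = (fun xy => f (xy.1, xy.2)) by apply/funext => -[].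
apply: (@measurable_caratheodory _ _ _ (fun x y => f (x, y))).
  move=> x; apply: continuous_measurable_fun => y.
  apply: (continuous_comp (f := pair x)); last exact: cf.
  by apply: cvg_to_pair; [exact: cvg_cst|exact: cvg_id].
move=> y x; apply: (continuous_comp (f := pair ^~ y)); last exact: cf.
by apply: cvg_to_pair; [exact: cvg_id|exact: cvg_cst].
Qed.

Lemma continuous_measurable_prod3 (f : R * (R * R) -> R) : continuous f -> measurable_fun setT f.
Proof.
move=> cf; have -> : f = (fun xy => f (xy.1, xy.2)) by apply/funext => -[].
apply: (@measurable_caratheodory _ _ _ (fun x y => f (x, y))).
  move=> x; apply: continuous_measurable_prod => y.
  apply: (continuous_comp (f := pair x)); last exact: cf.
  by apply: cvg_to_pair; [exact: cvg_cst|exact: cvg_id].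
move=> y x; apply: (continuous_comp (f := pair ^~ y)); last exact: cf.
by apply: cvg_to_pair; [exact: cvg_id|exact: cvg_cst].
Qed.

End plane.

(** * Mean value and Taylor estimates along lines, and translations *)

Section directional_calculus.
Context {R : realType} {E : normedModType R}.
Implicit Types (f : E -> R) (x v c : E).

Lemma is_derive_line f x v t : derivable f (x + t *: v) v ->
  is_derive t (1 : R) (fun s : R => f (x + s *: v)) ('D_v f (x + t *: v)).
Proof.
have e : (fun h : R => h^-1 *: (((fun s : R => f (x + s *: v)) \o shift t) (h *: (1 : R)) - f (x + t *: v))) =
         (fun h : R => h^-1 *: ((f \o shift (x + t *: v)) (h *: v) - f (x + t *: v))).
  apply/funext => h /=; congr (_ *: (f _ - _)).
  have -> : h *: (1 : R) = h by exact: mulr1.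
  by rewrite scalerDl addrCA.
move=> df; split; first by rewrite /derivable e.
by rewrite /derive e.
Qed.

Lemma line_mvt f x v a a' : (forall y, derivable f y v) ->
  exists xi : R, [/\ Num.min a a' <= xi, xi <= Num.max a a' &
    f (x + a' *: v) - f (x + a *: v) = 'D_v f (x + xi *: v) * (a' - a)].
Proof.
move=> df; wlog aa' : a a' / a <= a'.
  move=> H; have /orP[/H//|/H[xi [h1 h2 h3]]] := le_total a a'.
  exists xi; rewrite minC maxC; split => //.
  by rewrite -opprB h3 -mulrN opprB.
have hd t : is_derive t (1 : R) (fun s : R => f (x + s *: v)) ('D_v f (x + t *: v)).
  by apply: is_derive_line; exact: df.
have [|xi] := @MVT_segment R (fun s => f (x + s *: v)) (fun t => 'D_v f (x + t *: v)) a a' aa' (fun t _ => hd t).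
  apply: derivable_within_continuous => t _; by have [] := hd t.
rewrite in_itv/= => /andP[h1 h2] h3; exists xi.
by rewrite (min_idPl aa') (max_idPr aa').
Qed.

Lemma line_lipschitz f x v t (C : R) : (forall y, derivable f y v) ->
  (forall y, `|'D_v f y| <= C) -> `|f (x + t *: v) - f x| <= C * `|t|.
Proof.
move=> df fC; have [xi [_ _]] := line_mvt x 0 t df.
rewrite scale0r addr0 subr0 => ->.
by rewrite normrM ler_wpM2r.
Qed.

(** Two applications of the mean value theorem, which give the constant [C] in place of [C / 2]. *)
Lemma line_taylor f x v t (C : R) : (forall y, derivable f y v) ->
  (forall y, derivable ('D_v f) y v) -> (forall y, `|'D_v ('D_v f) y| <= C) ->
  `|f (x + t *: v) - f x - t * 'D_v f x| <= C * t ^+ 2.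
Proof.
move=> df ddf fC; have C0 : 0 <= C by exact: le_trans (fC x).
have [xi [h1 h2]] := line_mvt x 0 t df.
rewrite scale0r addr0 subr0 => ->; rewrite (mulrC t) -mulrBl normrM.
have xit : `|xi| <= `|t|.
  by move: h1 h2; case: (leP 0 t) => t0 h1 h2; rewrite ?(ger0_norm t0) ?(ltr0_norm t0) ler_norml; lra.
rewrite -real_normK ?num_real// expr2 mulrA ler_wpM2r//.
by apply: le_trans (line_lipschitz x xi ddf fC) _; rewrite ler_wpM2l.
Qed.

Definition translate c f : E -> R := fun z => f (z - c).

Lemma difference_quotient_translate c f x v :
  (fun h : R => h^-1 *: ((translate c f \o shift x) (h *: v) - translate c f x)) =
  (fun h : R => h^-1 *: ((f \o shift (x - c)) (h *: v) - f (x - c))).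
Proof. by apply/funext => h; rewrite /translate/= addrA. Qed.

Lemma translate_derivable c f x v : derivable f (x - c) v -> derivable (translate c f) x v.
Proof. by rewrite /derivable difference_quotient_translate. Qed.

Lemma derive_translate c f v : 'D_v (translate c f) = translate c ('D_v f).
Proof. by apply/funext => x; rewrite /derive difference_quotient_translate. Qed.

Lemma bounded_continuous_translate c f :
  bounded_continuous f -> bounded_continuous (translate c f).
Proof.
move=> [cf [C fC]]; split; last by exists C => x; exact: fC.
move=> x; apply: (continuous_comp (f := fun z => z - c)); last exact: cf.
by apply: cvgB; [exact: cvg_id|exact: cvg_cst].
Qed.

Lemma C2b_translate c f : C2b f -> C2b (translate c f).
Proof.
move=> [bf df]; split; first exact: bounded_continuous_translate.
move=> v; have [d1 b1 d2] := df v; split.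
- by move=> x; exact: translate_derivable.
- by rewrite derive_translate; exact: bounded_continuous_translate.
- move=> w; have [d3 b3] := d2 w; rewrite derive_translate; split.
    by move=> x; exact: translate_derivable.
  by rewrite derive_translate; exact: bounded_continuous_translate.
Qed.

Lemma derive_translate_at c f v x : 'D_v (translate c f) x = 'D_v f (x - c).
Proof. exact: (congr1 (@^~ x) (derive_translate c f v)). Qed.

Lemma derive2_translate_at c f v w x :
  'D_w ('D_v (translate c f)) x = 'D_w ('D_v f) (x - c).
Proof.
have -> : 'D_v (translate c f) = translate c ('D_v f) := derive_translate c f v.
exact: derive_translate_at.
Qed.

Lemma translate_bounds c f v w (C : R) :
  (forall x, [/\ `|f x| <= C, `|'D_v f x| <= C & `|'D_w ('D_v f) x| <= C]) ->
  forall x, [/\ `|translate c f x| <= C, `|'D_v (translate c f) x| <= C &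
    `|'D_w ('D_v (translate c f)) x| <= C].
Proof.
move=> h x; have [h1 h2 h3] := h (x - c).
by rewrite derive2_translate_at derive_translate_at.
Qed.

End directional_calculus.

(** * Densities of dominated measures *)

Section density.
Context d (T : measurableType d) (R : realType).
Implicit Types (mu nu : {measure set T -> \bar R}) (f g : T -> R) (S : set T).
Local Open Scope ereal_scope.

(** On [N], where [f < 0], the integral of [f] is nonnegative by hypothesis, so the integral of
    [|f|] over [N] vanishes and [N] is null. *)
Lemma ae_ge0_of_integral mu S f : measurable S -> measurable_fun setT f ->
  (forall A, measurable A -> A `<=` S -> 0 <= \int[mu]_(x in A) (f x)%:E) ->
  {ae mu, forall x, S x -> (0 <= f x)%R}.
Proof.
move=> mS mf If; pose N := S `&` [set x | (f x < 0)%R].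
have mN : measurable N.
  apply: measurableI => //; rewrite -[X in measurable X]setTI.
  have -> : [set x | (f x < 0)%R] = f @^-1` `]-oo, 0%R[%classic.
    by apply/seteqP; split => x /=; rewrite in_itv.
  exact: mf.
have mfN : measurable_fun N (EFin \o f).
  by apply/measurable_EFinP; exact: measurable_funTS.
have : ae_eq mu N (EFin \o f) (cst 0).
  apply/ae_eq_integral_abs => //; apply/eqP; rewrite eq_le; apply/andP; split; last first.
    exact: integral_ge0.
  rewrite (eq_integral (fun x => - (f x)%:E)); last first.
    by move=> x; rewrite inE => -[_ /= fx]; rewrite ltr0_norm.
  have -> : \int[mu]_(x in N) (- (f x)%:E) = - \int[mu]_(x in N) (f x)%:E.
    apply: oppe_inj; rewrite oppeK -integral_ge0N => [|x [_ /= fx]].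
      by apply: eq_integral => x _; rewrite oppeK.
    by rewrite lee_fin oppr_ge0 ltW.
  by rewrite oppe_le0; apply: If => // x [].
apply: filterS => x /= h Sx; rewrite leNgt; apply/negP => fx.
have : (f x)%:E = 0 by apply: h.
by case => e; rewrite e ltxx in fx.
Qed.

Section dominated.
Variables (mu nu : {measure set T -> \bar R}) (S : set T) (f : T -> R).
Hypotheses (mS : measurable S) (muS : mu S < +oo) (mf : measurable_fun setT f).
Hypothesis nu_mu : forall A, measurable A -> nu A <= mu A.
Hypothesis nuE : forall A, measurable A -> nu A = \int[mu]_(x in A) (f x)%:E.

Lemma density_ge0 : {ae mu, forall x, (0 <= f x)%R}.
Proof.
have := ae_ge0_of_integral (mu := mu) measurableT mf.
case=> [A mA _|]; first by rewrite -nuE.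
by move=> N [mN N0 sub]; exists N; split => //; apply: subset_trans sub; apply: subsetC => x h; apply: h.
Qed.

Lemma density_integrable : mu.-integrable S (EFin \o f).
Proof.
apply/integrableP; split; first by apply/measurable_EFinP; exact: measurable_funTS.
rewrite (@ae_eq_integral _ _ _ mu S (EFin \o f) (fun x => `|(f x)%:E|))//.
- by rewrite -nuE//; apply: le_lt_trans muS; exact: nu_mu.
- by apply: measurableT_comp => //; apply/measurable_EFinP; exact: measurable_funTS.
- by apply/measurable_EFinP; exact: measurable_funTS.
- by apply: filterS density_ge0 => x f0 _ /=; rewrite ger0_norm.
Qed.

(** Over [A] inside [S], the integral of [1 - f] is [mu A - nu A], which is nonnegative; [mu S]
    being finite makes the subtraction legitimate. *)
Lemma density_le1 : {ae mu, forall x, S x -> (f x <= 1)%R}.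
Proof.
have H := @ae_ge0_of_integral mu S (fun x => (1 - f x)%R) mS.
have mf1 : measurable_fun setT (fun x => (1 - f x)%R).
  by apply: measurable_funB => //; exact: measurable_cst.
have {H mf1} := H mf1; case=> [A mA AS|]; last first.
  move=> N [mN N0 sub]; exists N; split => //; apply: subset_trans sub; apply: subsetC => x h Sx.
  by rewrite -subr_ge0; exact: h.
have muA : mu A < +oo by apply: le_lt_trans muS; apply: le_measure; rewrite ?inE.
have iA : mu.-integrable A (EFin \o f) by apply: integrableS density_integrable.
under eq_integral do rewrite EFinB.
rewrite integralB//; last first.
  by apply: (bounded_integrable (C := 1)) => // x _; rewrite normr1.
rewrite -nuE// integral_cst// mul1e sube_ge0 ?nu_mu//.
by apply/orP; left; rewrite ge0_fin_numE// (le_lt_trans _ muA)// nu_mu.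
Qed.

End dominated.

(** Over subsets of [S] the two integrals are finite and equal, so [g - f] has integral 0 there.
    Used in both directions, this gives uniqueness of the density. *)
Lemma density_le mu nu S f g : measurable S -> mu S < +oo ->
  measurable_fun setT f -> measurable_fun setT g ->
  (forall A, measurable A -> nu A <= mu A) ->
  (forall A, measurable A -> nu A = \int[mu]_(x in A) (f x)%:E) ->
  (forall A, measurable A -> nu A = \int[mu]_(x in A) (g x)%:E) ->
  {ae mu, forall x, S x -> (f x <= g x)%R}.
Proof.
move=> mS muS mf mg numu nuf nug.
have if_ := density_integrable mS muS mf numu nuf.
have ig := density_integrable mS muS mg numu nug.
have H := @ae_ge0_of_integral mu S (fun x => (g x - f x)%R) mS (measurable_funB mg mf).
case: H => [A mA AS|N [mN N0 sub]].
  under eq_integral do rewrite EFinB.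
  rewrite integralB//; [|by apply: integrableS ig|by apply: integrableS if_].
  rewrite -nuf// -nug// subee// ge0_fin_numE//.
  by rewrite (le_lt_trans (numu _ mA))// (le_lt_trans _ muS)// le_measure ?inE.
exists N; split => //; apply: subset_trans sub; apply: subsetC => x h Sx.
by rewrite -subr_ge0; exact: h.
Qed.

End density.

(** With [s] the square root, [(x - 1)^2 = 1 - s^2], and [1 - s^2 <= 2 (1 - s)] is
    [(1 - s)^2 >= 0]. *)
Lemma one_minus_sqrt_ge (R : realType) (x : R) : 0 <= x <= 2 ->
  (x - 1) ^+ 2 <= 2 * (1 - Num.sqrt (x * (2 - x))).
Proof.
move=> /andP[x0 x2]; set s := Num.sqrt _.
have s2 : s ^+ 2 = x * (2 - x) by rewrite sqr_sqrtr// mulr_ge0// subr_ge0.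
have : 0 <= (s - 1) ^+ 2 by exact: sqr_ge0.
by rewrite !expr2 in s2 *; lra.
Qed.

Lemma sqrt_product_le1 (R : realType) (x : R) : Num.sqrt (x * (2 - x)) <= 1.
Proof.
have h : x * (2 - x) <= 1 by have := sqr_ge0 (x - 1); rewrite expr2; lra.
by apply: le_trans (ler_wsqrtr h) _; rewrite sqrtr1.
Qed.

(** * Jump kernels *)

Section kernel_bounds.
Context {R : realType}.
Local Notation Y := (R * R)%type.
Implicit Types (M : model R) (u x : bool) (y z : Y).

Lemma measurable_prod_norm : measurable_fun setT (fun z : Y => `|z|).
Proof. by apply: continuous_measurable_prod; exact: norm_continuous. Qed.

(** These sets exhaust the complement of 0 and have finite mass under the jump kernels, uniformly in
    the state. *)
Definition away (n : nat) : set Y := [set z | n.+1%:R^-1 < `|z|].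

Lemma measurable_away n : measurable (away n).
Proof.
rewrite -[X in measurable X]setTI.
have -> : away n = (fun z : Y => `|z|) @^-1` `]n.+1%:R^-1, +oo[%classic.
  by apply/seteqP; split => z /=; rewrite in_itv/= andbT.
exact: measurable_prod_norm.
Qed.

Lemma bigcup_away : \bigcup_n away n = ~` [set 0].
Proof.
apply/seteqP; split=> [z [n _]|z /= z0].
  rewrite /away/= => nz /= z0; move: nz; rewrite z0 normr0 ltNge invr_ge0.
  by rewrite ler0n.
have nz : 0 < `|z| by rewrite normr_gt0; apply/eqP.
exists (Num.truncn (`|z|^-1)) => //; rewrite /away/= invf_plt ?posrE//.
by rewrite truncnS_gt.
Qed.

Definition min_sq z : R := Num.min (`|z| ^+ 2) 1.

Lemma measurable_min_sq : measurable_fun setT min_sq.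
Proof.
apply: measurable_minr; last exact: measurable_cst.
by apply: measurable_funX; exact: measurable_prod_norm.
Qed.

Lemma min_sq_ge0 z : 0 <= min_sq z.
Proof. by rewrite le_min ler01 andbT. Qed.

(** Chebyshev: on [away n] the integrand of (A1) is at least [1/(n+1)^2]. *)
Lemma kernel_away_le M : A1 M -> exists C : R, forall n u x y,
  (K M (u, x, y) (away n) <= (C * n.+1%:R ^+ 2)%:E)%E.
Proof.
move=> [_ _ _ [C CP]]; exists C => n u x y.
have n0 : 0 < n.+1%:R :> R by [].
suff : ((n.+1%:R^-1 ^+ 2)%:E * K M (u, x, y) (away n) <= C%:E)%E.
  rewrite -lee_pdivlMl ?exprn_gt0 ?invr_gt0//.
  by rewrite -exprVn invrK -EFinM mulrC.
rewrite -integral_cst//; last exact: measurable_away.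
apply: le_trans (CP u x y).
apply: (@le_trans _ _ (\int[K M (u, x, y)]_(z in away n) (min_sq z)%:E)%E).
  apply: ge0_le_integral => //.
  - exact: measurable_away.
  - by move=> z _; rewrite lee_fin exprn_ge0// invr_ge0.
  - by apply/measurable_EFinP; exact: measurable_funTS measurable_min_sq.
  - move=> z nz; rewrite lee_fin le_min; apply/andP; split.
      by rewrite lerXn2r ?nnegrE ?invr_ge0//; exact: ltW.
    by rewrite expr_le1// ?invr_ge0// invf_le1// ler1n.
apply: ge0_subset_integral => //; first exact: measurable_away.
- by apply/measurable_EFinP; exact: measurable_min_sq.
- by move=> z _; rewrite lee_fin min_sq_ge0.
Qed.

Lemma K_sumE M u y A : K_sum M u y A = (K M (u, true, y) A + K M (u, false, y) A)%E.
Proof. exact: measure_addE. Qed.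

Lemma K_sum_away_lty M u y n : A1 M -> (K_sum M u y (away n) < +oo)%E.
Proof.
move=> /kernel_away_le[C CP]; rewrite K_sumE.
by apply: lte_add_pinfty; apply: le_lt_trans (CP _ _ _ _) _; rewrite ltry.
Qed.

Lemma K_le_K_sum M u x y A : (K M (u, x, y) A <= K_sum M u y A)%E.
Proof. by rewrite K_sumE; case: x; [rewrite leeDl|rewrite leeDr]. Qed.

Lemma measurable_phi2 chi M u y : A2 chi M -> measurable_fun setT (phi2 M u y).
Proof.
move=> [m2 _ _].
have -> : phi2 M u y = (fun yz : Y * Y => phi2 M u yz.1 yz.2) \o (pair y) by [].
by apply: measurableT_comp => //; apply: measurable_fun_pair.
Qed.

(** The point 0 carries no mass, so its complement, the countable union of the sets [away n],
    decides. *)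
Lemma ae_away M u y (Q : Y -> Prop) : no_null_jumps M ->
  (forall n, {ae K_sum M u y, forall z, away n z -> Q z}) -> {ae K_sum M u y, forall z, Q z}.
Proof.
move=> nn /ae_foralln h.
have h0 : {ae K_sum M u y, forall z, z <> 0}.
  exists [set 0]; split.
  - have -> : [set 0 : Y] = [set 0] `*` [set 0].
      by apply/seteqP; split => [_ ->//|[a b] [/= -> ->]].
    by apply: measurableX; exact: measurable_set1.
  - by rewrite K_sumE !nn adde0.
  - by move=> z /= /contrapT.
move: h0 h; apply: filterS2 => z z0 Qz.
have : (~` [set 0]) z by [].
by rewrite -bigcup_away => -[n _]; exact: Qz.
Qed.

(** [phi2 / 2] is the density of the kernel for [x = 1] with respect to the sum of both kernels,
    which dominates it; hence it lies between 0 and 1. *)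
Lemma phi2_range chi M u y : no_null_jumps M -> A1 M -> A2 chi M ->
  {ae K_sum M u y, forall z, 0 <= phi2 M u y z <= 2}.
Proof.
move=> nn a1 a2; have [_ kE _] := a2; apply: ae_away => // n.
have mf : measurable_fun setT (fun z => phi2 M u y z / 2).
  by apply: measurable_funM; [exact: measurable_phi2 a2|exact: measurable_cst].
have h1 := density_ge0 mf (kE u y).
have h2 := density_le1 (measurable_away n) (K_sum_away_lty u y n a1) mf (fun A _ => K_le_K_sum M u true y A) (kE u y).
move: h1 h2; apply: filterS2 => z; rewrite pmulr_lge0 ?invr_gt0// => -> h az /=.
by have := h az; rewrite ler_pdivrMr// mul1r.
Qed.

(** If the kernels agree, both halves of [phi2] are densities of the same measure with respect to
    the same sum; inequalities in both directions hold on each [away n]. *)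
Lemma phi2_unique chi M M' u y y' : no_null_jumps M -> A1 M -> A2 chi M -> A2 chi M' ->
  (forall x A, measurable A -> K M (u, x, y) A = K M' (u, x, y') A) ->
  {ae K_sum M u y, forall z, phi2 M u y z = phi2 M' u y' z}.
Proof.
move=> nn a1 a2 a2' KK'; have [_ kE _] := a2; have [_ kE' _] := a2'.
apply: ae_away => // n.
have mf : measurable_fun setT (fun z => phi2 M u y z / 2).
  by apply: measurable_funM; [exact: measurable_phi2 a2|exact: measurable_cst].
have mf' : measurable_fun setT (fun z => phi2 M' u y' z / 2).
  by apply: measurable_funM; [exact: measurable_phi2 a2'|exact: measurable_cst].
have kE2 A : measurable A ->
    K M (u, true, y) A = (\int[K_sum M u y]_(z in A) (phi2 M' u y' z / 2)%:E)%E.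
  move=> mA; rewrite KK'// kE'//; apply: eq_measure_integral => D mD _.
  by rewrite !K_sumE !KK'.
have le := density_le (measurable_away n) (K_sum_away_lty u y n a1) _ _
  (fun A _ => K_le_K_sum M u true y A).
have h1 := le _ _ mf mf' (kE u y) kE2.
have h2 := le _ _ mf' mf kE2 (kE u y).
move: h1 h2; apply: filterS2 => z h1 h2 az; apply/eqP; rewrite eq_le.
have := h1 az; have := h2 az; rewrite !ler_pM2r ?invr_gt0//.
by move=> -> ->.
Qed.

(** A dominating function for the jump integrand: the first term controls the square of the jump [j]
    of the belief, the second the jump of the observation. *)
Definition jump_weight M u y z : R := (phi2 M u y z - 1) ^+ 2 + min_sq z.

Lemma measurable_jump_weight chi M u y : A2 chi M -> measurable_fun setT (jump_weight M u y).
Proof.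
move=> a2; apply: measurable_funD; last exact: measurable_min_sq.
apply: measurable_funX; apply: measurable_funB; last exact: measurable_cst.
exact: measurable_phi2 a2.
Qed.

Lemma jump_weight_ge0 M u y z : 0 <= jump_weight M u y z.
Proof. by rewrite addr_ge0 ?sqr_ge0 ?min_sq_ge0. Qed.

(** (A3) bounds the sum of the quadratic form and the integral. Nonnegativity of [qform] allows the
    integral to be bounded alone. *)
Lemma jump_weight_bound chi M : no_null_jumps M -> A1 M -> A2 chi M -> A3 M ->
  (forall u y, 0 <= qform M u y) ->
  exists C : R, forall u y, (\int[K_sum M u y]_z (jump_weight M u y z)%:E <= C%:E)%E.
Proof.
move=> nn a1 a2 [C3 h3] q0; have [_ _ _ [C1 h1]] := a1.
(* Twice the bound of (A3), the factor 2 coming from [one_minus_sqrt_ge], and the bound of (A1) once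
   for each of the two kernels in [K_sum]. *)
exists (C3 *+ 2 + (C1 + C1)) => u y.
have mp := measurable_phi2 u y a2.
have msq : measurable_fun setT (fun z => (phi2 M u y z - 1) ^+ 2).
  by apply: measurable_funX; apply: measurable_funB => //; exact: measurable_cst.
have ms : measurable_fun setT (fun z => 1 - Num.sqrt (phi2 M u y z * (2 - phi2 M u y z))).
  apply: measurable_funB; first exact: measurable_cst.
  apply: measurableT_comp; first by apply: continuous_measurable_fun; exact: sqrt_continuous.
  apply: measurable_funM => //; apply: measurable_funB => //; exact: measurable_cst.
have I0 : (0 <= \int[K_sum M u y]_z (1 - Num.sqrt (phi2 M u y z * (2 - phi2 M u y z)))%:E)%E.
  by apply: integral_ge0 => z _; rewrite lee_fin subr_ge0 sqrt_product_le1.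
have I3 : (\int[K_sum M u y]_z (1 - Num.sqrt (phi2 M u y z * (2 - phi2 M u y z)))%:E <= C3%:E)%E.
  apply: le_trans (h3 u y); rewrite gee0_abs; last first.
    by rewrite adde_ge0// lee_fin mulr_ge0.
  by rewrite leeDr// lee_fin mulr_ge0.
under eq_integral do rewrite /jump_weight EFinD.
rewrite ge0_integralD//=.
- rewrite EFinD; apply: leeD.
    apply: (@le_trans _ _ (\int[K_sum M u y]_z
        (2%:E * (1 - Num.sqrt (phi2 M u y z * (2 - phi2 M u y z)))%:E))%E).
      apply: ae_ge0_le_integral => //.
      + by move=> z _; rewrite lee_fin sqr_ge0.
      + exact/measurable_EFinP.
      + by move=> z _; rewrite -EFinM lee_fin mulr_ge0// subr_ge0 sqrt_product_le1.
      + by apply: measurable_funeM; exact/measurable_EFinP.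
      + move: (phi2_range u y nn a1 a2); apply: filterS => z hz _.
        by rewrite -EFinM lee_fin; exact: one_minus_sqrt_ge.
    rewrite ge0_integralZl//; last 2 first.
    + exact/measurable_EFinP.
    + by move=> z _; rewrite lee_fin subr_ge0 sqrt_product_le1.
    have -> : (C3 *+ 2)%:E = (2%:E * C3%:E)%E by rewrite -EFinM mulr_natl.
    exact: lee_wpmul2l.
  rewrite ge0_integral_measure_add//.
  + by rewrite EFinD; apply: leeD; exact: h1.
  + by move=> z _; rewrite lee_fin min_sq_ge0.
  + by apply/measurable_EFinP; exact: measurable_min_sq.
- by move=> z _; rewrite lee_fin sqr_ge0.
- exact/measurable_EFinP.
- by move=> z _; rewrite lee_fin min_sq_ge0.
- by apply/measurable_EFinP; exact: measurable_min_sq.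
Qed.

(** [K_bar] is defined as a bare set function. For [p] in [[0, 1]] it is identified with a bundled
    measure, to which the integration lemmas apply. *)
Lemma K_bar_measure M u p y : 0 <= p <= 1 ->
  exists kb : {measure set Y -> \bar R},
  [/\ K_bar M u p y = kb :> (set Y -> \bar R),
      forall A, (kb A <= K_sum M u y A)%E &
      forall f : Y -> \bar R, (forall z, 0 <= f z)%E -> measurable_fun setT f ->
        (\int[kb]_z f z = p%:E * \int[K M (u, true, y)]_z f z +
                          (1 - p)%:E * \int[K M (u, false, y)]_z f z)%E].
Proof.
move=> /andP[p0 p1]; have q0 : 0 <= 1 - p by rewrite subr_ge0.
pose m1 : {measure set Y -> \bar R} := mscale (NngNum p0) (K M (u, true, y)).
pose m0 : {measure set Y -> \bar R} := mscale (NngNum q0) (K M (u, false, y)).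
have kbE A : measure_add m1 m0 A = K_bar M u p y A by rewrite measure_addE.
exists (measure_add m1 m0); split.
- by apply/funext => A; rewrite -kbE.
- move=> A; rewrite [X in (X <= _)%E]kbE.
  rewrite K_sumE; apply: leeD.
    by rewrite gee_pMl//= ?lee_fin// fin_numE.
  by rewrite gee_pMl// lee_fin lerBlDr lerDl.
- move=> f f0 mf; by rewrite ge0_integral_measure_add// !ge0_integral_mscale.
Qed.

Lemma ae_K_bar M u y (kb : {measure set Y -> \bar R}) (Q : Y -> Prop) :
  (forall A, (kb A <= K_sum M u y A)%E) ->
  {ae K_sum M u y, forall z, Q z} -> {ae kb, forall z, Q z}.
Proof.
move=> le [N [mN N0 sub]]; exists N; split => //.
by apply/eqP; rewrite eq_le measure_ge0 andbT -N0.
Qed.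

(** With [D] the denominator, [j = 2 p (1 - p) (phi2 - 1) / D], and [2 p (1 - p) <= D]. *)
Lemma j_bound M u p y z : 0 <= p <= 1 -> 0 <= phi2 M u y z <= 2 ->
  `|j M u p y z| <= `|phi2 M u y z - 1| /\ `|j M u p y z| <= 1.
Proof.
move=> /andP[p0 p1]; rewrite /j; set f := phi2 M u y z => /andP[f0 f2].
case: ifPn => [_|]; first by rewrite normr0.
rewrite negb_or => /andP[/eqP pn0 /eqP pn1].
have p0' : 0 < p by rewrite lt_neqAle p0 andbT eq_sym; apply/eqP.
have p1' : p < 1 by rewrite lt_neqAle p1 andbT; apply/eqP.
set D := p * f + (1 - p) * (2 - f).
have D0 : 0 < D by rewrite /D; nra.
have -> : p * f / D - p = 2 * p * (1 - p) * (f - 1) / D.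
  by rewrite /D; field; rewrite gt_eqF.
rewrite !normrM normfV (gtr0_norm D0) !ler_pdivrMr// (gtr0_norm p0').
have q0 : 0 < 1 - p by rewrite subr_gt0.
rewrite (gtr0_norm q0) normr_nat mul1r.
have fa : `|f - 1| <= 1 by rewrite ler_norml; lra.
have fb : 0 <= `|f - 1| by [].
(* The difference is [D - 2 p (1 - p) = p^2 f + (1 - p)^2 (2 - f)]. *)
have D1 : 2 * p * (1 - p) <= D.
  have h1 : 0 <= f * p ^+ 2 by rewrite mulr_ge0// sqr_ge0.
  have h2 : 0 <= (2 - f) * (1 - p) ^+ 2 by rewrite mulr_ge0 ?subr_ge0// sqr_ge0.
  by rewrite !expr2 in h1 h2; rewrite /D; lra.
split; first by rewrite mulrC ler_wpM2l.
apply: le_trans D1; rewrite -[X in _ <= X]mulr1 ler_wpM2l//; nra.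
Qed.

End kernel_bounds.

Lemma bool_uniform_bound (R : realType) (Q : bool -> R -> Prop) :
  (forall u C C', C <= C' -> Q u C -> Q u C') ->
  (forall u, exists C, Q u C) -> exists C, forall u, Q u C.
Proof.
move=> mQ h; have [C1 h1] := h true; have [C0 h0] := h false.
exists (Num.max C1 C0) => -[]; [apply: mQ h1|apply: mQ h0]; by rewrite le_max lexx ?orbT.
Qed.

Lemma seq_uniform_bound (R : realType) (V : eqType) (l : seq V) (Q : V -> R -> Prop) :
  (forall u C C', C <= C' -> Q u C -> Q u C') ->
  (forall u, exists C, Q u C) -> exists C, forall u, u \in l -> Q u C.
Proof.
move=> mQ h; elim: l => [|v l [C IH]]; first by exists 0.
have [C' h'] := h v; exists (Num.max C C') => u; rewrite inE => /orP[/eqP ->|/IH].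
  by apply: mQ h'; rewrite le_max lexx orbT.
by apply: mQ; rewrite le_max lexx.
Qed.

(** The jump is performed first in [r], then in [p]. This leaves a Taylor remainder in [p] at the
    intermediate point, a mixed term, and a compensated remainder in [r]. The factor 0 is the
    [h]-component of the truncated jump. *)
Lemma jump_decomposition (R : realType) (A B C D1 D0 E F G J : R) :
  A - C - D0 * J - (E * 0 + F * G) = (A - B - J * D1) + J * (D1 - D0) + (B - C - G * F).
Proof. ring. Qed.

(** * The generator *)

Section generator.
Context {R : realType}.
Local Notation Y := (R * R)%type.

Definition dirp : R * Y := (1, 0).
Definition dirh : R * Y := (0, eh R).
Definition dirr : R * Y := (0, er R).

(** One constant for sup norms, hence invariant under translations; this makes the estimates below
    uniform in the shift. *)
Definition C2_bound (c : R) (f : R * Y -> R) : Prop :=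
  forall v w, v \in [:: dirp; dirh; dirr] -> w \in [:: dirp; dirh; dirr] ->
  forall x, [/\ `|f x| <= c, `|'D_v f x| <= c & `|'D_w ('D_v f) x| <= c].

Lemma C2_bound_exists f : C2b f -> exists c, C2_bound c f.
Proof.
move=> [[_ [c0 h0]] h].
have [c1 h1] : exists c, forall v, v \in [:: dirp; dirh; dirr] ->
    forall w, w \in [:: dirp; dirh; dirr] ->
  forall x, [/\ `|f x| <= c, `|'D_v f x| <= c & `|'D_w ('D_v f) x| <= c].
  apply: seq_uniform_bound => [u C C' CC' H w wl x|v].
    by have [a1 a2 a3] := H w wl x; split; apply: le_trans CC'.
  apply: seq_uniform_bound => [u C C' CC' H x|w].
    by have [a1 a2 a3] := H x; split; apply: le_trans CC'.
  have [_ [_ [c1 h1]] h2] := h v; have [_ [_ [c2 h3]]] := h2 w.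
  exists (Num.max c0 (Num.max c1 c2)) => x; split.
  - by rewrite le_max h0.
  - by rewrite !le_max h1 orbT.
  - by rewrite !le_max h3 !orbT.
by exists c1 => v w vl wl x; exact: h1.
Qed.

Lemma C2_bound_translate c f a : C2_bound c f -> C2_bound c (translate a f).
Proof.
by move=> h v w vl wl; apply: translate_bounds; exact: h.
Qed.

Lemma translate_dirr (f : R * Y -> R) a p (y : Y) :
  translate (a *: dirr) f (p, y) = f (p, (y.1, y.2 - a)).
Proof.
rewrite /translate; congr f; case: y => h r.
by congr (_, (_, _)) => /=; rewrite /GRing.scale/= ?mulr0 ?mulr1 ?subr0.
Qed.

Definition jump_integrand (chi : Y -> Y) (M : model R) (f : R * Y -> R) u p y z : R :=
  f (p + j M u p y z, y + z) - f (p, y) - 'D_dirp f (p, y) * j M u p y z -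
  dot ('D_dirh f (p, y), 'D_dirr f (p, y)) (chi z).

Variables (chi : Y -> Y) (chi_R : R -> R) (M : model R) (k : R)
  (beta_H beta_R : bool -> R -> R) (sigma_R : R -> R)
  (K_R : R.-ker (bool * R)%type ~> R).
Hypothesis chi_trunc : truncation_function chi chi_R.
Hypothesis M_bandit : bandit chi M chi_R k beta_H beta_R sigma_R K_R.

Let nn : no_null_jumps M. Proof. by have [[]] := M_bandit. Qed.
Let a1 : A1 M. Proof. by have [[_ [[]]]] := M_bandit. Qed.
Let a2 : A2 chi M. Proof. by have [[_ [[]]]] := M_bandit. Qed.
Let a3 : A3 M. Proof. by have [[_ [[]]]] := M_bandit. Qed.
Let b1 : B1 M k beta_H beta_R sigma_R K_R. Proof. by have [] := M_bandit. Qed.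

Lemma sigma2_bandit u (y : Y) :
  sigma2 M u y = ((0, 0), (0, if u then sigma_R y.1 ^+ 2 else 0)).
Proof.
have [_ _ h _] := b1; case: y => h' r; have [e1 e2] := h h' r.
by case: u; [rewrite e1|rewrite e2].
Qed.

Lemma qform_bandit u (y : Y) :
  qform M u y = (sigma2 M u y).2.2 * (phi1 M u y).2 ^+ 2.
Proof. by rewrite /qform /tens_app /dot sigma2_bandit/=; ring. Qed.

Lemma sigma2_bandit_ge0 u (y : Y) : 0 <= (sigma2 M u y).2.2.
Proof. by rewrite sigma2_bandit/=; case: u; rewrite ?sqr_ge0. Qed.

Lemma qform_ge0 u (y : Y) : 0 <= qform M u y.
Proof. by rewrite qform_bandit mulr_ge0 ?sigma2_bandit_ge0 ?sqr_ge0. Qed.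

(** By (B1) the kernel is [delta_0] times [K_R] on the risky arm and zero on the safe arm. Jump
    estimates thus involve only the directions [p] and [r]. *)
Lemma ae_jump_risky_only u (y : Y) : {ae K_sum M u y, forall z, z.1 = 0}.
Proof.
have mz : measurable [set z : Y | z.1 <> 0].
  have -> : [set z : Y | z.1 <> 0] = (~` [set 0]) `*` setT.
    by apply/seteqP; split => [z /= z0|z [/= z0 _]].
  by apply: measurableX => //; apply: measurableC; exact: measurable_set1.
exists [set z | z.1 <> 0]; split => //.
have [_ _ _ hK] := b1; case: y => h r; rewrite K_sumE; case: u.
  have [-> _] := hK true h r _ mz; have [-> _] := hK false h r _ mz.
  rewrite (_ : [set s | [set z : Y | z.1 <> 0] (0, s)] = set0) ?measure0 ?adde0//.
  by apply/seteqP; split => s.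
have [_ ->] := hK true h r _ mz; have [_ ->] := hK false h r _ mz.
by rewrite adde0.
Qed.

(** The radius [e] is kept at most 1, so that [min (s^2, 1) = s^2] wherever [chi_R] is known to be
    the identity. *)
Lemma chi_bounds : exists e C : R, [/\ 0 < e, e <= 1, 0 <= C,
  forall s, `|chi_R s| <= C & forall s, `|s| < e -> chi_R s = s].
Proof.
have [_ [C hC] nearchi hchi] := chi_trunc.
have normE (s : R) : `|(0, s) : Y| = `|s|.
  by rewrite prod_normE/= normr0; apply/max_idPr.
have /nbhs_normP[e /= e0 he] := nearchi.
exists (Num.min e 1), C; split.
- by rewrite lt_min e0 ltr01.
- by rewrite ge_min lexx orbT.
- exact: le_trans (hC 0).
- by move=> s; rewrite -normE -hchi; exact: hC.
- move=> s; rewrite lt_min => /andP[se _].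
  have : chi (0, s) = (0, s) by apply: he; rewrite /ball_/= sub0r normrN normE.
  by rewrite hchi => -[].
Qed.

(** The three terms of [jump_decomposition] are bounded separately. With [q = (2 + C) / e^2] they
    add up to at most [c (2 J^2 + (3 + q) m)], which explains the constant [4 + q]. *)
Lemma jump_integrand_bound : exists2 Ck : R, 0 <= Ck & forall c f u p (y : Y),
  C2b f -> C2_bound c f -> 0 <= p <= 1 ->
  {ae K_sum M u y, forall z, `|jump_integrand chi M f u p y z| <= Ck * c * jump_weight M u y z}.
Proof.
have [e [C [e0 e1 C0 hC he]]] := chi_bounds; have [_ _ _ hchi] := chi_trunc.
have Ck0 : 0 <= 4 + (2 + C) / e ^+ 2 by rewrite addr_ge0// divr_ge0 ?addr_ge0// exprn_ge0// ltW.
exists (4 + (2 + C) / e ^+ 2) => // c f u p [h r] df fc p01.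
move: (phi2_range u (h, r) nn a1 a2) (ae_jump_risky_only u (h, r)).
apply: filterS2 => -[z1 s] phi02 /= z10; rewrite {z1}z10 in phi02 *.
have [jphi j1] := j_bound p01 phi02.
have c0 : 0 <= c.
  by have [q _ _] := fc dirp dirp (mem_head _ _) (mem_head _ _) 0; exact: le_trans q.
have [_ /= df2] := df.
have [dfp _ ddfp] := df2 dirp; have [dfr _ ddfr] := df2 dirr.
have inp : dirp \in [:: dirp; dirh; dirr] by rewrite inE eqxx.
have inr : dirr \in [:: dirp; dirh; dirr] by rewrite !inE eqxx !orbT.
have bf x : `|f x| <= c by have [] := fc dirp dirp inp inp x.
have bp x : `|'D_dirp f x| <= c by have [] := fc dirp dirp inp inp x.
have br x : `|'D_dirr f x| <= c by have [] := fc dirr dirr inr inr x.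
have bpp x : `|'D_dirp ('D_dirp f) x| <= c by have [] := fc dirp dirp inp inp x.
have bpr x : `|'D_dirr ('D_dirp f) x| <= c by have [] := fc dirp dirr inp inr x.
have brr x : `|'D_dirr ('D_dirr f) x| <= c by have [] := fc dirr dirr inr inr x.
set J := j M u p (h, r) (0, s) in jphi j1 *.
pose x0 : R * Y := (p, (h, r)); pose x1 := x0 + s *: dirr.
have x1J : (p + J, (h, r) + (0, s)) = x1 + J *: dirp.
  rewrite /x1 /x0 /dirp /dirr /er; congr (_, (_, _)) => /=; rewrite /GRing.scale/=; ring.
have -> : jump_integrand chi M f u p (h, r) (0, s) =
   (f (x1 + J *: dirp) - f x1 - J * 'D_dirp f x1) +
   J * ('D_dirp f x1 - 'D_dirp f x0) + (f x1 - f x0 - chi_R s * 'D_dirr f x0).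
  rewrite /jump_integrand -/J x1J hchi.
  exact: (jump_decomposition (f (x1 + J *: dirp)) (f x1) (f x0) ('D_dirp f x1)
    ('D_dirp f x0) ('D_dirh f x0) ('D_dirr f x0) (chi_R s) J).
set w := jump_weight _ _ _ _.
have Jw : J ^+ 2 <= (phi2 M u (h, r) (0, s) - 1) ^+ 2.
  by rewrite -(real_normK (num_real J)) -[leRHS](real_normK (num_real _)) lerXn2r// nnegrE.
have sE : `|(0, s) : Y| = `|s| by rewrite prod_normE/= normr0; apply/max_idPr.
have wE : w = (phi2 M u (h, r) (0, s) - 1) ^+ 2 + Num.min (s ^+ 2) 1.
  by rewrite /w /jump_weight /min_sq sE real_normK ?num_real.
have m0 : 0 <= Num.min (s ^+ 2) 1 by rewrite le_min sqr_ge0 ler01.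
set m := Num.min _ _ in wE m0.
have T1 : `|f (x1 + J *: dirp) - f x1 - J * 'D_dirp f x1| <= c * J ^+ 2.
  exact: (line_taylor x1 J dfp (ddfp dirp).1 bpp).
(* For [|s| <= 1] the increment of the derivative is at most [c |s|] and [|J| |s|] is split by
   squares; for larger [s] the crude bound [2 c] is used with [|J| <= 1] and [m = 1]. *)
have T2 : `|J * ('D_dirp f x1 - 'D_dirp f x0)| <= c * (J ^+ 2 + 2 * m).
  rewrite normrM; have [s1|s1] := leP (`|s|) 1.
    have ms : m = s ^+ 2.
      by apply/min_idPl; rewrite -(real_normK (num_real s)) expr_le1.
    have : `|'D_dirp f x1 - 'D_dirp f x0| <= c * `|s|.
      exact: (line_lipschitz x0 s (ddfp dirr).1 bpr).
    move=> /(ler_wpM2l (normr_ge0 J)) /le_trans; apply.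
    rewrite mulrCA ler_wpM2l// ms -(real_normK (num_real J)) -(real_normK (num_real s)).
    by have := sqr_ge0 (`|J| - `|s|); have := sqr_ge0 `|J|; have := sqr_ge0 `|s|; rewrite !expr2; lra.
  have -> : m = 1.
    by apply/min_idPr; rewrite -(real_normK (num_real s)) exprn_ege1// ltW.
  have h2 : `|'D_dirp f x1 - 'D_dirp f x0| <= c + c.
    exact: le_trans (ler_normB _ _) (lerD (bp x1) (bp x0)).
  apply: (@le_trans _ _ (1 * (c + c))).
    exact: ler_pM (normr_ge0 _) (normr_ge0 _) j1 h2.
  by rewrite mul1r mulr1 mulrDr mulr_natr mulr2n lerDr; exact: mulr_ge0 c0 (sqr_ge0 _).
(* Inside radius [e] the truncation is the identity and Taylor applies. Outside, the term is at most
   [c (2 + C)], and [m >= e^2] turns this into a multiple of [m]. *)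
have T3 : `|f x1 - f x0 - chi_R s * 'D_dirr f x0| <= c * ((1 + (2 + C) / e ^+ 2) * m).
  have [se|es] := ltP (`|s|) e.
    have ms : m = s ^+ 2.
      by apply/min_idPl; rewrite -(real_normK (num_real s)) expr_le1// (le_trans (ltW se)).
    rewrite he//; apply: (@le_trans _ _ (c * s ^+ 2)).
      exact: (line_taylor x0 s dfr (ddfr dirr).1 brr).
    rewrite ms ler_wpM2l// mulrDl mul1r lerDl mulr_ge0 ?sqr_ge0//.
    by rewrite divr_ge0 ?addr_ge0// exprn_ge0// ltW.
  have em : e ^+ 2 <= m.
    rewrite le_min expr_le1 ?(ltW e0)// e1 andbT -(real_normK (num_real s)).
    by rewrite lerXn2r ?nnegrE ?(ltW e0).
  have e20 : 0 < e ^+ 2 by rewrite exprn_gt0.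
  apply: (@le_trans _ _ (c * (2 + C))).
    have qr : `|chi_R s * 'D_dirr f x0| <= C * c.
      rewrite normrM; exact: ler_pM (normr_ge0 _) (normr_ge0 _) (hC s) (br x0).
    apply: le_trans (ler_normB _ _) _; apply: le_trans (lerD (ler_normB _ _) qr) _.
    apply: le_trans (lerD (lerD (bf x1) (bf x0)) (lexx _)) _.
    by rewrite mulrDr mulr_natr mulr2n [c * C]mulrC.
  rewrite ler_wpM2l// mulrDl mul1r.
  have : (2 + C) <= (2 + C) / e ^+ 2 * m.
    by rewrite mulrAC ler_pdivlMr// ler_wpM2l// addr_ge0.
  by lra.
apply: le_trans (ler_normD _ _) _; apply: le_trans (lerD (ler_normD _ _) (lexx _)) _.
apply: le_trans (lerD (lerD T1 T2) T3) _.
rewrite wE; set q := (2 + C) / _; set ph := (_ - 1) ^+ 2 in Jw *.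
have q0 : 0 <= q by rewrite divr_ge0 ?addr_ge0// exprn_ge0// ltW.
have ph0 : 0 <= ph by rewrite sqr_ge0.
have -> : c * J ^+ 2 + c * (J ^+ 2 + 2 * m) + c * ((1 + q) * m) =
  c * (2 * J ^+ 2 + (3 + q) * m) by ring.
have -> : (4 + q) * c * (ph + m) = c * ((4 + q) * (ph + m)) by ring.
apply: ler_wpM2l => //; have : 0 <= q * ph by rewrite mulr_ge0.
by lra.
Qed.

End generator.

(** * Measurability of integrals against possibly infinite kernels *)

Section kernel_integral.
Context d d' (X : measurableType d) (Y : measurableType d') (R : realType).
Variables (kappa : X -> {measure set Y -> \bar R}) (A : nat -> set Y).
Hypothesis measurable_kappa : forall U, measurable U -> measurable_fun setT (kappa ^~ U).
Hypothesis measurable_A : forall n, measurable (A n).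
Hypothesis trivIset_A : trivIset setT A.
Hypothesis kappa_A : forall n, exists r : R, forall x, (kappa x (A n) < r%:E)%E.
Hypothesis kappa_null : forall x, kappa x (~` \bigcup_n A n) = 0%E.

Definition restr_kernel n (x : X) : {measure set Y -> \bar R} :=
  mrestr (kappa x) (measurable_A n).

Lemma measurable_restr_kernel n U : measurable U -> measurable_fun setT (restr_kernel n ^~ U).
Proof. by move=> mU; apply: measurable_kappa; exact: measurableI. Qed.

HB.instance Definition _ n := isKernel.Build _ _ X Y R (restr_kernel n) (@measurable_restr_kernel n).

Lemma restr_kernel_uub n : measure_fam_uub (restr_kernel n).
Proof.
by have [r hr] := kappa_A n; exists r => x; rewrite /restr_kernel/= /mrestr setTI.
Qed.

HB.instance Definition _ n := Kernel_isFinite.Build _ _ X Y R (restr_kernel n) (restr_kernel_uub n).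

(** A named copy of [kappa], to which the kernel structures can be attached. *)
Definition kappa_kernel (x : X) : {measure set Y -> \bar R} := kappa x.

HB.instance Definition _ := isKernel.Build _ _ X Y R kappa_kernel measurable_kappa.

(** The restrictions to the disjoint sets [A n] are finite kernels, and they sum to [kappa] because
    the rest of the space is null. *)
Lemma kappa_kernel_sfinite : exists s : (R.-fker X ~> Y)^nat,
  forall x U, measurable U -> kappa_kernel x U = kseries s x U.
Proof.
exists (fun n => restr_kernel n) => x U mU; rewrite /kseries/= /mseries /kappa_kernel.
have mB : measurable (\bigcup_n A n) by exact: bigcupT_measurable.
have -> : kappa x U = kappa x (\bigcup_n (U `&` A n)).
  rewrite -[in LHS](setUIDK U (\bigcup_n A n)) measureU//.
  - rewrite setI_bigcupr [X in (_ + X)%E](_ : _ = 0%E) ?adde0//.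
    apply/eqP; rewrite -measure_le0 -(kappa_null x); apply: le_measure; rewrite ?inE.
    + exact: measurableD.
    + exact: measurableC.
    + by move=> y [].
  - exact: measurableI.
  - exact: measurableD.
  - by rewrite setDE setIACA setICr setI0.
rewrite measure_bigcup//.
- by apply/congr_lim/funext => n; apply: eq_big => // i; rewrite in_setT.
- by move=> n _; exact: measurableI.
- exact: trivIset_setIl.
Qed.

HB.instance Definition _ := Kernel_isSFinite.Build _ _ X Y R kappa_kernel kappa_kernel_sfinite.

Lemma measurable_integral_family (F : X * Y -> \bar R) : (forall z, (0 <= F z)%E) ->
  measurable_fun setT F -> measurable_fun setT (fun x => \int[kappa x]_y F (x, y))%E.
Proof. exact: (measurable_fun_integral_sfinite_kernel F kappa_kernel). Qed.

End kernel_integral.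

Section sequential_translation.
Context {R : realType} {E : normedModType R}.
Variables (an : nat -> R) (a : R) (e x : E).
Hypothesis ana : an n @[n --> \oo] --> a.

Lemma cvg_translate (g : E -> R) : continuous g ->
  translate (an n *: e) g x @[n --> \oo] --> translate (a *: e) g x.
Proof.
move=> cg; rewrite /translate; apply: continuous_cvg; first exact: cg.
by apply: cvgB; [exact: cvg_cst|apply: cvgZr_tmp].
Qed.

Lemma cvg_derive_translate f v : C2b f ->
  'D_v (translate (an n *: e) f) x @[n --> \oo] --> 'D_v (translate (a *: e) f) x.
Proof.
move=> [_ /(_ v)[_ [cf _] _]]; under eq_fun do rewrite derive_translate_at.
rewrite derive_translate_at; exact: cvg_translate cf.
Qed.

Lemma cvg_derive2_translate f v w : C2b f ->
  'D_w ('D_v (translate (an n *: e) f)) x @[n --> \oo] -->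
  'D_w ('D_v (translate (a *: e) f)) x.
Proof.
move=> [_ /(_ v)[_ _ /(_ w)[_ [cf _]]]]; under eq_fun do rewrite derive2_translate_at.
rewrite derive2_translate_at; exact: cvg_translate cf.
Qed.

End sequential_translation.

(** The inverse is continuous off the closed point 0, where its value is 0 by convention. *)
Lemma measurable_inverse (R : realType) : measurable_fun setT (fun x : R => x^-1).
Proof.
have -> : (fun x : R => x^-1) = (fun x => if x == 0 then 0 else x^-1).
  by apply/funext => x; case: eqP => // ->; rewrite invr0.
apply: measurable_fun_if => //.
  by apply: measurable_fun_eqr => //; exact: measurable_cst.
have -> : setT `&` (fun x : R => x == 0) @^-1` [set false] = ~` [set 0].
  by apply/seteqP; split=> [x [_ /= /eqP ?]//|x /= x0]; split => //; apply/eqP.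
apply: open_continuous_measurable_fun; first by apply: closed_openC; exact: (@closed_eq R 0).
by move=> x; rewrite inE => /= /eqP x0; exact: inv_continuous.
Qed.

(** Each of the five products is at most [c * Cb], and the weights [1/2], [p (1 - p)] and its square
    are at most 1. *)
Lemma second_order_bound (R : realType) (c Cb p x1 x2 x3 x4 x5 y1 y2 q s t : R) :
  0 <= c -> 0 <= p <= 1 ->
  `|x1| <= c -> `|x2| <= c -> `|x3| <= c -> `|x4| <= c -> `|x5| <= c ->
  `|y1| <= Cb -> `|y2| <= Cb -> `|s| <= Cb -> `|q| <= Cb -> `|t| <= Cb ->
  `|x1 * y1 + x2 * y2 + 2^-1 * x3 * (p ^+ 2 * (1 - p) ^+ 2) * q
    + p * (1 - p) * (x4 * t) + 2^-1 * (x5 * s)| <= 5 * Cb * c.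
Proof.
move=> c0 p01 b1 b2 b3 b4 b5 c1 c2 c3 c4 c5.
move/andP: p01 => [p0 p1]; have q0 : 0 <= 1 - p by rewrite subr_ge0.
have q1 : 1 - p <= 1 by rewrite lerBlDr lerDl.
have w0 : 0 <= p * (1 - p) by rewrite mulr_ge0.
have w1 : p * (1 - p) <= 1 by rewrite mulr_ile1.
have prod (a b : R) : `|a| <= c -> `|b| <= Cb -> `|a * b| <= c * Cb.
  by move=> ha hb'; rewrite normrM ler_pM.
have half (a : R) : `|a| <= c * Cb -> `|2^-1 * a| <= c * Cb.
  by move=> ha; rewrite normrM (@ger0_norm _ 2^-1) ?invr_ge0//; have := normr_ge0 a; lra.
have wt (w a : R) : 0 <= w -> w <= 1 -> `|a| <= c * Cb -> `|w * a| <= c * Cb.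
  move=> w0' w1' ha; rewrite normrM (ger0_norm w0').
  by apply: le_trans ha; rewrite -[leRHS]mul1r ler_wpM2r.
have e3 : 2^-1 * x3 * (p ^+ 2 * (1 - p) ^+ 2) * q = 2^-1 * ((p * (1 - p)) ^+ 2 * (x3 * q)).
  by rewrite exprMn; ring.
rewrite e3.
have -> : 5 * Cb * c = c * Cb + c * Cb + c * Cb + c * Cb + c * Cb by ring.
apply: le_trans (ler_normD _ _) _; apply: lerD; last exact/half/prod.
apply: le_trans (ler_normD _ _) _; apply: lerD; last exact/wt/prod.
apply: le_trans (ler_normD _ _) _; apply: lerD; last first.
  apply/half/wt; [by rewrite exprn_ge0|by rewrite expr_le1|exact: prod].
by apply: le_trans (ler_normD _ _) _; apply: lerD; exact: prod.
Qed.

(** * Boundedness, continuity under shifts and measurability of the generator *)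

Section generator_estimates.
Context {R : realType}.
Local Notation Y := (R * R)%type.
Local Notation dirp := (@dirp R).
Local Notation dirh := (@dirh R).
Local Notation dirr := (@dirr R).

Variables (chi : Y -> Y) (chi_R : R -> R) (M : model R) (k : R)
  (beta_H beta_R : bool -> R -> R) (sigma_R : R -> R)
  (K_R : R.-ker (bool * R)%type ~> R).
Hypothesis chi_trunc : truncation_function chi chi_R.
Hypothesis M_bandit : bandit chi M chi_R k beta_H beta_R sigma_R K_R.

Let nn : no_null_jumps M. Proof. by have [[]] := M_bandit. Qed.
Let a1 : A1 M. Proof. by have [[_ [[]]]] := M_bandit. Qed.
Let a2 : A2 chi M. Proof. by have [[_ [[]]]] := M_bandit. Qed.
Let a3 : A3 M. Proof. by have [[_ [[]]]] := M_bandit. Qed.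
Let a4 : A4 M. Proof. by have [[_ [_ []]]] := M_bandit. Qed.

(** The drift and diffusion part of [genG] after the vanishing entries of [sigma2] are removed: by
    (B1) only its [r]-[r] entry can be nonzero. *)
Definition local_generator (f : R * Y -> R) u p (y : Y) : R :=
  'D_dirh f (p, y) * (beta_bar M u p y).1 + 'D_dirr f (p, y) * (beta_bar M u p y).2
  + 2^-1 * 'D_dirp ('D_dirp f) (p, y) * (p ^+ 2 * (1 - p) ^+ 2) * qform M u y
  + p * (1 - p) * ('D_dirr ('D_dirp f) (p, y) * ((sigma2 M u y).2.2 * (phi1 M u y).2))
  + 2^-1 * ('D_dirr ('D_dirr f) (p, y) * (sigma2 M u y).2.2).

Definition jump_generator (f : R * Y -> R) u p (y : Y) : R :=
  fine (\int[K_bar M u p y]_z (jump_integrand chi M f u p y z)%:E)%E.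

Lemma genG_bandit f u p (y : Y) :
  genG chi M f u (p, y) = local_generator f u p y + jump_generator f u p y.
Proof.
(* The left side keeps the zero entries of [sigma2] literally, so that it is convertible with the
   unfolded [genG]. *)
have alg (a b1 c b2 T w m1 m2 f1 f2 h d1 d2 d3 d4 s J : R) :
    (a * b1 + c * b2) + T + w * (m1 * (0 * f1 + 0 * f2) + m2 * (0 * f1 + s * f2))
      + h * (d1 * 0 + d2 * 0 + d3 * 0 + d4 * s) + J =
    a * b1 + c * b2 + T + w * (m2 * (s * f2)) + h * (d4 * s) + J by ring.
have es : sigma2 M u y = ((0, 0), (0, (sigma2 M u y).2.2)).
  by rewrite (sigma2_bandit M_bandit).
rewrite /local_generator -(alg _ _ _ _ _ _ ('D_dirh ('D_dirp f) (p, y)) _ (phi1 M u y).1 _ _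
  ('D_dirh ('D_dirh f) (p, y)) ('D_dirr ('D_dirh f) (p, y)) ('D_dirh ('D_dirr f) (p, y))) /genG.
set s := (sigma2 M u y).2.2 in es *; rewrite es.
reflexivity.
Qed.

Lemma measurable_chi1 : measurable_fun setT (fun z : Y => (chi z).1).
Proof.
have [cc _ _ _] := chi_trunc; apply: continuous_measurable_prod => z.
by apply: (continuous_comp (f := chi) (g := fst)); [exact: cc|exact: cvg_fst].
Qed.

Lemma measurable_chi2 : measurable_fun setT (fun z : Y => (chi z).2).
Proof.
have [cc _ _ _] := chi_trunc; apply: continuous_measurable_prod => z.
by apply: (continuous_comp (f := chi) (g := snd)); [exact: cc|exact: cvg_snd].
Qed.

Lemma measurable_j u :
  measurable_fun setT (fun q : (R * Y) * Y => j M u q.1.1 q.1.2 q.2).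
Proof.
have [m2 _ _] := a2.
have mp : measurable_fun setT (fun q : (R * Y) * Y => q.1.1).
  by apply: measurableT_comp => //; exact: measurable_fst.
have my : measurable_fun setT (fun q : (R * Y) * Y => q.1.2).
  by apply: (measurableT_comp (f := snd)) => //; exact: measurable_fst.
have mphi : measurable_fun setT (fun q : (R * Y) * Y => phi2 M u q.1.2 q.2).
  apply: (measurableT_comp (f := fun yz : Y * Y => phi2 M u yz.1 yz.2)
    (g := fun q : (R * Y) * Y => (q.1.2, q.2))) => //.
  by apply: measurable_fun_pair => //; exact: measurable_snd.
have mq : measurable_fun setT (fun q : (R * Y) * Y => 1 - q.1.1).
  by apply: measurable_funB => //; exact: measurable_cst.
apply: measurable_fun_ifT.
- by apply: measurable_or; apply: measurable_fun_eqr => //; exact: measurable_cst.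
- exact: measurable_cst.
apply: measurable_funB => //; apply: measurable_funM; first exact: measurable_funM.
apply: measurableT_comp; first exact: measurable_inverse.
apply: measurable_funD; first exact: measurable_funM.
apply: measurable_funM => //; apply: measurable_funB => //; exact: measurable_cst.
Qed.

Lemma C2b_measurable (f : R * Y -> R) : C2b f -> [/\ measurable_fun setT f,
  forall v : R * Y, measurable_fun setT ('D_v f) &
  forall v w : R * Y, measurable_fun setT ('D_w ('D_v f))].
Proof.
move=> [[cf _] h]; split.
- exact: continuous_measurable_prod3 cf.
- by move=> v; have [_ [c _] _] := h v; exact: continuous_measurable_prod3 c.
- move=> v w; have [_ _ /(_ w)[_ [c _]]] := h v; exact: continuous_measurable_prod3 c.
Qed.

Lemma measurable_jump_integrand (f : R * Y -> R) u : C2b f ->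
  measurable_fun setT (fun q : (R * Y) * Y => jump_integrand chi M f u q.1.1 q.1.2 q.2).
Proof.
move=> /C2b_measurable[mf md _].
have mp : measurable_fun setT (fun q : (R * Y) * Y => q.1.1).
  by apply: measurableT_comp => //; exact: measurable_fst.
have mdq v : measurable_fun setT (fun q : (R * Y) * Y => 'D_v f q.1).
  exact: (measurableT_comp (md v) measurable_fst).
have md' v : measurable_fun setT (fun q : (R * Y) * Y => 'D_v f (q.1.1, q.1.2)).
  rewrite (_ : (fun q : (R * Y) * Y => 'D_v f (q.1.1, q.1.2)) =
    (fun q : (R * Y) * Y => 'D_v f q.1)); first exact: mdq.
  by apply/funext => -[[p y] z].
have mfq : measurable_fun setT (fun q : (R * Y) * Y => f (q.1.1, q.1.2)).
  rewrite (_ : (fun q : (R * Y) * Y => f (q.1.1, q.1.2)) =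
    (fun q : (R * Y) * Y => f q.1)); first exact: (measurableT_comp mf measurable_fst).
  by apply/funext => -[[p y] z].
have myz : measurable_fun setT (fun q : (R * Y) * Y => q.1.2 + q.2).
  have mc (g : Y -> R) : measurable_fun setT g ->
      measurable_fun setT (fun q : (R * Y) * Y => g q.1.2) /\
      measurable_fun setT (fun q : (R * Y) * Y => g q.2).
    move=> mg; split; last exact: (measurableT_comp mg measurable_snd).
    exact: (measurableT_comp (measurableT_comp mg measurable_snd) measurable_fst).
  have [m1 m1'] := mc fst measurable_fst; have [m2 m2'] := mc snd measurable_snd.
  exact: (measurable_fun_pair (measurable_funD m1 m1') (measurable_funD m2 m2')).
have mj := measurable_j u.
have mz : measurable_fun setT (snd : (R * Y) * Y -> Y) by exact: measurable_snd.
have mc1 : measurable_fun setT (fun q : (R * Y) * Y => (chi q.2).1).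
  exact: (measurableT_comp measurable_chi1 mz).
have mc2 : measurable_fun setT (fun q : (R * Y) * Y => (chi q.2).2).
  exact: (measurableT_comp measurable_chi2 mz).
have mfj : measurable_fun setT
    (fun q : (R * Y) * Y => f (q.1.1 + j M u q.1.1 q.1.2 q.2, q.1.2 + q.2)).
  exact: (measurableT_comp mf (measurable_fun_pair (measurable_funD mp mj) myz)).
exact: (measurable_funB (measurable_funB (measurable_funB mfj mfq)
  (measurable_funM (md' dirp) mj))
  (measurable_funD (measurable_funM (md' dirh) mc1) (measurable_funM (md' dirr) mc2))).
Qed.

Lemma measurable_jump_section (f : R * Y -> R) u p (y : Y) : C2b f ->
  measurable_fun setT (jump_integrand chi M f u p y).
Proof.
move=> df; pose h (z : Y) := ((p, y), z) : (R * Y) * Y.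
have mh : measurable_fun setT h by apply: measurable_fun_pair; [exact: measurable_cst|exact: measurable_id].
exact: (measurableT_comp (measurable_jump_integrand u df) mh).
Qed.

Lemma jump_measure : exists2 Cw : R, 0 <= Cw & forall u p (y : Y), 0 <= p <= 1 ->
  exists kb : {measure set Y -> \bar R},
  [/\ K_bar M u p y = kb :> (set Y -> \bar R),
      forall A, (kb A <= K_sum M u y A)%E,
      forall f : Y -> \bar R, (forall z, 0 <= f z)%E -> measurable_fun setT f ->
        (\int[kb]_z f z = p%:E * \int[K M (u, true, y)]_z f z +
                          (1 - p)%:E * \int[K M (u, false, y)]_z f z)%E &
      (\int[kb]_z (jump_weight M u y z)%:E <= Cw%:E)%E].
Proof.
have [Cw hCw] := jump_weight_bound nn a1 a2 a3 (qform_ge0 M_bandit).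
have mW u y := measurable_jump_weight u y a2.
have W0 u y z : (0 <= (jump_weight M u y z)%:E)%E by rewrite lee_fin jump_weight_ge0.
exists Cw.
  have := hCw true (0, 0); rewrite -lee_fin; apply: le_trans.
  by apply: integral_ge0 => z _; exact: W0.
move=> u p y p01; have [kb [e le int]] := K_bar_measure M u y p01.
exists kb; split => //; apply: le_trans (hCw u y).
by apply: ge0_le_measure_integral => //; apply/measurable_EFinP; exact: mW.
Qed.

Lemma jump_integrable (kb : {measure set Y -> \bar R}) (C : R) u (y : Y) :
  (\int[kb]_z (jump_weight M u y z)%:E <= C%:E)%E ->
  forall c : R, kb.-integrable setT (fun z => (c * jump_weight M u y z)%:E).
Proof.
move=> le c; have mW := measurable_jump_weight u y a2.
have iW : kb.-integrable setT (EFin \o jump_weight M u y).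
  apply/integrableP; split; first exact/measurable_EFinP.
  apply: le_lt_trans (ltry C); apply: le_trans le; rewrite le_eqVlt; apply/orP; left; apply/eqP.
  by apply: eq_integral => z _ /=; rewrite ger0_norm ?jump_weight_ge0.
by under eq_fun do rewrite EFinM; exact: integrableZl.
Qed.

Lemma jump_generator_bound : exists2 Cj : R, 0 <= Cj & forall c f u p (y : Y),
  C2b f -> C2_bound c f -> 0 <= p <= 1 -> `|jump_generator f u p y| <= Cj * c.
Proof.
have [Cw Cw0 hw] := jump_measure.
have [Ck Ck0 hk] := jump_integrand_bound chi_trunc M_bandit.
exists (Ck * Cw) => [|c f u p y df fc p01]; first exact: mulr_ge0.
have c0 : 0 <= c.
  by have [q _ _] := fc dirp dirp (mem_head _ _) (mem_head _ _) 0; exact: le_trans q.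
have [kb [e kle _ kW]] := hw u p y p01; rewrite /jump_generator e.
have mJ : measurable_fun setT (fun z => (jump_integrand chi M f u p y z)%:E).
  by apply/measurable_EFinP; exact: measurable_jump_section df.
rewrite -lee_fin.
have h : (`|\int[kb]_z (jump_integrand chi M f u p y z)%:E| <= (Ck * Cw * c)%:E)%E.
  apply: le_trans (le_abse_integral kb measurableT mJ) _.
  apply: (@le_trans _ _ (\int[kb]_z ((Ck * c)%:E * (jump_weight M u y z)%:E))%E).
    apply: ae_ge0_le_integral => //.
    - exact: (measurableT_comp _ mJ).
    - by move=> z _; rewrite -EFinM lee_fin mulr_ge0 ?jump_weight_ge0// mulr_ge0.
    - apply: measurable_funeM; apply/measurable_EFinP.
      exact: measurable_jump_weight a2.
    - have := ae_K_bar kle (hk c f u p y df fc p01).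
      by apply: filterS => z hz _; rewrite -EFinM lee_fin.
  rewrite ge0_integralZl//; last 3 first.
  - by apply/measurable_EFinP; exact: measurable_jump_weight a2.
  - by move=> z _; rewrite lee_fin jump_weight_ge0.
  - by rewrite lee_fin mulr_ge0.
  have -> : (Ck * Cw * c)%:E = ((Ck * c)%:E * Cw%:E)%E by rewrite -EFinM mulrAC.
  by apply: lee_wpmul2l => //; rewrite lee_fin mulr_ge0.
(* An infinite integral would contradict [h], so [fine] does not fall back to its default value. *)
move: h; case: (\int[kb]_z _)%E => [x h| |] //=.
Qed.

(** Dominated convergence: translations preserve [C2_bound], so one multiple of [jump_weight]
    dominates all the integrands. *)
Lemma cvg_jump_generator (f : R * Y -> R) u p (y : Y) (an : nat -> R) (a : R) :
  C2b f -> 0 <= p <= 1 -> an n @[n --> \oo] --> a ->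
  jump_generator (translate (an n *: dirr) f) u p y @[n --> \oo] -->
  jump_generator (translate (a *: dirr) f) u p y.
Proof.
move=> df p01 ana; have [Cw Cw0 hw] := jump_measure.
have [Ck Ck0 hk] := jump_integrand_bound chi_trunc M_bandit.
have [c fc] := C2_bound_exists df.
have [kb [e kle _ kW]] := hw u p y p01; rewrite /jump_generator e.
have dft b : C2b (translate (b *: dirr) f) by exact: C2b_translate.
have mJ b : measurable_fun setT (fun z => (jump_integrand chi M (translate (b *: dirr) f) u p y z)%:E).
  by apply/measurable_EFinP; exact: measurable_jump_section (dft b).
have ig := jump_integrable kW (Ck * c).
have hb b : {ae kb, forall z, `|jump_integrand chi M (translate (b *: dirr) f) u p y z|
    <= Ck * c * jump_weight M u y z}.
  exact: (ae_K_bar kle (hk c _ u p y (dft b) (C2_bound_translate _ fc) p01)).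
have [] := @dominated_convergence _ _ _ kb setT measurableT
  (fun n z => (jump_integrand chi M (translate (an n *: dirr) f) u p y z)%:E)
  (fun z => (jump_integrand chi M (translate (a *: dirr) f) u p y z)%:E)
  (fun z => (Ck * c * jump_weight M u y z)%:E) (fun n => mJ (an n)) (mJ a) _ ig.
- apply: aeW => z _; apply/cvg_EFin; first exact: nearW.
  have cf : continuous f by have [[]] := df.
  have t1 x : translate (an n *: dirr) f x @[n --> \oo] --> translate (a *: dirr) f x.
    exact: cvg_translate.
  have t2 v x : 'D_v (translate (an n *: dirr) f) x @[n --> \oo] -->
      'D_v (translate (a *: dirr) f) x by exact: cvg_derive_translate.
  exact: (cvgB (cvgB (cvgB (t1 _) (t1 _)) (cvgM (t2 dirp _) (cvg_cst _)))
    (cvgD (cvgM (t2 dirh _) (cvg_cst _)) (cvgM (t2 dirr _) (cvg_cst _)))).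
- have : {ae kb, forall z, forall n, `|jump_integrand chi M (translate (an n *: dirr) f) u p y z|
    <= Ck * c * jump_weight M u y z} by apply: ae_foralln => n; exact: hb.
  by apply: filterS => z hz n _; rewrite lee_fin; exact: hz.
move=> iJ _ cJ; apply: fine_cvg; rewrite fineK; first exact: cJ.
exact: (integrable_fin_num measurableT iJ).
Qed.

(** The control of [phi1] comes from (A3) through [qform], which is the [r]-[r] entry of [sigma2]
    times the square of the [r]-component of [phi1]; the bound on the product without the square
    follows by the inequality of means. *)
Lemma coefficient_bounds : exists2 Cb : R, 0 <= Cb & forall u p (y : Y), 0 <= p <= 1 ->
  [/\ `|(beta_bar M u p y).1| <= Cb, `|(beta_bar M u p y).2| <= Cb,
      `|(sigma2 M u y).2.2| <= Cb, `|qform M u y| <= Cb &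
      `|(sigma2 M u y).2.2 * (phi1 M u y).2| <= Cb].
Proof.
have [_ hb hs _] := a1.
have [C1 h1] : exists C, forall u x (y : Y), `|(beta M u x y).1| <= C /\ `|(beta M u x y).2| <= C.
  apply: bool_uniform_bound => [u C C' CC' H x y|u].
    by have [h1 h2] := H x y; split; apply: le_trans CC'.
  apply: bool_uniform_bound => [x C C' CC' H y|x].
    by have [h1 h2] := H y; split; apply: le_trans CC'.
  have [[_ [C1 h1]] [_ [C2 h2]]] := hb u x.
  by exists (Num.max C1 C2) => y; rewrite !le_max h1 h2 orbT.
have [C2 h2] : exists C, forall u (y : Y), `|(sigma2 M u y).2.2| <= C.
  apply: bool_uniform_bound => [u C C' CC' H y|u]; first exact: le_trans CC'.
  by have [_ _ _ [_ ?]] := hs u.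
have [C3 h3] : exists C, forall u (y : Y), `|qform M u y| <= C.
  (* (A3) bounds one eighth of [qform] plus a nonnegative integral. *)
  have [C hC] := a3; exists (8 * C) => u y; have := hC u y.
  have q0 := qform_ge0 M_bandit u y.
  have I0 : (0 <= \int[K_sum M u y]_z (1 - Num.sqrt (phi2 M u y z * (2 - phi2 M u y z)))%:E)%E.
    by apply: integral_ge0 => z _; rewrite lee_fin subr_ge0 sqrt_product_le1.
  rewrite gee0_abs; last by rewrite adde_ge0// lee_fin mulr_ge0.
  move=> h; have : ((8^-1 * qform M u y)%:E <= C%:E)%E by apply: le_trans h; rewrite leeDl.
  by rewrite lee_fin ger0_norm//; lra.
exists (C1 + C2 + C3) => [|u p y p01].
  have [q1 _] := h1 true true (0, 0); have q2 := h2 true (0, 0); have q3 := h3 true (0, 0).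
  by rewrite !addr_ge0//; [exact: le_trans q1|exact: le_trans q2|exact: le_trans q3].
have C10 : 0 <= C1 by have [q1 _] := h1 u true y; exact: le_trans q1.
have C20 : 0 <= C2 by exact: le_trans (h2 u y).
have C30 : 0 <= C3 by exact: le_trans (h3 u y).
have mixb (x1 x0 : R) : `|x1| <= C1 -> `|x0| <= C1 -> `|mix p x1 x0| <= C1 + C2 + C3.
  move=> b1 b0; move/andP: p01 => [p0 p1]; have q0 : 0 <= 1 - p by rewrite subr_ge0.
  apply: (@le_trans _ _ (p * C1 + (1 - p) * C1)); last by lra.
  apply: le_trans (ler_normD _ _) _; rewrite !normrM (ger0_norm p0) (ger0_norm q0).
  by apply: lerD; apply: ler_wpM2l.
have [b11 b12] := h1 u true y; have [b01 b02] := h1 u false y.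
have s0 := sigma2_bandit_ge0 M_bandit u y; have q0 := qform_ge0 M_bandit u y.
have := h2 u y; have := h3 u y; rewrite (ger0_norm s0) (ger0_norm q0) => q3 s2.
split.
- exact: mixb.
- exact: mixb.
- by lra.
- by lra.
- move: q3; rewrite (qform_bandit M_bandit).
  move: s0 s2; set s := (sigma2 M u y).2.2; set t := (phi1 M u y).2 => s0 s2 q3.
  (* Together with [e2] this gives [2 |s t| <= s + s t^2]. *)
  have e1 : 0 <= s * (t - 1) ^+ 2 by rewrite mulr_ge0// sqr_ge0.
  have e2 : 0 <= s * (t + 1) ^+ 2 by rewrite mulr_ge0// sqr_ge0.
  by rewrite expr2 in q3 e1 e2; rewrite ler_norml; apply/andP; split; lra.
Qed.

Lemma generator_bound : exists Cg : R, forall c f u p (y : Y),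
  C2b f -> C2_bound c f -> 0 <= p <= 1 -> `|genG chi M f u (p, y)| <= Cg * c.
Proof.
have [Cj Cj0 hj] := jump_generator_bound; have [Cb Cb0 hb] := coefficient_bounds.
exists (5 * Cb + Cj) => c f u p y df fc p01; rewrite genG_bandit.
apply: le_trans (ler_normD _ _) _; rewrite mulrDl; apply: lerD; last exact: hj.
have [c1 c2 c3 c4 c5] := hb u p y p01.
have c0 : 0 <= c.
  by have [q _ _] := fc dirp dirp (mem_head _ _) (mem_head _ _) 0; exact: le_trans q.
have inp : dirp \in [:: dirp; dirh; dirr] by rewrite inE eqxx.
have inh : dirh \in [:: dirp; dirh; dirr] by rewrite !inE eqxx !orbT.
have inr : dirr \in [:: dirp; dirh; dirr] by rewrite !inE eqxx !orbT.
have bh : `|'D_dirh f (p, y)| <= c by have [] := fc dirh dirh inh inh (p, y).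
have br : `|'D_dirr f (p, y)| <= c by have [] := fc dirr dirr inr inr (p, y).
have bpp : `|'D_dirp ('D_dirp f) (p, y)| <= c by have [] := fc dirp dirp inp inp (p, y).
have bpr : `|'D_dirr ('D_dirp f) (p, y)| <= c by have [] := fc dirp dirr inp inr (p, y).
have brr : `|'D_dirr ('D_dirr f) (p, y)| <= c by have [] := fc dirr dirr inr inr (p, y).
exact: (second_order_bound c0 p01 bh br bpp bpr brr c1 c2 c3 c4 c5).
Qed.

Lemma cvg_generator (f : R * Y -> R) u p (y : Y) (an : nat -> R) (a : R) :
  C2b f -> 0 <= p <= 1 -> an n @[n --> \oo] --> a ->
  genG chi M (translate (an n *: dirr) f) u (p, y) @[n --> \oo] -->
  genG chi M (translate (a *: dirr) f) u (p, y).
Proof.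
move=> df p01 ana; under eq_fun do rewrite genG_bandit.
rewrite genG_bandit; apply: cvgD; last exact: cvg_jump_generator.
have t2 v : 'D_v (translate (an n *: dirr) f) (p, y) @[n --> \oo] -->
    'D_v (translate (a *: dirr) f) (p, y) by exact: cvg_derive_translate.
have t3 v w : 'D_w ('D_v (translate (an n *: dirr) f)) (p, y) @[n --> \oo] -->
    'D_w ('D_v (translate (a *: dirr) f)) (p, y) by exact: cvg_derive2_translate.
have c (b : R) : (fun _ : nat => b) @ \oo --> b by exact: cvg_cst.
exact: (cvgD (cvgD (cvgD (cvgD (cvgM (t2 dirh) (c _)) (cvgM (t2 dirr) (c _)))
  (cvgM (cvgM (cvgM (c _) (t3 dirp dirp)) (c _)) (c _)))
  (cvgM (c _) (cvgM (t3 dirp dirr) (c _)))) (cvgM (c _) (cvgM (t3 dirr dirr) (c _)))).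
Qed.

Lemma measurable_stateG : measurable (@stateG R).
Proof.
rewrite -[X in measurable X]setTI.
have -> : @stateG R = fst @^-1` `[0, 1]%classic.
  by apply/seteqP; split => q /=; rewrite in_itv.
exact: measurable_fst.
Qed.

(** The disjointified sets [seqDU away] have mass bounded uniformly in the state, and together they
    miss only the null point 0. *)
Lemma measurable_kernel_integral u x (F : (R * Y) * Y -> \bar R) :
  (forall q, (0 <= F q)%E) -> measurable_fun setT F ->
  measurable_fun setT (fun q : R * Y => \int[K M (u, x, q.2)]_z F (q, z))%E.
Proof.
move=> F0 mF.
apply: (@measurable_integral_family _ _ (R * Y)%type Y R (fun q => K M (u, x, q.2))
  (seqDU (@away R))) => //.
- move=> U mU.
  have mh : measurable_fun setT (fun q : R * Y => (u, x, q.2)).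
    by apply: measurable_fun_pair; [exact: measurable_cst|exact: measurable_snd].
  exact: (measurableT_comp (measurable_kernel (K M) U mU) mh).
- by apply: seqDU_measurable => n; exact: measurable_away.
- move=> n; have [C hC] := kernel_away_le a1.
  exists (C * n.+1%:R ^+ 2 + 1) => q.
  apply: (@le_lt_trans _ _ (K M (u, x, q.2) (away n))).
    apply: le_measure; rewrite ?inE.
    + by apply: seqDU_measurable => m; exact: measurable_away.
    + exact: measurable_away.
    + by move=> z [].
  by apply: le_lt_trans (hC _ _ _ _) _; rewrite lte_fin ltrDl.
- by move=> q; rewrite -seqDU_bigcup_eq bigcup_away setCK; exact: nn.
Qed.

(** Positive and negative parts are integrated separately, each as a mixture of integrals against
    the two kernels. The domain is [stateG] because [K_bar] is identified with a measure for [p] in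
    [[0, 1]]. *)
Lemma measurable_jump_generator (f : R * Y -> R) u : C2b f ->
  measurable_fun (@stateG R) (fun q => jump_generator f u q.1 q.2).
Proof.
move=> df; pose J := EFin \o (fun q : (R * Y) * Y => jump_integrand chi M f u q.1.1 q.1.2 q.2).
have mJ : measurable_fun setT J by apply/measurable_EFinP; exact: measurable_jump_integrand.
have mp := measurable_funepos mJ; have mn := measurable_funeneg mJ.
pose I (F : (R * Y) * Y -> \bar R) (q : R * Y) : \bar R :=
  (q.1%:E * \int[K M (u, true, q.2)]_z F (q, z) +
   (1 - q.1)%:E * \int[K M (u, false, q.2)]_z F (q, z))%E.
have mI F : (forall q, (0 <= F q)%E) -> measurable_fun setT F -> measurable_fun setT (I F).
  move=> F0 mF; apply: emeasurable_funD; apply: emeasurable_funM.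
  - by apply/measurable_EFinP; exact: measurable_fst.
  - exact: measurable_kernel_integral.
  - apply/measurable_EFinP; apply: measurable_funB; first exact: measurable_cst.
    exact: measurable_fst.
  - exact: measurable_kernel_integral.
have mE : measurable_fun setT (fun q => fine (I (J^\+)%E q - I (J^\-)%E q)%E).
  by apply: measurableT_comp => //; apply: emeasurable_funB; apply: mI.
apply: (eq_measurable_fun _ _ (measurable_funTS mE)) => -[p y]; rewrite inE => p01.
have [Cw Cw0 hw] := jump_measure; have [kb [e _ int _]] := hw u p y p01.
have mj : measurable_fun setT (fun z => (jump_integrand chi M f u p y z)%:E).
  by apply/measurable_EFinP; exact: measurable_jump_section.
rewrite /jump_generator e integralE/= (int _ _ (measurable_funepos mj))//
  (int _ _ (measurable_funeneg mj))//.
by rewrite /I/=; congr fine; congr (_ - _)%E; congr (_ + _)%E; congr (_ * _)%E;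
  apply: eq_integral => z _; rewrite ?funeposE ?funenegE.
Qed.

Lemma measurable_generator (f : R * Y -> R) u : C2b f ->
  measurable_fun (@stateG R) (genG chi M f u).
Proof.
move=> df; have [mf md mdd] := C2b_measurable df.
have -> : genG chi M f u = (fun q => local_generator f u q.1 q.2 + jump_generator f u q.1 q.2).
  by apply/funext => -[p y]; rewrite genG_bandit.
apply: measurable_funD; last exact: measurable_jump_generator.
apply: measurable_funTS.
have m1 : measurable_fun setT (fun q : R * Y => q.1) by exact: measurable_fst.
have snd_ (g : Y -> R) : measurable_fun setT g -> measurable_fun setT (fun q : R * Y => g q.2).
  by move=> mg; exact: (measurableT_comp mg measurable_snd).
have md' v : measurable_fun setT (fun q : R * Y => 'D_v f (q.1, q.2)).
  rewrite (_ : (fun q : R * Y => 'D_v f (q.1, q.2)) = 'D_v f); first exact: md.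
  by apply/funext => -[p y].
have mdd' v w : measurable_fun setT (fun q : R * Y => 'D_w ('D_v f) (q.1, q.2)).
  rewrite (_ : (fun q : R * Y => 'D_w ('D_v f) (q.1, q.2)) = 'D_w ('D_v f)); first exact: mdd.
  by apply/funext => -[p y].
have mc (c : R) : measurable_fun setT (fun _ : R * Y => c) by exact: measurable_cst.
have mq : measurable_fun setT (fun q : R * Y => 1 - q.1) by exact: measurable_funB.
have [_ hb hs _] := a1.
have ms : measurable_fun setT (fun q : R * Y => (sigma2 M u q.2).2.2).
  by apply: (snd_ (fun y => (sigma2 M u y).2.2)); have [_ _ _ []] := hs u.
have mphi : measurable_fun setT (fun q : R * Y => (phi1 M u q.2).2).
  apply: (snd_ (fun y => (phi1 M u y).2)); apply: continuous_measurable_prod => z.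
  have [_ _ cphi _] := a4.
  by apply: (continuous_comp (f := phi1 M u) (g := snd)); [exact: cphi|exact: cvg_snd].
have mqf : measurable_fun setT (fun q : R * Y => qform M u q.2).
  under eq_fun do rewrite (qform_bandit M_bandit).
  exact: measurable_funM ms (measurable_funX 2 mphi).
have mb1 : measurable_fun setT (fun q : R * Y => (beta_bar M u q.1 q.2).1).
  have h x := snd_ _ (hb u x).1.1.
  exact: measurable_funD (measurable_funM m1 (h true)) (measurable_funM mq (h false)).
have mb2 : measurable_fun setT (fun q : R * Y => (beta_bar M u q.1 q.2).2).
  have h x := snd_ _ (hb u x).2.1.
  exact: measurable_funD (measurable_funM m1 (h true)) (measurable_funM mq (h false)).
exact: (measurable_funD (measurable_funD (measurable_funD
  (measurable_funD (measurable_funM (md' dirh) mb1) (measurable_funM (md' dirr) mb2))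
  (measurable_funM (measurable_funM (measurable_funM (mc _) (mdd' dirp dirp))
     (measurable_funM (measurable_funX 2 m1) (measurable_funX 2 mq))) mqf))
  (measurable_funM (measurable_funM m1 mq) (measurable_funM (mdd' dirp dirr) (measurable_funM ms mphi))))
  (measurable_funM (mc _) (measurable_funM (mdd' dirr dirr) ms))).
Qed.

End generator_estimates.

(** * Comparison of the models with safe payoffs k and k' *)

Section comparison.
Context {R : realType}.
Local Notation Y := (R * R)%type.
Local Notation dirp := (@dirp R).
Local Notation dirh := (@dirh R).
Local Notation dirr := (@dirr R).
Variables (chi : Y -> Y) (chi_R : R -> R) (M M' : model R) (k k' : R)
  (beta_H beta_R : bool -> R -> R) (sigma_R : R -> R)
  (K_R : R.-ker (bool * R)%type ~> R).
Hypothesis chi_trunc : truncation_function chi chi_R.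
Hypothesis M_bandit : bandit chi M chi_R k beta_H beta_R sigma_R K_R.
Hypothesis M'_bandit : bandit chi M' chi_R k' beta_H beta_R sigma_R K_R.

Let nn : no_null_jumps M. Proof. by have [[]] := M_bandit. Qed.
Let a1 : A1 M. Proof. by have [[_ [[]]]] := M_bandit. Qed.
Let a2 : A2 chi M. Proof. by have [[_ [[]]]] := M_bandit. Qed.
Let a2' : A2 chi M'. Proof. by have [[_ [[]]]] := M'_bandit. Qed.
Let b1 : B1 M k beta_H beta_R sigma_R K_R. Proof. by have [] := M_bandit. Qed.
Let b1' : B1 M' k' beta_H beta_R sigma_R K_R. Proof. by have [] := M'_bandit. Qed.

Lemma kernel_comparison u x h r r' (A : set Y) : measurable A ->
  K M (u, x, (h, r)) A = K M' (u, x, (h, r')) A.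
Proof.
move=> mA; have [_ _ _ e] := b1; have [_ _ _ e'] := b1'.
have [e1 e2] := e x h r A mA; have [e1' e2'] := e' x h r' A mA.
by case: u; [rewrite e1 e1'|rewrite e2 e2'].
Qed.

Lemma phi2_comparison u h r r' :
  {ae K_sum M u (h, r), forall z, phi2 M u (h, r) z = phi2 M' u (h, r') z}.
Proof.
by apply: phi2_unique nn a1 a2 a2' _ => x A mA; exact: kernel_comparison.
Qed.

Lemma sigma2_comparison u h r r' : sigma2 M u (h, r) = sigma2 M' u (h, r').
Proof. by rewrite (sigma2_bandit M_bandit) (sigma2_bandit M'_bandit). Qed.

(** Where [sigma_R] vanishes, [phi1] is not determined by (A2), but its product with [sigma2] is. On
    the risky arm the drifts, the kernels and, almost everywhere, [phi2] agree in both models; on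
    the safe arm [sigma2] is 0. *)
Lemma sigma_phi1_comparison u h r r' :
  (sigma2 M u (h, r)).2.2 * (phi1 M u (h, r)).2 =
  (sigma2 M' u (h, r')).2.2 * (phi1 M' u (h, r')).2.
Proof.
case: u; last by rewrite (sigma2_bandit M_bandit) (sigma2_bandit M'_bandit)/= !mul0r.
have tens (N : model R) kN y : bandit chi N chi_R kN beta_H beta_R sigma_R K_R ->
    (tens_app (sigma2 N true y) (phi1 N true y)).2 = (sigma2 N true y).2.2 * (phi1 N true y).2.
  by move=> HN; rewrite /tens_app /dot (sigma2_bandit HN)/= mul0r add0r.
rewrite -(tens _ _ _ M_bandit) -(tens _ _ _ M'_bandit).
have [_ _ e] := a2; have [_ _ e'] := a2'; rewrite e e'.
have [_ be _ _] := b1; have [_ be' _ _] := b1'.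
have [b1t _] := be true h r; have [b1f _] := be false h r.
have [b1t' _] := be' true h r'; have [b1f' _] := be' false h r'.
rewrite b1t b1f b1t' b1f'.
suff -> : \int[K_sum M true (h, r)]_z ((phi2 M true (h, r) z - 1) * (chi z).2) =
  \int[K_sum M' true (h, r')]_z ((phi2 M' true (h, r') z - 1) * (chi z).2) by [].
rewrite /Rintegral; congr fine.
have m N y : A2 chi N -> measurable_fun setT (fun z => ((phi2 N true y z - 1) * (chi z).2)%:E).
  move=> aN; apply/measurable_EFinP; apply: measurable_funM; last exact: measurable_chi2 chi_trunc.
  by apply: measurable_funB; [exact: measurable_phi2 aN|exact: measurable_cst].
transitivity (\int[K_sum M true (h, r)]_z ((phi2 M' true (h, r') z - 1) * (chi z).2)%:E)%E.
  apply: ae_eq_integral => //; [exact: m|exact: m|].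
  by have := phi2_comparison true h r r'; apply: filterS => z ez _ /=; rewrite ez.
by apply: eq_measure_integral => D mD _; rewrite !K_sumE !(kernel_comparison _ _ _ _ r').
Qed.

(** Either the [r]-[r] entry of [sigma2] is 0 and both sides vanish, or it can be cancelled and the
    [r]-components of [phi1] agree. *)
Lemma qform_comparison u h r r' : qform M u (h, r) = qform M' u (h, r').
Proof.
rewrite (qform_bandit M_bandit) (qform_bandit M'_bandit).
have es := sigma2_comparison u h r r'; have ep := sigma_phi1_comparison u h r r'.
rewrite !expr2 !mulrA ep; move: ep; rewrite es.
have [->|s0] := eqVneq (sigma2 M' u (h, r')).2.2 0; first by rewrite !mul0r.
by move=> /(mulfI s0) ->.
Qed.

(** The kernels depend neither on [r] nor on the safe payoff, and the belief jumps agree almost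
    everywhere; the shift of [r] is carried by the test function. *)
Lemma jump_generator_comparison (f : R * Y -> R) u p h r a : C2b f -> 0 <= p <= 1 ->
  jump_generator chi M f u p (h, r - a) =
  jump_generator chi M' (translate (a *: dirr) f) u p (h, r).
Proof.
move=> df p01; rewrite /jump_generator; congr fine.
have [kb [e le _]] := K_bar_measure M u (h, r - a) p01.
have [kb' [e' _ _]] := K_bar_measure M' u (h, r) p01.
have dt : C2b (translate (a *: dirr) f) by exact: C2b_translate.
rewrite e e'.
have eK A : measurable A -> kb A = kb' A.
  by move=> mA; rewrite -e -e' /K_bar !(kernel_comparison _ _ _ _ r mA).
have mJ' : measurable_fun setT (fun z =>
    (jump_integrand chi M' (translate (a *: dirr) f) u p (h, r) z)%:E).
  by apply/measurable_EFinP; exact: (measurable_jump_section chi_trunc M'_bandit).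
rewrite -(@eq_measure_integral _ _ _ setT kb' kb); last by move=> A mA _; exact: eK.
apply: ae_eq_integral => //.
  by apply/measurable_EFinP; exact: (measurable_jump_section chi_trunc M_bandit).
have := ae_K_bar le (phi2_comparison u h (r - a) r).
apply: filterS => z ez _; congr (_%:E).
have ej : j M u p (h, r - a) z = j M' u p (h, r) z by rewrite /j ez.
have Dt v : 'D_v (translate (a *: dirr) f) (p, (h, r)) = 'D_v f (p, (h, r - a)).
  by rewrite derive_translate_at; exact: (translate_dirr ('D_v f) a p (h, r)).
rewrite /jump_integrand ej !Dt !translate_dirr.
have -> : (h, r - a) + z = (((h, r) + z).1, ((h, r) + z).2 - a) :> Y.
  by case: z {ez ej} => z1 z2; congr (_, _) => /=; rewrite addrAC.
by [].
Qed.

(** All coefficients that enter the generator agree except the drift of [R] on the safe arm, which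
    is [k] for [M] and [k'] for [M']. The last term is this difference times the [r]-derivative. *)
Lemma generator_comparison (f : R * Y -> R) u p h r a : C2b f -> 0 <= p <= 1 ->
  genG chi M f u (p, (h, r - a)) =
  genG chi M' (translate (a *: dirr) f) u (p, (h, r)) -
  'D_dirr f (p, (h, r - a)) * ((k' - k) * (~~ u)%:R).
Proof.
move=> df p01; rewrite (genG_bandit M_bandit) (genG_bandit M'_bandit).
rewrite -(jump_generator_comparison _ _ _ _ df p01).
have Dt v : 'D_v (translate (a *: dirr) f) (p, (h, r)) = 'D_v f (p, (h, r - a)).
  by rewrite derive_translate_at; exact: (translate_dirr ('D_v f) a p (h, r)).
have Dt2 v w : 'D_w ('D_v (translate (a *: dirr) f)) (p, (h, r)) = 'D_w ('D_v f) (p, (h, r - a)).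
  by rewrite derive2_translate_at; exact: (translate_dirr ('D_w ('D_v f)) a p (h, r)).
have [_ be _ _] := b1; have [_ be' _ _] := b1'.
have e1 : (beta_bar M u p (h, r - a)).1 = (beta_bar M' u p (h, r)).1.
  rewrite /beta_bar/=; have [t f0] := be true h (r - a); have [t1 f1] := be false h (r - a).
  have [t' f0'] := be' true h r; have [t1' f1'] := be' false h r.
  by case: u {Dt Dt2}; [rewrite t t1 t' t1'|rewrite f0 f1 f0' f1'].
(* The weights [p] and [1 - p] add up to 1, so the drift difference does not depend on the
   belief. *)
have e2 : (beta_bar M u p (h, r - a)).2 = (beta_bar M' u p (h, r)).2 - (k' - k) * (~~ u)%:R.
  rewrite /beta_bar/=; have [t f0] := be true h (r - a); have [t1 f1] := be false h (r - a).
  have [t' f0'] := be' true h r; have [t1' f1'] := be' false h r.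
  by case: u {Dt Dt2 e1}; [rewrite t t1 t' t1'|rewrite f0 f1 f0' f1'] => /=; rewrite /mix; ring.
have alg (x1 x2 x3 x4 x5 y1 y2 q s t x1' x2' x3' x4' x5' y1' y2' q' s' t' J C : R) :
    x1' = x1 -> x2' = x2 -> x3' = x3 -> x4' = x4 -> x5' = x5 ->
    y1 = y1' -> y2 = y2' - C -> q = q' -> s = s' -> t = t' ->
    x1 * y1 + x2 * y2 + 2^-1 * x3 * (p ^+ 2 * (1 - p) ^+ 2) * q
      + p * (1 - p) * (x4 * t) + 2^-1 * (x5 * s) + J =
    x1' * y1' + x2' * y2' + 2^-1 * x3' * (p ^+ 2 * (1 - p) ^+ 2) * q'
      + p * (1 - p) * (x4' * t') + 2^-1 * (x5' * s') + J - x2 * C.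
  by do 10 move=> ->; ring.
have es : (sigma2 M u (h, r - a)).2.2 = (sigma2 M' u (h, r)).2.2.
  by rewrite (sigma2_comparison u h (r - a) r).
exact: (alg _ _ _ _ _ _ _ _ _ _ _ _ _ _ _ _ _ _ _ _ _ _ (Dt dirh) (Dt dirr)
  (Dt2 dirp dirp) (Dt2 dirp dirr) (Dt2 dirr dirr) e1 e2
  (qform_comparison u h (r - a) r) es (sigma_phi1_comparison u h (r - a) r)).
Qed.

End comparison.

Lemma measurable_fun_pair_on d d1 d2 (T : measurableType d) (T1 : measurableType d1)
    (T2 : measurableType d2) (D : set T) (f : T -> T1) (g : T -> T2) : measurable D ->
  measurable_fun D f -> measurable_fun D g -> measurable_fun D (fun x => (f x, g x)).
Proof.
move=> mD /(measurable_restrictT _ mD) mf /(measurable_restrictT _ mD) mg.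
apply: (eq_measurable_fun _ _ (measurable_funTS (measurable_fun_pair mf mg))) => x xD.
by rewrite !patchE xD.
Qed.

(** Convergence in the discrete space [bool] means being eventually equal to the limit. *)
Lemma cvg_bool_fun (R : realType) (F : set_system R) (U : R -> bool) (b : bool) (g : bool -> R) :
  Filter F -> U @ F --> b -> (fun s => g (U s)) @ F --> g b.
Proof.
move=> FF /discrete_cvg Ub.
have h : F (U @^-1` [set b]) := Ub.
have c : (fun _ : R => g b) @ F --> g b by exact: cvg_cst.
suff h' : {near F, (fun _ => g b) =1 (fun s => g (U s))} by exact: (cvg_trans (near_eq_cvg h') c).
by apply: (@filterS _ F FF _ _ _ h) => s /= ->.
Qed.

(** * Joint measurability of controls and states in time and chance *)

Section joint_measurability.
Context {R : realType}.
Local Notation Y := (R * R)%type.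

Lemma cvg_coordinates {T : Type} (F : set_system T) (z : T -> R * Y) (l : R * Y) : Filter F ->
  z @ F --> l -> [/\ (fun s => (z s).1) @ F --> l.1, (fun s => (z s).2.1) @ F --> l.2.1 &
    (fun s => (z s).2.2) @ F --> l.2.2].
Proof.
move=> FF zl; have z2 : (fun s => (z s).2) @ F --> l.2 by apply: cvg_comp zl _; exact: cvg_snd.
split; first by apply: cvg_comp zl _; exact: cvg_fst.
  by apply: cvg_comp z2 _; exact: cvg_fst.
by apply: cvg_comp z2 _; exact: cvg_snd.
Qed.

Lemma measurable_cadlag d (T : measurableType d) (Z : R -> T -> R * Y) :
  (forall t, 0 <= t -> measurable_fun setT (Z t)) -> (forall w, cadlag (Z ^~ w)) ->
  measurable_fun (`[0, +oo[%classic `*` setT : set (R * T)) (fun tw : R * T => Z tw.1 tw.2).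
Proof.
move=> mZ cZ.
have rZ t w : 0 <= t -> Z s w @[s --> t^'+] --> Z t w by move=> /(cZ w)[].
have m1 : measurable_fun (`[0, +oo[%classic `*` setT : set (R * T)) (fun tw => (Z tw.1 tw.2).1).
  apply: (@measurable_right_continuous _ _ _ (fun t w => (Z t w).1)) => [t t0|t w t0].
    exact: (measurableT_comp measurable_fst (mZ _ t0)).
  by have [] := cvg_coordinates (at_right_proper_filter _) (rZ t w t0).
have m2 : measurable_fun (`[0, +oo[%classic `*` setT : set (R * T)) (fun tw => (Z tw.1 tw.2).2.1).
  apply: (@measurable_right_continuous _ _ _ (fun t w => (Z t w).2.1)) => [t t0|t w t0].
    exact: (measurableT_comp measurable_fst (measurableT_comp measurable_snd (mZ _ t0))).
  by have [] := cvg_coordinates (at_right_proper_filter _) (rZ t w t0).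
have m3 : measurable_fun (`[0, +oo[%classic `*` setT : set (R * T)) (fun tw => (Z tw.1 tw.2).2.2).
  apply: (@measurable_right_continuous _ _ _ (fun t w => (Z t w).2.2)) => [t t0|t w t0].
    exact: (measurableT_comp measurable_snd (measurableT_comp measurable_snd (mZ _ t0))).
  by have [] := cvg_coordinates (at_right_proper_filter _) (rZ t w t0).
have -> : (fun tw : R * T => Z tw.1 tw.2) =
    (fun tw => ((Z tw.1 tw.2).1, ((Z tw.1 tw.2).2.1, (Z tw.1 tw.2).2.2))).
  by apply/funext => tw; case: (Z tw.1 tw.2) => p [].
have mD : measurable (`[0, +oo[%classic `*` setT : set (R * T)) by exact: measurableX.
exact: (measurable_fun_pair_on mD m1 (measurable_fun_pair_on mD m2 m3)).
Qed.

Lemma measurable_caglad_bool d (T : measurableType d) (U : R -> T -> bool) :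
  (forall t, 0 <= t -> measurable_fun setT (U t)) -> (forall w, caglad (U ^~ w)) ->
  measurable_fun (`[0, +oo[%classic `*` setT : set (R * T)) (fun tw : R * T => U tw.1 tw.2).
Proof.
move=> mU cU.
have m : measurable_fun (`[0, +oo[%classic `*` setT : set (R * T)) (fun tw => (U tw.1 tw.2)%:R : R).
  apply: (@measurable_left_continuous _ _ _ (fun t w => (U t w)%:R)) => [t t0|t w t0].
    apply: (@measurableT_comp _ _ _ _ _ _ (fun b : bool => b%:R : R)); last exact: mU.
    by [].
  apply: (@cvg_bool_fun _ _ (U ^~ w) (U t w) (fun b => b%:R)).
  by have [h _] := cU w t (ltW t0); exact: h.
have -> : (fun tw : R * T => U tw.1 tw.2) = (fun tw => (U tw.1 tw.2)%:R == 1 :> R).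
  by apply/funext => tw; case: (U _ _); rewrite ?eqxx// eq_sym oner_eq0.
by apply: measurable_fun_eqr => //; exact: measurable_cst.
Qed.

(** A single path is a process on the one-point space [unit], so the joint measurability lemmas
    apply to it. *)
Lemma measurable_path d (E : measurableType d) (z : R -> E) :
  measurable_fun (`[0, +oo[%classic `*` setT : set (R * unit)) (fun tw => z tw.1) ->
  measurable_fun (`[0, +oo[%classic : set R) z.
Proof.
move=> h; change z with ((fun tw : R * unit => z tw.1) \o (fun t => (t, tt))).
apply: (measurable_comp _ _ h) => //.
- by apply: measurableX.
- by move=> _ [t t0] <-.
- exact/measurable_funTS/measurable_fun_pair.
Qed.

Lemma measurable_generator_path (chi : Y -> Y) (chi_R : R -> R) (M : model R) (k : R)
    (beta_H beta_R : bool -> R -> R) (sigma_R : R -> R)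
    (K_R : R.-ker (bool * R)%type ~> R) (f : R * Y -> R) (u : R -> bool) (z : R -> R * Y) :
  truncation_function chi chi_R -> bandit chi M chi_R k beta_H beta_R sigma_R K_R ->
  C2b f -> caglad u -> pathsG z ->
  measurable_fun (`[0, +oo[%classic : set R) (fun v => genG chi M f (u v) (z v)).
Proof.
move=> hchi HM df cu [cz sz].
have mz : measurable_fun (`[0, +oo[%classic : set R) z.
  apply: measurable_path; apply: (@measurable_cadlag _ unit (fun t _ => z t)) => [t _|_].
    exact: measurable_cst.
  exact: cz.
have mu : measurable_fun (`[0, +oo[%classic : set R) u.
  apply: measurable_path; apply: (@measurable_caglad_bool _ unit (fun t _ => u t)) => [t _|_].
    exact: measurable_cst.
  exact: cu.
have mg b : measurable_fun (`[0, +oo[%classic : set R) (fun v => genG chi M f b (z v)).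
  apply: (measurable_comp _ _ (measurable_generator hchi HM b df)) => //.
    exact: measurable_stateG.
  by move=> _ [v + <-]; rewrite /= in_itv/= andbT; exact: sz.
have -> : (fun v => genG chi M f (u v) (z v)) =
    (fun v => if u v then genG chi M f true (z v) else genG chi M f false (z v)).
  by apply/funext => v; case: (u v).
by apply: measurable_fun_if => //; apply: measurable_funS (mg _) => // v [].
Qed.

End joint_measurability.

(** * Shifted controls *)

Section safe_clock.
Context {R : realType} (B : stoch_basis R).
Variables (c : R) (U : R -> B -> bool).
Hypotheses (c0 : 0 <= c) (U_caglad : forall w, caglad (U ^~ w)) (U_adapted : adapted U).
Local Notation mu := (@lebesgue_measure R).

Definition safe_rate (v : R) (w : B) : R := c * (~~ U v w)%:R.

(** The process [A] of the overview, for [c = k' - k]. The interval is empty for [t <= 0], which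
    makes the clock continuous on the whole line. *)
Definition safe_clock (t : R) (w : B) : R := \int[mu]_(v in `]0, t]) safe_rate v w.

Lemma safe_rate_bound v w : 0 <= safe_rate v w <= c.
Proof. by rewrite /safe_rate; case: (U v w) => /=; rewrite ?mulr0 ?mulr1 lexx c0. Qed.

Lemma safe_rate_norm v w : `|safe_rate v w| <= c.
Proof. by have /andP[h1 h2] := safe_rate_bound v w; rewrite ger0_norm. Qed.

Lemma measurable_safe_rate w : measurable_fun (`[0, +oo[%classic : set R) (safe_rate ^~ w).
Proof.
apply: measurable_funM; first exact: measurable_cst.
apply: (@measurable_path R _ R (fun v => (~~ U v w)%:R)).
apply: (@measurable_left_continuous _ _ unit (fun t _ => (~~ U t w)%:R : R)) => [t t0|t _ t0].
  exact: measurable_cst.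
apply: (@cvg_bool_fun _ _ (U ^~ w) (U t w) (fun b => (~~ b)%:R)).
by have [h _] := U_caglad w (ltW t0); exact: h.
Qed.

Lemma safe_rate_integrable w a b : 0 <= a -> mu.-integrable (`]a, b] : set R) (EFin \o safe_rate ^~ w).
Proof.
move=> a0; apply: (bounded_integrable (C := c)) => //.
- exact: lebesgue_itvoc_lty.
- apply: (measurable_funS _ _ (measurable_safe_rate w)) => // v.
  by rewrite /= !in_itv/= andbT => /andP[av _]; rewrite ltW// (le_lt_trans a0).
- by move=> v _; exact: safe_rate_norm.
Qed.

Lemma safe_clock0 t w : t <= 0 -> safe_clock t w = 0.
Proof. by move=> t0; rewrite /safe_clock set_itv_ge ?Rintegral_set0// bnd_simp -leNgt. Qed.

Lemma safe_clock_integral v v' w : 0 <= v -> v <= v' ->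
  safe_clock v' w - safe_clock v w = \int[mu]_(x in `]v, v']) safe_rate x w.
Proof.
move=> v0 vv'; rewrite /safe_clock Rintegral_itvB ?bnd_simp//.
exact: safe_rate_integrable.
Qed.

Lemma safe_clock_lipschitz v v' w : 0 <= v -> v <= v' ->
  0 <= safe_clock v' w - safe_clock v w <= c * (v' - v).
Proof.
move=> v0 vv'; rewrite safe_clock_integral//; apply/andP; split.
  by apply: Rintegral_ge0 => x _; have /andP[] := safe_rate_bound x w.
have -> : v' - v = fine (mu `]v, v']).
  by rewrite lebesgue_measure_itv/= lte_fin; case: ltgtP vv' => // ->; rewrite subrr.
rewrite -Rintegral_cst//; apply: le_Rintegral => //.
- exact: safe_rate_integrable.
- apply: (bounded_integrable (C := c)) => //; first exact: lebesgue_itvoc_lty.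
  by move=> x _; rewrite ger0_norm.
- by move=> x _; have /andP[] := safe_rate_bound x w.
Qed.

Lemma safe_clock_dist s t w : `|safe_clock s w - safe_clock t w| <= c * `|s - t|.
Proof.
wlog st : s t / s <= t.
  move=> H; have [/H//|/ltW/H] := leP s t.
  by rewrite distrC [in X in _ -> _ <= X]distrC.
rewrite distrC [X in _ <= _ * X]distrC [X in _ <= _ * X]ger0_norm ?subr_ge0//.
have [t0|/ltW t0] := leP t 0.
  rewrite !safe_clock0 ?(le_trans st)// subrr normr0 mulr_ge0// subr_ge0//.
have [s0|/ltW s0] := leP 0 s.
  by have /andP[h1 h2] := safe_clock_lipschitz w s0 st; rewrite ger0_norm.
have /andP[h1 h2] := safe_clock_lipschitz w (lexx 0) t0.
rewrite (safe_clock0 w s0) -(safe_clock0 w (lexx 0)) ger0_norm//.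
by apply: (le_trans h2); rewrite ler_wpM2l//; lra.
Qed.

Lemma safe_clock_continuous w : continuous (safe_clock ^~ w).
Proof.
move=> t; apply/subr_cvg0/norm_cvg0P.
apply: (@squeeze_cvgr _ _ _ _ (cst 0) (fun s => c * `|s - t|)).
- by apply: nearW => s; rewrite normr_ge0/=; exact: safe_clock_dist.
- exact: cvg_cst.
- rewrite -[X in _ --> X](mulr0 c); apply: cvgM; first exact: cvg_cst.
  by apply/norm_cvg0P/subr_cvg0; exact: cvg_id.
Qed.

(** Up to [t] the left continuity of [U] applies; beyond [t] the stopped rate is constant. *)
Lemma safe_rate_stopped_left_continuous s t w : 0 < s ->
  safe_rate (Num.min v t) w @[v --> s^'-] --> safe_rate (Num.min s t) w.
Proof.
move=> s0; have [st|ts] := leP s t.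
  apply: (@cvg_trans _ (safe_rate v w @[v --> s^'-])).
    apply: near_eq_cvg; near=> v; rewrite /safe_rate (min_idPl _)//.
    by apply: le_trans st; apply/ltW; near: v; exact: nbhs_left_lt.
  apply: cvgM; first exact: cvg_cst.
  apply: (@cvg_bool_fun _ _ (U ^~ w) (U s w) (fun b => (~~ b)%:R)).
  by have [h _] := U_caglad w (ltW s0); exact: h.
apply: (@cvg_trans _ ((fun _ : R => safe_rate t w) @ s^'-)); last exact: cvg_cst.
apply: near_eq_cvg; near=> v; rewrite /= (min_idPr _)//.
by apply/ltW; near: v; exact: nbhs_left_gt.
Unshelve. all: by end_near. Qed.

(** Progressive measurability. Stopping the rate at [t] leaves it unchanged on []0, t]] and makes
    all its values [F t]-measurable; left continuity gives joint measurability for [F t], and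
    Tonelli does the rest. *)
Lemma filt_measurable_safe_clock t : 0 <= t -> filt_measurable t (safe_clock t).
Proof.
move=> t0; pose T := g_sigma_algebraType (@sb_filt R B t).
pose z (s : R) (w : T) := safe_rate (Num.min s t) w.
have mz : measurable_fun (`[0, +oo[%classic `*` setT : set (R * T)) (fun sw => z sw.1 sw.2).
  apply: measurable_left_continuous => [s s0|s w s0].
    have st0 : 0 <= Num.min s t by rewrite le_min s0.
    apply: measurable_funM; first exact: measurable_cst.
    apply: (@measurableT_comp _ _ _ _ _ _ (fun b : bool => (~~ b)%:R : R)).
      by [].
    apply: (@filt_measurableW _ _ _ _ (Num.min s t)) => //; first by rewrite ge_min lexx orbT.
    by apply/filt_measurableP => // A mA; exact: U_adapted.
  exact: safe_rate_stopped_left_continuous.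
pose D : set (R * T) := `]0, t]%classic `*` setT.
have mD : measurable D by apply: measurableX.
pose h := (EFin \o (fun sw : R * T => z sw.1 sw.2)) \_ D.
have mh : measurable_fun setT h.
  apply/(measurable_restrictT _ mD)/measurable_EFinP.
  apply: (measurable_funS _ _ mz); first exact: measurableX.
  by move=> [s w] [/=]; rewrite !in_itv/= andbT => /andP[s0 _] _; rewrite (ltW s0).
have h0 q : (0 <= h q)%E.
  rewrite /h patchE; case: ifP => // _; rewrite lee_fin /z.
  by have /andP[] := safe_rate_bound (Num.min q.1 t) q.2.
have := @measurable_fun_fubini_tonelli_G _ _ _ _ _ mu h mh h0.
move=> mG; have -> : safe_clock t = fine \o (fun w : T => \int[mu]_s h (s, w))%E.
  apply/funext => w; rewrite /safe_clock /Rintegral /=; congr fine.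
  rewrite integral_mkcond; apply: eq_integral => s _.
  have sD : ((s, w) \in D) = (s \in (`]0, t]%classic : set R)).
    by apply/idP/idP; rewrite !inE => // -[].
  rewrite /h !patchE sD; case: ifPn => //.
  by rewrite inE /= in_itv/= => /andP[_ st]; rewrite /z (min_idPl st).
by apply: (@measurableT_comp _ _ _ _ _ _ fine); [exact: fine_measurable|exact: mG].
Qed.

End safe_clock.

Section translation_along_line.
Context {R : realType} {E : normedModType R}.

(** The minus sign arises because [translate (a *: v) f x] is [f] at [x - a *: v]. *)
Lemma translate_mvt (f : E -> R) (x v : E) (a a' : R) : (forall y, derivable f y v) -> a <= a' ->
  exists2 xi, a <= xi <= a' &
    translate (a' *: v) f x - translate (a *: v) f x =
    - (translate (xi *: v) ('D_v f) x * (a' - a)).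
Proof.
move=> df aa'; have [xi [h1 h2 h3]] := line_mvt x (- a) (- a') df.
move: h1 h2; rewrite min_r ?lerN2// max_l ?lerN2// => h1 h2.
exists (- xi); first by rewrite lerNr h2 lerNl h1.
have e b : x - b *: v = x + (- b) *: v by rewrite scaleNr.
by rewrite /translate !e h3 !opprK -mulrN opprB [- a' + a]addrC.
Qed.

Lemma cvg_translate_joint (g : E -> R) (zn : nat -> E) (an : nat -> R) (z v : E) (a : R) :
  continuous g -> zn n @[n --> \oo] --> z -> an n @[n --> \oo] --> a ->
  translate (an n *: v) g (zn n) @[n --> \oo] --> translate (a *: v) g z.
Proof.
move=> cg znz ana; rewrite /translate; apply: continuous_cvg; first exact: cg.
by apply: cvgB => //; exact: cvgZr_tmp.
Qed.

End translation_along_line.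

Lemma Rintegral_increment (R : realType) (F : R -> R) (C s t : R) :
  measurable_fun (`[0, +oo[%classic : set R) F -> (forall v, 0 <= v -> `|F v| <= C) ->
  0 <= s -> s <= t ->
  \int[lebesgue_measure]_(v in `[0, t]) F v - \int[lebesgue_measure]_(v in `[0, s]) F v =
  \int[lebesgue_measure]_(v in `]s, t]) F v.
Proof.
move=> mF FC s0 st; rewrite Rintegral_itvB ?bnd_simp//.
have mut : (lebesgue_measure (`[0%R, t]%classic : set R) < +oo)%E.
  by rewrite lebesgue_measure_itv/=; case: ifP => _; rewrite ?ltry// -EFinB ltry.
apply: (bounded_integrable (C := C)) => //.
- by apply: (measurable_funS _ _ mF) => // v; rewrite /= !in_itv/= andbT => /andP[].
- by move=> v; rewrite /= in_itv/= => /andP[v0 _]; exact: FC.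
Qed.

Section shifted_control.
Context {R : realType}.
Local Notation Y := (R * R)%type.
Local Notation dirp := (@dirp R).
Local Notation dirh := (@dirh R).
Local Notation dirr := (@dirr R).
Variables (chi : Y -> Y) (chi_R : R -> R) (M M' : model R) (k k' : R)
  (beta_H beta_R : bool -> R -> R) (sigma_R : R -> R)
  (K_R : R.-ker (bool * R)%type ~> R).
Hypothesis chi_trunc : truncation_function chi chi_R.
Hypothesis M_bandit : bandit chi M chi_R k beta_H beta_R sigma_R K_R.
Hypothesis M'_bandit : bandit chi M' chi_R k' beta_H beta_R sigma_R K_R.
Hypothesis kk' : k <= k'.
Variables (B : stoch_basis R) (U : R -> B -> bool) (Z : R -> B -> R * Y).
Hypothesis UZ_control : separated_control chi M' U Z.

Let c := k' - k.
Let c0 : 0 <= c. Proof. by rewrite subr_ge0. Qed.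
Let U_adapted : adapted U. Proof. by have [] := UZ_control. Qed.
Let U_caglad : forall w, caglad (U ^~ w). Proof. by have [] := UZ_control. Qed.
Let Z_paths : forall w, pathsG (Z ^~ w). Proof. by have [] := UZ_control. Qed.

Definition shifted (t : R) (w : B) : R * Y :=
  ((Z t w).1, ((Z t w).2.1, (Z t w).2.2 - safe_clock c U t w)).

(** Moves the shift from the process to the test function, where the martingale property of the
    original control can be used. *)
Lemma shifted_translate (f : R * Y -> R) t w :
  f (shifted t w) = translate (safe_clock c U t w *: dirr) f (Z t w).
Proof.
rewrite /shifted; case: (Z t w) => p y.
exact: esym (translate_dirr f (safe_clock c U t w) p y).
Qed.

Lemma shifted0 w : shifted 0 w = Z 0 w.
Proof. by rewrite /shifted safe_clock0// subr0; case: (Z 0 w) => p []. Qed.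

Lemma shifted_paths w : pathsG (shifted ^~ w).
Proof.
have [cz sz] := Z_paths w; split => // t t0; have [rz lz] := cz t t0.
have ca : continuous (safe_clock c U ^~ w) by exact: safe_clock_continuous.
split.
  have [r1 r2 r3] := cvg_coordinates (at_right_proper_filter _) rz.
  apply: cvg_to_pair => //; apply: cvg_to_pair => //; apply: cvgB => //.
  by apply: cvg_at_right_filter; exact: ca.
move=> /lz[l zl]; exists (l.1, (l.2.1, l.2.2 - safe_clock c U t w)).
have [r1 r2 r3] := cvg_coordinates (at_left_proper_filter _) zl.
apply: cvg_to_pair => //; apply: cvg_to_pair => //; apply: cvgB => //.
by apply: cvg_at_left_filter; exact: ca.
Qed.

Lemma shifted_adapted : adapted shifted.
Proof.
move=> t A t0 mA; have [_ _ aZ _ _] := UZ_control.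
have mZ : filt_measurable t (Z t) by apply/filt_measurableP => // D mD; exact: aZ.
have mS : filt_measurable t (shifted t).
  have m2 := measurableT_comp measurable_snd mZ.
  apply: measurable_fun_pair; first exact: (measurableT_comp measurable_fst mZ).
  apply: measurable_fun_pair; first exact: (measurableT_comp measurable_fst m2).
  apply: measurable_funB; first exact: (measurableT_comp measurable_snd m2).
  exact: filt_measurable_safe_clock.
by move/(filt_measurableP _ t0) : mS; apply.
Qed.

Lemma stateG_path v w : 0 <= v -> 0 <= (Z v w).1 <= 1.
Proof. by have [_ h] := Z_paths w; exact: h. Qed.

(** [C] does not depend on the shift [a], since [C2_bound] is invariant under translation. *)
Lemma generator_path_bound (N : model R) kN (f : R * Y -> R) :
  bandit chi N chi_R kN beta_H beta_R sigma_R K_R -> C2b f ->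
  exists C, forall a u (z : R * Y), 0 <= z.1 <= 1 ->
    `|genG chi N (translate (a *: dirr) f) u z| <= C.
Proof.
move=> HN df; have [cb hcb] := C2_bound_exists df.
have [Cg hCg] := generator_bound chi_trunc HN.
exists (Cg * cb) => a u [p y] p01.
exact: hCg (C2b_translate _ df) (C2_bound_translate _ hcb) p01.
Qed.

Lemma martingale_increment (f : R * Y -> R) s t : C2b f -> 0 <= s -> s <= t ->
  mart_diff s t (fun w => f (Z t w) - f (Z s w) -
    \int[lebesgue_measure]_(v in `]s, t]) genG chi M' f (U v w) (Z v w)).
Proof.
move=> df s0 st; have t0 := le_trans s0 st.
have [_ _ _ _ mart] := UZ_control.
have [C hC] := generator_path_bound M'_bandit df.
have hC0 u (z : R * Y) : 0 <= z.1 <= 1 -> `|genG chi M' f u z| <= C.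
  move=> z01; have := hC 0 u z z01.
  have -> : translate (0 *: dirr) f = f; last by [].
  by apply/funext => x; rewrite /translate scale0r subr0.
have mg w := measurable_generator_path chi_trunc M'_bandit df (U_caglad w) (Z_paths w).
have bg w v : 0 <= v -> `|genG chi M' f (U v w) (Z v w)| <= C.
  by move=> v0; apply: hC0; exact: stateG_path.
pose N t w := f (Z t w) - f (Z 0 w) -
        \int[lebesgue_measure]_(s in `[0, t]) genG chi M' f (U s w) (Z s w).
have eN : (fun w => f (Z t w) - f (Z s w) -
    \int[lebesgue_measure]_(v in `]s, t]) genG chi M' f (U v w) (Z v w)) =
    (fun w => N t w - N s w).
  apply/funext => w; rewrite -(Rintegral_increment (mg w) (bg w) s0 st) /N.
  have alg (x y z i j : R) : x - y - (i - j) = x - z - i - (y - z - j) by ring.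
  exact: alg.
have [[_ [cb hcb]] _] := df.
have mN : martingale N := mart f df.
have sub : (`]s, t] : set R) `<=` `[0, +oo[.
  by move=> v; rewrite /= !in_itv/= andbT => /andP[sv _]; rewrite ltW// (le_lt_trans s0).
have Nb w : `|N t w - N s w| <= cb + cb + C * fine (lebesgue_measure (`]s, t] : set R)).
  rewrite -[X in `|X|](congr1 (@^~ w) eN).
  apply: le_trans (ler_normB _ _) _; apply: lerD.
    exact: le_trans (ler_normB _ _) (lerD (hcb _) (hcb _)).
  have bg' v : (`]s, t]%classic : set R) v -> `|genG chi M' f (U v w) (Z v w)| <= C.
    by move=> vst; apply: bg; have := sub v vst; rewrite /= in_itv/= andbT.
  have mg' : measurable_fun (`]s, t] : set R) (fun v => genG chi M' f (U v w) (Z v w)).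
    by apply: measurable_funS (mg w).
  by apply: Rintegral_norm_le => //; exact: lebesgue_itvoc_lty.
rewrite eN; exact: (martingale_mart_diff s0 st mN Nb).
Qed.

(** The correction [- psi * alpha] of [mart_diff_random_translation] is exactly the drift difference
    in [generator_comparison], so the drift of the shifted process is the generator of [M]. *)
Lemma shifted_mart_diff (f : R * Y -> R) s t : C2b f -> 0 <= s -> s <= t ->
  mart_diff s t (fun w => f (shifted t w) - f (shifted s w) -
    \int[lebesgue_measure]_(v in `]s, t]) genG chi M f (U v w) (shifted v w)).
Proof.
move=> df s0 st; have [cb hcb] := C2_bound_exists df.
have [C hC] := generator_path_bound M'_bandit df.
have [[cf _] df2] := df; have [dfr [cfr _] _] := df2 dirr.
have inr : dirr \in [:: dirp; dirh; dirr] by rewrite !inE eqxx !orbT.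
have bf x : `|f x| <= cb by have [] := hcb dirr dirr inr inr x.
have br x : `|'D_dirr f x| <= cb by have [] := hcb dirr dirr inr inr x.
pose phi v a w := translate (a *: dirr) f (Z v w).
pose psi v a w := translate (a *: dirr) ('D_dirr f) (Z v w).
pose g v a w := genG chi M' (translate (a *: dirr) f) (U v w) (Z v w).
have dt a : C2b (translate (a *: dirr) f) by exact: C2b_translate.
have gE v w : 0 <= v -> genG chi M f (U v w) (shifted v w) =
    g v (safe_clock c U v w) w - psi v (safe_clock c U v w) w * safe_rate c U v w.
  move=> v0; have := stateG_path w v0.
  rewrite /g /psi /shifted; case: (Z v w) => p [h r] p01.
  rewrite (generator_comparison chi_trunc M_bandit M'_bandit (U v w) h r (safe_clock c U v w) df p01).
  by rewrite (translate_dirr ('D_dirr f) (safe_clock c U v w) p (h, r)).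
have -> : (fun w => f (shifted t w) - f (shifted s w) -
    \int[lebesgue_measure]_(v in `]s, t]) genG chi M f (U v w) (shifted v w)) =
  (fun w => phi t (safe_clock c U t w) w - phi s (safe_clock c U s w) w -
    \int[lebesgue_measure]_(v in `]s, t]) (g v (safe_clock c U v w) w -
       psi v (safe_clock c U v w) w * safe_rate c U v w)).
  apply/funext => w; rewrite !shifted_translate; congr (_ - _).
  apply: eq_Rintegral => v; rewrite inE/= in_itv/= => /andP[sv _]; apply: gE.
  by rewrite ltW// (le_lt_trans s0).
apply: (@mart_diff_random_translation R B phi psi g _ _ cb C cb c) => //.
- by move=> v a w _; exact: bf.
- by move=> v a w v0; apply: hC; exact: stateG_path.
- by move=> v a w _; exact: br.
- by move=> v w; exact: safe_rate_norm.
- by move=> v a a' w _; exact: translate_mvt.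
- move=> a w; exact: (measurable_generator_path chi_trunc M'_bandit (dt a) (U_caglad w) (Z_paths w)).
- move=> v w an a v0 ana; have := stateG_path w v0; rewrite /g; case: (Z v w) => p y p01.
  by apply: (cvg_generator chi_trunc M'_bandit).
- by move=> v w an a _ ana; apply: cvg_translate.
- move=> vn an v a w v0 vvn vnv ana; apply: cvg_translate_joint => //.
  have [cz _] := Z_paths w; have [rz _] := cz v v0.
  by apply: (@cvg_right_seq _ _ (Z ^~ w)).
- by move=> w; exact: measurable_safe_rate.
- by move=> w; exact: safe_clock0.
- by move=> v v' w; exact: safe_clock_lipschitz.
- by move=> v v' w; exact: safe_clock_integral.
- by move=> v; exact: filt_measurable_safe_clock.
- by move=> a s' t' s0' st'; exact: (martingale_increment (dt a) s0' st').
Qed.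

Lemma shifted_separated_control : separated_control chi M U shifted.
Proof.
split; [exact: U_adapted|exact: U_caglad|exact: shifted_adapted|exact: shifted_paths|].
move=> f df; apply: mart_diff_martingale => [w|s t s0 st].
  by rewrite subrr set_itv1 Rintegral_set1 subrr.
have [C hC] := generator_path_bound M_bandit df.
have hC0 u (z : R * Y) : 0 <= z.1 <= 1 -> `|genG chi M f u z| <= C.
  move=> z01; have := hC 0 u z z01.
  have -> : translate (0 *: dirr) f = f; last by [].
  by apply/funext => x; rewrite /translate scale0r subr0.
have mg w := measurable_generator_path chi_trunc M_bandit df (U_caglad w) (shifted_paths w).
have bg w v : 0 <= v -> `|genG chi M f (U v w) (shifted v w)| <= C.
  by move=> v0; apply: hC0; have [_ h] := shifted_paths w; exact: h.
have := shifted_mart_diff df s0 st; congr (mart_diff s t _).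
apply/funext => w; rewrite -(Rintegral_increment (mg w) (bg w) s0 st).
have alg (x y z i j : R) : x - y - (i - j) = x - z - i - (y - z - j) by ring.
exact: alg.
Qed.

End shifted_control.

(** * Discounted values *)

Section discounted_values.
Context {R : realType} (rho : R).
Hypothesis rho0 : 0 < rho.
Local Notation mu := (@lebesgue_measure R).
Local Notation halfline := (`[0%R, +oo[%classic : set R).

Let e (t : R) : R := rho * expR (- (rho * t)).

Let e0 t : 0 <= e t.
Proof. by rewrite mulr_ge0 ?expR_ge0// ltW. Qed.

Let me : measurable_fun setT e.
Proof.
apply: measurable_funM; first exact: measurable_cst.
apply: measurableT_comp; first exact: measurable_expR.
by apply: measurableT_comp => //; apply: measurable_funM => //; exact: measurable_cst.
Qed.

(** The discount factor is the density of the exponential law of rate [rho]. *)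
Lemma integral_discount : (\int[mu]_(t in halfline) (e t)%:E = 1)%E.
Proof.
rewrite -(integral_exponential_pdf rho0) integral_mkcond; apply: eq_integral => t _.
rewrite /exponential_pdf !patchE; case: ifP => // _.
by rewrite /e mulNr.
Qed.

Let me' : measurable_fun halfline (fun t => (e t)%:E).
Proof. by apply/measurable_EFinP; exact: measurable_funTS. Qed.

Let ie : mu.-integrable halfline (EFin \o e).
Proof.
apply/integrableP; split; first exact: me'.
suff -> : (\int[mu]_(t in halfline) `|(EFin \o e) t| = 1)%E by rewrite ltry.
by rewrite -integral_discount; apply: eq_integral => t _ /=; rewrite ger0_norm.
Qed.

Lemma discounted_integrable (v : R -> R) (C : R) : measurable_fun halfline v ->
  (forall t, 0 <= t -> `|v t| <= C) -> mu.-integrable halfline (EFin \o (fun t => e t * v t)).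
Proof.
move=> mv vC; apply: (@le_integrable _ _ _ mu halfline _ _ (EFin \o (fun t => C * e t))) => //.
- by apply/measurable_EFinP; apply: measurable_funM => //; exact: measurable_funTS.
- move=> t; rewrite /= in_itv/= andbT => t0; rewrite lee_fin normrM (ger0_norm (e0 t)).
  have h : e t * `|v t| <= C * e t by rewrite [leRHS]mulrC; exact: ler_wpM2l (e0 t) _ _ (vC t t0).
  exact: le_trans h (ler_norm _).
- have iCe : mu.-integrable halfline (fun t => C%:E * (EFin \o e) t)%E by exact: integrableZl.
  by apply: eq_integrable iCe => // t _; rewrite /= EFinM.
Qed.

Lemma Rintegral_discount_cst (c : R) : \int[mu]_(t in halfline) (e t * c) = c.
Proof.
by rewrite RintegralZr// /Rintegral integral_discount mul1r.
Qed.

Section random.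
Context d (T : measurableType d) (P : probability T R).

Definition discounted (v : R -> T -> R) (w : T) : R := \int[mu]_(t in halfline) (e t * v t w).

Lemma discounted_EFin (v : R -> T -> R) (C : R) w : measurable_fun halfline (v ^~ w) ->
  (forall t, 0 <= t -> `|v t w| <= C) ->
  (\int[mu]_(t in halfline) (e t * v t w)%:E)%E = (discounted v w)%:E.
Proof.
move=> mv vC; rewrite /discounted /Rintegral fineK//.
by apply: integrable_fin_num => //; exact: discounted_integrable mv vC.
Qed.

Lemma discounted_bound (v : R -> T -> R) (C : R) w : measurable_fun halfline (v ^~ w) ->
  (forall t, 0 <= t -> `|v t w| <= C) -> `|discounted v w| <= C.
Proof.
move=> mv vC; have iv := discounted_integrable mv vC.
apply: (@le_trans _ _ (\int[mu]_(t in halfline) `|e t * v t w|)); first exact: le_normr_Rintegral.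
rewrite -[leRHS]Rintegral_discount_cst; apply: le_Rintegral => //.
- by apply: integrable_norm.
- apply: (@discounted_integrable (fun=> C) `|C|) => //.
- move=> t; rewrite /= in_itv/= andbT => t0; rewrite normrM (ger0_norm (e0 t)).
  exact: ler_wpM2l (e0 t) _ _ (vC t t0).
Qed.

Lemma measurable_section (v : R -> T -> R) w :
  measurable_fun (halfline `*` setT : set (R * T)) (fun tw => v tw.1 tw.2) ->
  measurable_fun halfline (v ^~ w).
Proof.
move=> mv; change (v ^~ w) with ((fun tw : R * T => v tw.1 tw.2) \o (fun t => (t, w))).
apply: (measurable_comp _ _ mv) => //.
- exact: measurableX.
- by move=> _ [t t0] <-.
- by apply: measurable_funTS; apply: measurable_fun_pair => //; exact: measurable_cst.
Qed.

Lemma measurable_discounted (v : R -> T -> R) (C : R) :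
  measurable_fun (halfline `*` setT : set (R * T)) (fun tw => v tw.1 tw.2) ->
  (forall t w, 0 <= t -> `|v t w| <= C) -> measurable_fun setT (discounted v).
Proof.
move=> mv vC; have mvw w := measurable_section w mv.
pose D : set (R * T) := halfline `*` setT.
have mD : measurable D by exact: measurableX.
(* Tonelli asks for a nonnegative integrand, hence [v + C]. The constant has discounted integral [C]
   and is subtracted afterwards. *)
pose h := (EFin \o (fun tw : R * T => e tw.1 * (v tw.1 tw.2 + C))) \_ D.
have mh : measurable_fun setT h.
  apply/(measurable_restrictT _ mD)/measurable_EFinP; apply: measurable_funM.
    by apply: measurable_funTS; exact: (measurableT_comp me measurable_fst).
  by apply: measurable_funD => //; exact: measurable_cst.
have h0 q : (0 <= h q)%E.
  rewrite /h patchE; case: ifPn => //; rewrite inE => -[/= q0 _].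
  rewrite lee_fin mulr_ge0// -lerBlDr sub0r.
  have t0 : 0 <= q.1 by move: q0; rewrite in_itv/= andbT.
  by have := vC q.1 q.2 t0; rewrite ler_norml => /andP[].
have mG := @measurable_fun_fubini_tonelli_G _ _ _ _ _ mu h mh h0.
have -> : discounted v = (fun w => fine (\int[mu]_t h (t, w))%E - C).
  apply/funext => w.
  have -> : (\int[mu]_t h (t, w))%E = (\int[mu]_(t in halfline) (e t * (v t w + C))%:E)%E.
    rewrite [RHS]integral_mkcond; apply: eq_integral => t _.
    rewrite /h !patchE; have -> // : ((t, w) \in D) = (t \in halfline).
    by apply/idP/idP; rewrite !inE => // -[].
  rewrite -[fine _]/(\int[mu]_(t in halfline) (e t * (v t w + C))).
  under [in RHS]eq_Rintegral do rewrite mulrDr.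
  rewrite RintegralD//.
  - by rewrite Rintegral_discount_cst addrK.
  - exact: discounted_integrable (mvw w) (fun t => vC t w).
  - by apply: (@discounted_integrable (fun=> C) `|C|).
apply: measurable_funB; last exact: measurable_cst.
by apply: (@measurableT_comp _ _ _ _ _ _ fine); [exact: fine_measurable|exact: mG].
Qed.

(** The constant [c] passes through both integrals unchanged, because the discount and [P] have
    total mass 1. The extended integrals are first turned into real ones, where linearity is
    available. *)
Lemma discounted_le (v v' : R -> T -> R) (C c : R) :
  measurable_fun (halfline `*` setT : set (R * T)) (fun tw => v tw.1 tw.2) ->
  measurable_fun (halfline `*` setT : set (R * T)) (fun tw => v' tw.1 tw.2) ->
  (forall t w, 0 <= t -> `|v t w| <= C) -> (forall t w, 0 <= t -> `|v' t w| <= C) ->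
  (forall t w, 0 <= t -> v' t w <= v t w + c) ->
  (\int[P]_w \int[mu]_(t in halfline) (e t * v' t w)%:E <=
   \int[P]_w \int[mu]_(t in halfline) (e t * v t w)%:E + c%:E)%E.
Proof.
move=> mv mv' vC v'C vv'; have mvw w := measurable_section w mv; have mv'w w := measurable_section w mv'.
have PT : (P setT < +oo)%E by rewrite probability_setT ltry.
have iX (u : R -> T -> R) : measurable_fun (halfline `*` setT : set (R * T)) (fun tw => u tw.1 tw.2) ->
    (forall t w, 0 <= t -> `|u t w| <= C) -> P.-integrable setT (EFin \o discounted u).
  move=> mu_ uC; apply: (bounded_integrable (C := C)) => //; first exact: measurable_discounted mu_ uC.
  by move=> w _; exact: (discounted_bound (measurable_section w mu_) (fun t => uC t w)).
have ic : P.-integrable setT (EFin \o (fun _ : T => c)).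
  by apply: (bounded_integrable (C := `|c|)).
under eq_integral do rewrite (discounted_EFin (mv'w _) (fun t => v'C t _)).
under [X in (_ <= X + _)%E]eq_integral do rewrite (discounted_EFin (mvw _) (fun t => vC t _)).
have -> : (c%:E = \int[P]_w c%:E)%E.
  by rewrite integral_cst// [X in (_ * X)%E](_ : _ = 1%E) ?mule1//; exact: probability_setT.
rewrite -integralD//; last exact: iX.
apply: le_integral => //; first exact: iX.
  by apply: integrableD => //; exact: iX.
move=> w _; rewrite /= -EFinD lee_fin -[X in _ <= _ + X]Rintegral_discount_cst /discounted.
rewrite -RintegralD//.
- apply: le_Rintegral => //.
  + exact: discounted_integrable (mv'w w) (fun t => v'C t w).
  + have : mu.-integrable halfline (EFin \o (fun t => e t * (v t w + c))).
      apply: (@discounted_integrable _ (C + `|c|)).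
        by apply: measurable_funD => //; exact: measurable_cst.
      by move=> t t0; apply: le_trans (ler_normD _ _) _; rewrite lerD2r; exact: vC.
    by apply: eq_integrable => // t _; rewrite /= mulrDr.
  + move=> t; rewrite /= in_itv/= andbT => t0; rewrite -mulrDr.
    exact: ler_wpM2l (e0 t) _ _ (vv' t w t0).
- exact: discounted_integrable (mvw w) (fun t => vC t w).
- by apply: (@discounted_integrable (fun=> c) `|c|).
Qed.

End random.
End discounted_values.

(** * Boundedness and measurability of the reward rate *)

Section control_reward.
Context {R : realType}.
Local Notation Y := (R * R)%type.
Variables (chi : Y -> Y) (M : model R).
Hypothesis a1 : A1 M.

Lemma b_bar_bound : exists C, forall u p (y : Y), 0 <= p <= 1 -> `|b_bar M u p y| <= C.
Proof.
have [hb _ _ _] := a1.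
have [C hC] : exists C, forall u x (y : Y), `|b M u x y| <= C.
  apply: bool_uniform_bound => [u C C' CC' H x y|u]; first exact: le_trans CC'.
  apply: bool_uniform_bound => [x C C' CC' H y|x]; first exact: le_trans CC'.
  by have [_] := hb u x.
exists C => u p y /andP[p0 p1]; have q0 : 0 <= 1 - p by rewrite subr_ge0.
rewrite /b_bar /mix; apply: le_trans (ler_normD _ _) _.
rewrite !normrM (ger0_norm p0) (ger0_norm q0).
have h1 : p * `|b M u true y| <= p * C by exact: ler_wpM2l p0 _ _ (hC u true y).
have h2 : (1 - p) * `|b M u false y| <= (1 - p) * C by exact: ler_wpM2l q0 _ _ (hC u false y).
lra.
Qed.

Lemma measurable_reward (B : stoch_basis R) (U : R -> B -> bool) (Z : R -> B -> R * Y) :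
  separated_control chi M U Z ->
  measurable_fun (`[0%R, +oo[%classic `*` setT : set (R * B))
    (fun tw => b_bar M (U tw.1 tw.2) (Z tw.1 tw.2).1 (Z tw.1 tw.2).2).
Proof.
move=> [aU cU aZ pZ _]; have [hb _ _ _] := a1.
have mU : measurable_fun (`[0%R, +oo[%classic `*` setT : set (R * B)) (fun tw => U tw.1 tw.2).
  apply: measurable_caglad_bool => // t t0; apply: (filt_measurable_measurable t0).
  by apply/filt_measurableP => // A mA; exact: aU.
have mZ : measurable_fun (`[0%R, +oo[%classic `*` setT : set (R * B)) (fun tw => Z tw.1 tw.2).
  apply: measurable_cadlag => [t t0|w]; last by have [] := pZ w.
  apply: (filt_measurable_measurable t0).
  by apply/filt_measurableP => // A mA; exact: aZ.
have mb u : measurable_fun setT (fun z : R * Y => b_bar M u z.1 z.2).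
  have h x : measurable_fun setT (fun z : R * Y => b M u x z.2).
    exact: (measurableT_comp (hb u x).1 measurable_snd).
  have m1 : measurable_fun setT (fun z : R * Y => z.1) by exact: measurable_fst.
  apply: measurable_funD; first exact: measurable_funM.
  by apply: measurable_funM => //; apply: measurable_funB => //; exact: measurable_cst.
have mD : measurable (`[0%R, +oo[%classic `*` setT : set (R * B)) by exact: measurableX.
have mg u : measurable_fun (`[0%R, +oo[%classic `*` setT : set (R * B))
    (fun tw => b_bar M u (Z tw.1 tw.2).1 (Z tw.1 tw.2).2).
  exact: (measurableT_comp (mb u) mZ).
have -> : (fun tw : R * B => b_bar M (U tw.1 tw.2) (Z tw.1 tw.2).1 (Z tw.1 tw.2).2) =
  (fun tw => if U tw.1 tw.2 then b_bar M true (Z tw.1 tw.2).1 (Z tw.1 tw.2).2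
             else b_bar M false (Z tw.1 tw.2).1 (Z tw.1 tw.2).2).
  by apply/funext => tw; case: (U _ _).
by apply: measurable_fun_if => //; apply: measurable_funS (mg _) => // tw [].
Qed.

End control_reward.

Unset Implicit Arguments.

Theorem proposition2 (R : realType) (rho : R)
    (chi : R * R -> R * R) (chi_R : R -> R)
    (beta_H beta_R : bool -> R -> R) (sigma_R : R -> R)
    (K_R : R.-ker (bool * R)%type ~> R)
    (k k' : R) (M M' : model R) :
  0 < rho ->
  truncation_function chi chi_R ->
  bandit chi M chi_R k beta_H beta_R sigma_R K_R ->
  bandit chi M' chi_R k' beta_H beta_R sigma_R K_R ->
  k <= k' ->
  safe_optimal (V_se rho chi M) k `<=` safe_optimal (V_se rho chi M') k' /\
  ((forall (p : R) (y : R * R), 0 <= p <= 1 -> V_po rho chi M p y = V_se rho chi M p y) ->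
   (forall (p : R) (y : R * R), 0 <= p <= 1 -> V_po rho chi M' p y = V_se rho chi M' p y) ->
   safe_optimal (V_po rho chi M) k `<=` safe_optimal (V_po rho chi M') k').
Proof.
move=> rho0 hchi HM HM' kk'.
have main : safe_optimal (V_se rho chi M) k `<=` safe_optimal (V_se rho chi M') k'.
  move=> [p h] [/= p01 hV]; split => //= r.
  apply: ge_ereal_sup => _ [B [U [Z [sc Z0 ->]]]].
  have sc' := shifted_separated_control hchi HM HM' kk' sc.
  pose S := shifted k k' U Z.
  (* The clock starts at 0, so the shifted control has the same initial state and competes in the
     supremum for [M]. *)
  have le_k : (se_value rho M U S <= k%:E)%E.
    apply: le_trans (hV r); apply: ereal_sup_ubound; exists B, U, S; split => //.
    by move: Z0; apply: filterS => w; rewrite /S shifted0.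
  have a1 : A1 M by have [[_ [[]]]] := HM.
  have a1' : A1 M' by have [[_ [[]]]] := HM'.
  have [C hC] := b_bar_bound a1; have [C' hC'] := b_bar_bound a1'.
  have [_ _ _ pZ _] := sc.
  have sZ t w : 0 <= t -> 0 <= (Z t w).1 <= 1 by have [_ h'] := pZ w; exact: h'.
  have vC t w : 0 <= t -> `|b_bar M (U t w) (S t w).1 (S t w).2| <= Num.max C C'.
    by move=> t0; rewrite le_max hC//; exact: sZ.
  have v'C t w : 0 <= t -> `|b_bar M' (U t w) (Z t w).1 (Z t w).2| <= Num.max C C'.
    by move=> t0; rewrite le_max hC' ?orbT//; exact: sZ.
  (* The reward does not depend on [r]: on the risky arm both rates agree, on the safe arm they
     differ by exactly [k' - k]. *)
  have vv' t w : 0 <= t -> b_bar M' (U t w) (Z t w).1 (Z t w).2 <=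
      b_bar M (U t w) (S t w).1 (S t w).2 + (k' - k).
    move=> _; rewrite /S /shifted; move: (safe_clock _ _ _ _) => a.
    have [_ _ e _] := HM; have [_ _ e' _] := HM'.
    case: (Z t w) => q [h0 r0]; rewrite /b_bar/=.
    have [t1 f1] := e true h0 (r0 - a); have [t0 f0] := e false h0 (r0 - a).
    have [t1' f1'] := e' true h0 r0; have [t0' f0'] := e' false h0 r0.
    case: (U t w); first by rewrite t1 t0 t1' t0' lerDl subr_ge0.
    by rewrite f1 f0 f1' f0' /mix; lra.
  apply: le_trans (discounted_le rho0 (sb_prob B) (measurable_reward a1 sc')
    (measurable_reward a1' sc) vC v'C vv') _.
  apply: le_trans (leeD le_k (lexx _)) _.
  by rewrite -EFinD addrC subrK.
(* [safe_optimal] evaluates the value function only at beliefs in [[0, 1]], where [V_po] and [V_se]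
   are assumed to coincide. *)
split=> // poM poM' [p h] [/= p01 hV].
have [|_ hV'] := main (p, h); first by split => //= r; rewrite -poM.
by split => //= r; rewrite poM'.
Qed.
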